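(* Let $n\ge 2$. The $\mathbb{C}$-algebra isomorphism $\Psi:Y_n^>\to W^{(n)}$, $e_{i,r}\mapsto x_{i,1}^r$, restricts to a $\mathbb{Z}[\frac12]$-algebra isomorphism $\Psi:\mathbf{Y}_n^>\xrightarrow{\sim}\mathbf{W}^{(n)}$. Moreover, for finitely supported $h:\Delta^+\times\mathbb{N}\to\mathbb{N}$, the elements $\mathbf{E}_h=\prod^{\rightarrow}_{(\beta,r)}e_\beta(r)^{h(\beta,r)}/h(\beta,r)!$ (ordered product, see context) form a basis of the $\mathbb{Z}[\frac12]$-module $\mathbf{Y}_n^>$.
   Context: $\mathbb{N}=\{0,1,\dots\}$, $I=\{1,\dots,n-1\}$, $(c_{ij})$ the Cartan matrix of $\mathfrak{sl}_n$. $Y_n^>$: the $\mathbb{C}$-algebra generated by $e_{i,r}$ ($i\in I,r\in\mathbb{N}$) with relations $[e_{i,r+1},e_{j,s}]-[e_{i,r},e_{j,s+1}]=\frac{c_{ij}}{2}(e_{i,r}e_{j,s}+e_{j,s}e_{i,r})$; $[e_{i,r},e_{j,s}]=0$ if $c_{ij}=0$; $[e_{i,r_1},[e_{i,r_2},e_{j,s}]]+[e_{i,r_2},[e_{i,r_1},e_{j,s}]]=0$ if $c_{ij}=-1$. $\mathbf{Y}_n^>$: the $\mathbb{Z}[\frac12]$-subalgebra of $Y_n^>$ generated by $e_{i,r}^t/t!$ ($t\in\mathbb{N}$). $\Delta^+=\{[i,j]:1\le i\le j\le n-1\}$; $e_\beta(r)=[\cdots[e_{i,r},e_{i+1,0}],\dots,e_{j,0}]$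 for $\beta=[i,j]$. Order: $[i,j]\le[i',j']$ iff $i<i'$ or ($i=i'$, $j\le j'$); $(\beta,r)\le(\beta',r')$ iff $\beta<\beta'$ or ($\beta=\beta'$, $r\ge r'$); the product defining $\mathbf{E}_h$ is taken in increasing order. Shuffle algebra $W^{(n)}=\bigoplus_{\underline k\in\mathbb{N}^I}W^{(n)}_{\underline k}$: $W^{(n)}_{\underline k}$ consists of $\Sigma_{k_1}\times\dots\times\Sigma_{k_{n-1}}$-symmetric rational functions $F$ in $\{x_{i,r}\}_{i\in I,1\le r\le k_i}$ of the form $F=f/\prod_{i=1}^{n-2}\prod_{r\le k_i,r'\le k_{i+1}}(x_{i,r}-x_{i+1,r'})$ with $f$ a symmetric polynomial, vanishing whenever $x_{i,r_1}=x_{i+\epsilon,s}+\frac12=x_{i,r_2}+1$ ($\epsilon=\pm1$, $r_1\ne r_2$). Product: $F\star G=\sum_\sigma\sigma\big(F(\{x_{i,r}\}_{r\le k_i})G(\{x_{i',r'}\}_{r'>k_{i'}})\prod_{i,i'}\prod_{r\le k_i<r'}\zeta_{i,i'}(x_{i,r}-x_{i',r'})\big)$ for $F\in W_{\underline k}$, $G\in W_{\underline\ell}$, with $\zeta_{i,j}(z)=1+\frac{c_{ij}}{2z}$, sum over $\sigma=(\sigma_i)$, $\sigma_i\in\Sigma_{k_i+\ell_i}$ increasing on $\{1,\dots,k_i\}$ and on $\{k_i+1,\dots,k_i+\ell_i\}$. It is known that $e_{i,r}\mapsto x_{i,1}^r$ gives a $\mathbb{C}$-algebra isomorphism $\Psi:Y_n^>\to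 W^{(n)}$. $\mathbf{W}^{(n)}=\bigoplus_{\underline k}\mathbf{W}^{(n)}_{\underline k}$, where $\mathbf{W}^{(n)}_{\underline k}$ is the set of $F\in W^{(n)}_{\underline k}$ whose numerator $f$ has coefficients in $\mathbb{Z}[\frac12]$. *)

(* Defs.v *)
From HB Require Import structures.
From mathcomp Require Import all_boot all_order all_algebra all_fingroup.
From mathcomp Require Import Rstruct.
From mathcomp Require Import complex.
From mathcomp Require Import mpoly.
From Stdlib Require Rdefinitions.

Unset Implicit Arguments.
Unset Strict Implicit.
Unset Printing Implicit Defensive.

Import GRing.Theory Num.Theory.
Local Open Scope ring_scope.

Notation C := (complex Rdefinitions.R).

Definition dyadic (c : C) : Prop :=
  exists (a : int) (t : nat), c = a%:~R / (2%:R ^+ t).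

Definition commr {A : algType C} (x y : A) : A := x * y - y * x.

Section Defs.
(* m = n - 1 = number of nodes; node (i : 'I_m) is the paper's node i+1. *)
Variable m : nat.

Definition cartan (i j : 'I_m) : int :=
  if i == j then 2%:Z
  else if ((i.+1 == j :> nat) || (j.+1 == i :> nat)) then - 1%:Z else 0%:Z.
Definition cC (i j : 'I_m) : C := (cartan i j)%:~R.

Definition Yrel (A : algType C) (e : 'I_m -> nat -> A) : Prop :=
  [/\ forall i j r s,
        commr (e i r.+1) (e j s) - commr (e i r) (e j s.+1)
        = (cC i j / 2%:R) *: (e i r * e j s + e j s * e i r),
      forall i j r s, cartan i j = 0 -> commr (e i r) (e j s) = 0 &
      forall i j r1 r2 s, cartan i j = - 1%:Z ->
        commr (e i r1) (commr (e i r2) (e j s))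
        + commr (e i r2) (commr (e i r1) (e j s)) = 0].

Definition is_Yangian (A : algType C) (e : 'I_m -> nat -> A) : Prop :=
  Yrel A e /\
  forall (B : algType C) (b : 'I_m -> nat -> B), Yrel B b ->
    (exists phi : {lrmorphism A -> B}, forall i r, phi (e i r) = b i r) /\
    (forall phi1 phi2 : {lrmorphism A -> B},
        (forall i r, phi1 (e i r) = phi2 (e i r)) -> forall x, phi1 x = phi2 x).

Inductive Ybold (A : algType C) (e : 'I_m -> nat -> A) : A -> Prop :=
  | Yb_gen i r t : Ybold A e ((t`!%:R : C)^-1 *: (e i r ^+ t))
  | Yb_one : Ybold A e 1
  | Yb_add x y : Ybold A e x -> Ybold A e y -> Ybold A e (x + y)
  | Yb_opp x : Ybold A e x -> Ybold A e (- x)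
  | Yb_mul x y : Ybold A e x -> Ybold A e y -> Ybold A e (x * y)
  | Yb_half x : Ybold A e x -> Ybold A e ((2%:R : C)^-1 *: x).

Definition eroot (A : algType C) (e : 'I_m -> nat -> A) (i j : 'I_m) (r : nat) : A :=
  foldl (fun (acc : A) (k : 'I_m) => commr acc (e k 0%N)) (e i r)
        [seq k : 'I_m <- enum 'I_m | ((i < k)%N && (k <= j)%N)].

(* h : Delta^+ x N -> N, encoded as h i j r for beta = [i,j] (i <= j);
   admissible R h : h vanishes off Delta^+ and for r >= R. *)
Definition admissible (R : nat) (h : 'I_m -> 'I_m -> nat -> nat) : Prop :=
  (forall (i j : 'I_m) (r : nat), (j < i)%N -> h i j r = 0%N) /\
  (forall (i j : 'I_m) (r : nat), (R <= r)%N -> h i j r = 0%N).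

(* E_h, ordered product: beta increasing lexicographically, and for fixed
   beta, r decreasing (from R-1 down to 0); factors with r >= R are 1 when
   admissible R h holds. *)
Definition Eh (A : algType C) (e : 'I_m -> nat -> A) (R : nat)
    (h : 'I_m -> 'I_m -> nat -> nat) : A :=
  \prod_(i <- enum 'I_m) \prod_(j <- enum 'I_m | (i <= j)%N)
    \prod_(r <- rev (iota 0 R))
       (((h i j r)`!%:R : C)^-1 *: (eroot A e i j r ^+ h i j r)).

Definition degree := {ffun 'I_m -> nat}.
Definition deg0 : degree := [ffun => 0%N].
Definition delta (i : 'I_m) : degree := [ffun j => nat_of_bool (j == i)].
Definition degsub (K k : degree) : degree := [ffun i => (K i - k i)%N].

(* number of variables in degree K; variable x_{i,r+1} (r < K i) is the
   polynomial variable number offset K i + r *)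
Definition Nk (K : degree) : nat := (\sum_(i < m) K i)%N.
Definition offset (K : degree) (i : 'I_m) : nat := (\sum_(j < m | j < i) K j)%N.

(* a point: v i r = value of the variable x_{i,r+1} *)
Definition point := 'I_m -> nat -> C.

Definition flatpt (K : degree) (v : point) : 'I_(Nk K) -> C :=
  fun t => \sum_(i < m) \sum_(r < K i) (if (offset K i + r == t)%N then v i r else 0).

Definition evalK (K : degree) (f : {mpoly C[Nk K]}) (v : point) : C :=
  f.@[flatpt K v].

Definition Dk (K : degree) (v : point) : C :=
  \prod_(i < m) \prod_(j < m | (j == i.+1 :> nat))
    \prod_(r < K i) \prod_(s < K j) (v i r - v j s).

Definition ratK (K : degree) (f : {mpoly C[Nk K]}) (v : point) : C :=
  evalK K f v / Dk K v.

Definition injpt (K : degree) (v : point) : Prop :=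
  forall i i' r r', (r < K i)%N -> (r' < K i')%N -> v i r = v i' r' ->
    i = i' /\ r = r'.

Definition is_sym (K : degree) (f : {mpoly C[Nk K]}) : Prop :=
  forall (v : point) (s : 'I_m -> nat -> nat),
    (forall i r, (r < K i)%N -> (s i r < K i)%N) ->
    (forall i r r', (r < K i)%N -> (r' < K i)%N -> s i r = s i r' -> r = r') ->
    evalK K f (fun i r => v i (s i r)) = evalK K f v.

Definition wheel (K : degree) (f : {mpoly C[Nk K]}) : Prop :=
  forall (v : point) (i j : 'I_m) (r1 r2 s : nat),
    ((i.+1 == j :> nat) || (j.+1 == i :> nat)) ->
    (r1 < K i)%N -> (r2 < K i)%N -> (s < K j)%N -> r1 <> r2 ->
    v i r1 = v j s + 2%:R^-1 -> v j s + 2%:R^-1 = v i r2 + 1 ->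
    evalK K f v = 0.

(* an element of W = (+)_K W_K, given by the numerators of its components *)
Definition Wfam := forall K : degree, {mpoly C[Nk K]}.

Definition inW (F : Wfam) : Prop :=
  (exists B : nat, forall K : degree, (exists i, (B <= K i)%N) -> F K = 0) /\
  (forall K, is_sym K (F K) /\ wheel K (F K)).

Definition Wbold (F : Wfam) : Prop :=
  forall (K : degree) (mon : 'X_{1.. Nk K}), dyadic (F K)@_mon.

Definition zeta (i j : 'I_m) (z : C) : C := 1 + cC i j / (2%:R * z).

Definition Mk (K : degree) : nat := (Nk K).+1.

(* sigma = (sigma_i), sigma_i a permutation of {0,..,K_i - 1} (extended by
   the identity to 'I_(Mk K)) *)
Definition act (K : degree) (s : {ffun 'I_m -> {perm 'I_(Mk K)}}) (i : 'I_m)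
    (r : nat) : nat := s i (inord r).

Definition is_shuffle (K k : degree) (s : {ffun 'I_m -> {perm 'I_(Mk K)}}) : bool :=
  [forall i, [forall x : 'I_(Mk K), (K i <= x)%N ==> (s i x == x)] &&
   [forall x : 'I_(Mk K), forall y : 'I_(Mk K),
      [&& (x < y)%N, (y < K i)%N & ((y < k i)%N || (k i <= x)%N)]
        ==> (s i x < s i y)%N]].

(* sigma( F(x_{i,r<=k_i}) G(x_{i,r>k_i}) prod zeta ) evaluated at v *)
Definition shuffle_term (K k : degree) (f : {mpoly C[Nk k]})
    (g : {mpoly C[Nk (degsub K k)]}) (s : {ffun 'I_m -> {perm 'I_(Mk K)}})
    (v : point) : C :=
  let u1 : point := fun i r => v i (act K s i r) in
  let u2 : point := fun i r => v i (act K s i (k i + r)) in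
  ratK k f u1 * ratK (degsub K k) g u2 *
  \prod_(i < m) \prod_(j < m) \prod_(r < k i) \prod_(r' < K j - k j)
     zeta i j (u1 i r - u2 j r').

Definition shuffle_prod_at (F G : Wfam) (K : degree) (v : point) : C :=
  \sum_(kk : {ffun 'I_m -> 'I_(Mk K)} | [forall i, (kk i <= K i)%N])
    let k : degree := [ffun i => (kk i : nat)] in
    \sum_(s | is_shuffle K k s) shuffle_term K k (F k) (G (degsub K k)) s v.

Definition Psi_hom (A : algType C) (e : 'I_m -> nat -> A) (Psi : A -> Wfam) : Prop :=
  [/\ forall a b K, Psi (a + b) K = Psi a K + Psi b K,
      forall (c : C) a K, Psi (c *: a) K = c *: Psi a K,
      forall K, Psi 1 K = (if K == deg0 then 1 else 0),
      forall a b K v, injpt K v ->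
        ratK K (Psi (a * b) K) v = shuffle_prod_at (Psi a) (Psi b) K v &
      forall i r K,
        (K = delta i -> forall v, evalK K (Psi (e i r) K) v = v i 0%N ^+ r) /\
        (K <> delta i -> Psi (e i r) K = 0)].

Definition Psi_bij (A : algType C) (Psi : A -> Wfam) : Prop :=
  [/\ forall a, inW (Psi a),
      forall a b, (forall K, Psi a K = Psi b K) -> a = b &
      forall F, inW F -> exists a, forall K, Psi a K = F K].

End Defs.

(* Main.v *)
Require Import Defs.
From HB Require Import structures.
From mathcomp Require Import all_boot all_order all_algebra all_fingroup.
From mathcomp Require Import Rstruct complex mpoly.
From mathcomp Require Import ring lra zify.
From Stdlib Require Import ClassicalEpsilon FunctionalExtensionality.
Set Implicit Arguments.
Unset Strict Implicit.
Unset Printing Implicit Defensive.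
Import Order.TTheory GRing.Theory Num.Theory.
Local Open Scope ring_scope.

(* The value of [Psi a] at a finite list of coloured points, cleared of denominators, is a function [N a] on
   lists; the shuffle product becomes a sum over all ways to split the list, weighted by [om1].  Grading by degree
   replaces [om1] by its leading term [om0], and the top component of [N (E_h)] is the product [mono] of the divided
   powers of the elementary functions [eps].

   For the product with weight [om0], the functions [mono] span every integral function with the limiting wheel
   condition: specialize the points of colours [i..j] to a single value, where the wheel condition forces
   divisibility by [cw], and let the quotient (the residue) be spanned by induction on the number of points.  The
   symmetry of iterated residues makes the residues match those of a combination of monomials.  Longer strings come
   first, so that the divisibility statements for the shorter ones hold.  The same residues give linear
   independence.  Subtracting leading terms lifts both facts to [Psi].

   That [E_h] is in the integral form follows from [e_(i,j+1)(r)^(k) = sum_a (-1)^a y^(a) x^(k) y^(k-a)] with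
   [x = e_(i,j)(r)] and [y = e_(j+1)(0)]; that the integral form has integral numerators follows from
   [Psi (e_(i,0)^k / k!) = 1]. *)

(** * Polynomial functions with coefficients in a subring *)

(** The obstacle is integrality: solving for coefficients over a field would create denominators.
    Only differences of two variables are ever divided out, and these are monic, so quotients stay
    over any subring [S]. The elimination itself divides by nothing, because the residue of a
    divided monomial is, up to sign, a divided monomial with one generator removed; ordinary powers
    would produce multiplicities. That the divided monomials are integral and satisfy the limiting
    wheel condition is not checked by combinatorics. Each is the top component of the numerator of
    some [E_h], which is integral since [E_h] lies in the integral form and obeys the wheel
    condition since [Psi] lands in the shuffle algebra. The spanning argument therefore takes this
    as a hypothesis, discharged only once the algebra is available. Residues are taken for the
    undeformed product because its weight vanishes for adjacent colours at one position, so a string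
    is never torn between two factors. Numerators become functions on lists so that specializing,
    permuting and splitting are plain list operations; identities known only at distinct points
    extend by density. *)

Section PolynomialFunctions.
Variable R : numFieldType.
Implicit Types (S : R -> Prop) (v w : nat -> R) (f g : (nat -> R) -> R).

Definition subringP S :=
  [/\ S 1, forall x y, S x -> S y -> S (x - y) & forall x y, S x -> S y -> S (x * y)].

Section SubringTheory.
Variable S : R -> Prop.
Hypothesis SS : subringP S.

Lemma subring1 : S 1. Proof. by case: SS. Qed.
Lemma subringB x y : S x -> S y -> S (x - y). Proof. by case: SS => _ h _; exact: h. Qed.
Lemma subringM x y : S x -> S y -> S (x * y). Proof. by case: SS => _ _ h; exact: h. Qed.
Lemma subring0 : S 0. Proof. by rewrite -(subrr 1); apply: subringB; exact: subring1. Qed.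
Lemma subringN x : S x -> S (- x).
Proof. by move=> Sx; rewrite -sub0r; apply: subringB => //; exact: subring0. Qed.
Lemma subringD x y : S x -> S y -> S (x + y).
Proof. by move=> Sx Sy; rewrite -(opprK y); apply: subringB => //; exact: subringN. Qed.
Lemma subring_nat n : S n%:R.
Proof. by elim: n => [|n IH]; [exact: subring0|rewrite -natr1; apply: subringD => //; exact: subring1]. Qed.
Lemma subring_sign n : S ((-1) ^+ n).
Proof.
elim: n => [|n IH]; first by rewrite expr0; exact: subring1.
by rewrite exprS; apply: subringM => //; apply: subringN; exact: subring1.
Qed.
Lemma subring_sum (I : Type) (r : seq I) (P : pred I) (F : I -> R) :
  (forall i, P i -> S (F i)) -> S (\sum_(i <- r | P i) F i).
Proof. by move=> h; elim/big_ind: _ => //; [exact: subring0|exact: subringD]. Qed.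
End SubringTheory.

(** Infinitely many variables are available, so substitution and renaming never change the ambient
    ring. The index bounds the degree, and [polyf_ext] makes pointwise equality sufficient. *)
Inductive polyf S : nat -> ((nat -> R) -> R) -> Prop :=
| polyf_const c : S c -> polyf S 0 (fun=> c)
| polyf_var i : polyf S 1 (fun v => v i)
| polyf_add d f g : polyf S d f -> polyf S d g -> polyf S d (fun v => f v + g v)
| polyf_mul d d' f g : polyf S d f -> polyf S d' g -> polyf S (d + d') (fun v => f v * g v)
| polyf_leq d d' f : (d <= d')%N -> polyf S d f -> polyf S d' f
| polyf_ext d f g : f =1 g -> polyf S d f -> polyf S d g.

Lemma polyf_weaken S S' d f : (forall x, S x -> S' x) -> polyf S d f -> polyf S' d f.
Proof.
move=> h; elim=> {d f} [c /h Sc|i|d f g _ IHf _ IHg|d d' f g _ IHf _ IHg|d d' f le _ IH|d f g fg _ IH].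
- exact: polyf_const.
- exact: polyf_var.
- exact: polyf_add.
- exact: polyf_mul.
- exact: polyf_leq le IH.
- exact: polyf_ext fg IH.
Qed.

Section Closure.
Variable S : R -> Prop.
Hypothesis SS : subringP S.

Lemma polyf_cst d c : S c -> polyf S d (fun=> c).
Proof. by move=> Sc; apply: polyf_leq (polyf_const Sc). Qed.

Lemma polyf0 d : polyf S d (fun=> 0).
Proof. by apply: polyf_cst; exact: subring0. Qed.

Lemma polyf_scale d c f : S c -> polyf S d f -> polyf S d (fun v => c * f v).
Proof. by move=> Sc Pf; rewrite -[d]add0n; apply: polyf_mul Pf; exact: polyf_const. Qed.

Lemma polyf_opp d f : polyf S d f -> polyf S d (fun v => - f v).
Proof.
move=> Pf; apply: (@polyf_ext _ _ (fun v => -1 * f v)) => [v|]; first by rewrite mulN1r.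
by apply: polyf_scale => //; apply: subringN => //; exact: subring1.
Qed.

Lemma polyf_sub d f g : polyf S d f -> polyf S d g -> polyf S d (fun v => f v - g v).
Proof. by move=> Pf Pg; apply: polyf_add => //; exact: polyf_opp. Qed.

Lemma polyf_sum (I : Type) (r : seq I) (Q : pred I) d (F : I -> (nat -> R) -> R) :
  (forall i, Q i -> polyf S d (F i)) -> polyf S d (fun v => \sum_(i <- r | Q i) F i v).
Proof.
move=> h; elim: r => [|i r IH].
  by apply: polyf_ext (polyf0 d) => v; rewrite big_nil.
case Qi: (Q i); last by apply: polyf_ext IH => v; rewrite big_cons Qi.
by apply: polyf_ext (polyf_add (h i Qi) IH) => v; rewrite big_cons Qi.
Qed.

Lemma polyf_expr d k f : polyf S d f -> polyf S (k * d) (fun v => f v ^+ k).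
Proof.
move=> Pf; elim: k => [|k IH].
  by apply: (@polyf_ext _ _ (fun=> 1)) => [v|]; [rewrite expr0|apply: polyf_cst; exact: subring1].
rewrite mulSn; apply: polyf_ext (polyf_mul Pf IH) => v; by rewrite exprS.
Qed.

Lemma polyf_subst d f (s : nat -> (nat -> R) -> R) :
  polyf S d f -> (forall i, polyf S 1 (s i)) -> polyf S d (fun v => f (fun i => s i v)).
Proof.
move=> Pf Ps; elim: Pf => {d f} [c Sc|i|d f g _ IHf _ IHg|d d' f g _ IHf _ IHg|d d' f le _ IH|d f g fg _ IH].
- exact: polyf_const.
- exact: Ps.
- exact: polyf_add.
- exact: polyf_mul.
- exact: polyf_leq le IH.
- by apply: polyf_ext IH => v.
Qed.

(** The coefficients of the expansion in [t] are again integral in [v]. With [be] a unit vector this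
    extracts coefficients in one variable, with [al = 0] homogeneous components. *)
Lemma polyf_affine_subst d f (al be : nat -> (nat -> R) -> R) :
  polyf S d f -> (forall i, polyf S 1 (al i)) -> (forall i, polyf S 1 (be i)) ->
  exists2 fk : nat -> (nat -> R) -> R, (forall k, polyf S d (fk k)) &
  forall t v, f (fun i => al i v + t * be i v) = \sum_(k < d.+1) t ^+ k * fk k v.
Proof.
move=> Pf Pal Pbe; elim: Pf => {d f} [c Sc|i|d f g _ [fk Pfk fE] _ [gk Pgk gE]|d d' f g _ [fk Pfk fE] _ [gk Pgk gE]
                  |d d' f le _ [fk Pfk fE]|d f g fg _ [fk Pfk fE]].
- by exists (fun=> fun=> c) => [k|t v]; [exact: polyf_const|rewrite big_ord1 expr0 mul1r].
- exists (fun k => if k is 0 then al i else be i) => [[|k]//|t v].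
  by rewrite 2!big_ord_recl big_ord0 expr0 mul1r addr0 /=.
- exists (fun k v => fk k v + gk k v) => [k|t v]; first exact: polyf_add.
  by rewrite fE gE -big_split; apply: eq_bigr => k _; rewrite mulrDr.
- exists (fun k v => \sum_(p : 'I_d.+1 * 'I_d'.+1 | (p.1 + p.2 == k)%N) fk p.1 v * gk p.2 v) => [k|t v].
    by apply: polyf_sum => p _; apply: polyf_mul.
  rewrite fE gE mulr_suml.
  under eq_bigr do rewrite mulr_sumr.
  rewrite pair_big /=.
  rewrite (partition_big (fun p : 'I_d.+1 * 'I_d'.+1 => inord (p.1 + p.2) : 'I_(d + d').+1) predT) //=.
  apply: eq_bigr => k _; rewrite mulr_sumr.
  have inE (p : 'I_d.+1 * 'I_d'.+1) : (inord (p.1 + p.2) == k :> 'I_(d+d').+1) = (p.1 + p.2 == k)%N.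
    rewrite -val_eqE /= inordK // ltnS leq_add //; [have := ltn_ord p.1|have := ltn_ord p.2]; by rewrite ltnS.
  apply: eq_big => [p|p]; first by rewrite inE.
  by rewrite inE => /eqP <-; rewrite exprD mulrACA.
- exists (fun k => if (k <= d)%N then fk k else fun=> 0) => [k|t v].
    by case: ifP => _; [apply: polyf_leq (Pfk k)|exact: polyf0].
  rewrite fE (big_ord_widen d'.+1 (fun k => t ^+ k * fk k v)) ?ltnS // big_mkcond /=.
  by apply: eq_bigr => k _; rewrite ltnS; case: ifP; rewrite ?mulr0.
- by exists fk => // t v; rewrite -fg.
Qed.

Definition upd v a x : nat -> R := fun i => if i == a then x else v i.

(** Dividing by [v a - v b] is dividing by a monic polynomial in [v a], so the quotient stays over
    [S]. The product case is a discrete Leibniz rule. *)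
Lemma polyf_factor d f a b : polyf S d f ->
  exists2 g, polyf S d g & forall v, f v - f (upd v a (v b)) = (v a - v b) * g v.
Proof.
elim=> {d f} [c Sc|i|d f g _ [fk Pfk fE] _ [gk Pgk gE]|d d' f g Pf [fk Pfk fE] Pg [gk Pgk gE]
                  |d d' f le _ [fk Pfk fE]|d f g fg _ [fk Pfk fE]].
- by exists (fun=> 0) => [|v]; [exact: polyf0|rewrite subrr mulr0].
- rewrite /upd; case: (i =P a) => [->|_].
    by exists (fun=> 1) => [|v]; [apply: polyf_cst; exact: subring1|rewrite mulr1].
  by exists (fun=> 0) => [|v]; [exact: polyf0|rewrite subrr mulr0].
- exists (fun v => fk v + gk v) => [|v]; first exact: polyf_add.
  by rewrite mulrDr -fE -gE opprD addrACA.
- exists (fun v => fk v * g v + f (upd v a (v b)) * gk v) => [|v].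
    apply: polyf_add; first exact: polyf_mul.
    apply: polyf_mul => //.
    apply: (polyf_subst (s := fun i v => if i == a then v b else v i)) => // i.
    by case: (i == a); exact: polyf_var.
  rewrite mulrDr mulrA -fE [_ * (f _ * _)]mulrCA -gE mulrBl mulrBr addrA subrK //.
- by exists fk => //; apply: polyf_leq Pfk.
- by exists fk => // v; rewrite -!fg.
Qed.
End Closure.

Lemma polyf_eq S d f v w : polyf S d f -> v =1 w -> f v = f w.
Proof.
move=> Pf vw; elim: Pf => {d f} [c Sc|i|d f g _ IHf _ IHg|d d' f g _ IHf _ IHg|//|d f g fg _ IH].
- by [].
- exact: vw.
- by rewrite IHf IHg.
- by rewrite IHf IHg.
- by rewrite -!fg.
Qed.

Lemma polyf_in S d f v : subringP S -> (forall i, S (v i)) -> polyf S d f -> S (f v).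
Proof.
move=> SS Sv; elim=> {d f} // [d f g _ Sf _ Sg|d d' f g _ Sf _ Sg|d f g fg _ Sf].
- exact: subringD.
- exact: subringM.
- by rewrite -fg.
Qed.

Definition anyR : R -> Prop := fun=> True.

Lemma subring_any : subringP anyR. Proof. by []. Qed.

Lemma polyf_line S d f v w : polyf S d f ->
  exists2 q : {poly R}, (size q <= d.+1)%N & forall t, f (fun i => v i + t * w i) = q.[t].
Proof.
move=> Pf0; have Pf := polyf_weaken (S' := anyR) (fun _ _ => I) Pf0.
have [||fk _ fE] := polyf_affine_subst subring_any (f := f) (d := d)
  (al := fun i _ => v i) (be := fun i _ => w i) Pf; try by move=> i; exact: polyf_cst.
exists (\poly_(k < d.+1) fk k v); first exact: size_poly.
by move=> t; rewrite (fE t v) horner_poly; apply: eq_bigr => k _; rewrite mulrC.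
Qed.

Lemma poly_cofinite_eq0 (s : seq R) (q : {poly R}) : (forall t, t \notin s -> q.[t] = 0) -> q = 0.
Proof.
move=> h; pose N := (size q + size s)%N.
pose ns : seq R := [seq i%:R | i <- iota 0 N].
pose rs : seq R := [seq x <- ns | x \notin s].
have U : uniq ns by rewrite map_inj_uniq ?iota_uniq //; exact: mulrIn (oner_neq0 R).
apply: (@roots_geq_poly_eq0 _ q rs).
- by apply/allP => x; rewrite mem_filter => /andP[xs _]; rewrite /root h.
- exact: filter_uniq.
- rewrite size_filter -(leq_add2r (size s)) -/N.
  have <- : size ns = N by rewrite size_map size_iota.
  rewrite -(count_predC (fun x => x \notin s)) leq_add2l.
  rewrite -size_filter; apply: uniq_leq_size; first exact: filter_uniq.
  by move=> x; rewrite mem_filter /= negbK => /andP[].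
Qed.

Lemma poly_cofinite_eq (s : seq R) (p q : {poly R}) :
  (forall t, t \notin s -> p.[t] = q.[t]) -> p = q.
Proof.
move=> h; apply/eqP; rewrite -subr_eq0; apply/eqP; apply: (@poly_cofinite_eq0 s) => t ts.
by rewrite hornerD hornerN h // subrr.
Qed.

Definition injn n v := forall a b, (a < n)%N -> (b < n)%N -> v a = v b -> a = b.

(** The line through [v] in direction (0, 1, 2, ...) meets each locus where two coordinates agree in
    at most one parameter, so [f] vanishes along almost all of the line and hence at [v]. *)
Lemma polyf_density S d f n : polyf S d f ->
  (forall v, injn n v -> f v = 0) -> forall v, f v = 0.
Proof.
move=> Pf h v; have [q _ qE] := polyf_line v (fun i => i%:R) Pf.
suff q0 : q = 0.
  have := qE 0; rewrite q0 horner0 => <-; apply: polyf_eq Pf _ => i; by rewrite mul0r addr0.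
(* The parameters at which two coordinates of the line meet; a pair of equal indices only adds the
   harmless value 0. *)
pose s := [seq (v p.2 - v p.1) / (p.1%:R - p.2%:R) | p <- allpairs pair (iota 0 n) (iota 0 n)].
apply: (@poly_cofinite_eq0 s) => t ts; rewrite -qE; apply: h => a b an bn /eqP E.
apply/eqP; apply: contraNT ts => ab; apply/mapP; exists (a, b) => /=.
  by apply/allpairsP; exists (a, b); rewrite !mem_iota.
have nz : a%:R - b%:R != 0 :> R by rewrite subr_eq0 eqr_nat.
apply: (mulIf nz); rewrite divfK // mulrBr.
move: E; rewrite -subr_eq0 opprD addrACA addrC addr_eq0 opprB => /eqP ->.
by [].
Qed.

Lemma polyf_cancel S d g a b : a != b -> polyf S d g ->
  (forall v, (v a - v b) * g v = 0) -> forall v, g v = 0.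
Proof.
move=> ab Pg h; apply: (polyf_density (n := (maxn a b).+1) Pg) => v iv.
have /eqP := h v; rewrite mulf_eq0 subr_eq0 => /orP[/eqP E|/eqP//].
by move: ab; rewrite (iv a b _ _ E) ?eqxx // ltnS ?leq_maxl ?leq_maxr.
Qed.

Lemma polyf_divide S d f a b : subringP S -> polyf S d f ->
  (forall v, v a = v b -> f v = 0) ->
  exists2 g, polyf S d g & forall v, f v = (v a - v b) * g v.
Proof.
move=> SS Pf h; have [g Pg gE] := polyf_factor SS a b Pf.
exists g => // v; rewrite -gE (h (upd v a (v b))) ?subr0 // /upd eqxx; by case: eqP.
Qed.

Definition polyfn S f := exists d, polyf S d f.

Section UngradedClosure.
Variable S : R -> Prop.
Hypothesis SS : subringP S.

Lemma polyfn_cst c : S c -> polyfn S (fun=> c).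
Proof. by exists 0%N; exact: polyf_const. Qed.

Lemma polyfn_var i : polyfn S (fun v => v i).
Proof. by exists 1%N; exact: polyf_var. Qed.

Lemma polyfn_ext f g : f =1 g -> polyfn S f -> polyfn S g.
Proof. by move=> fg [d Pf]; exists d; exact: polyf_ext fg Pf. Qed.

Lemma polyfn_mul f g : polyfn S f -> polyfn S g -> polyfn S (fun v => f v * g v).
Proof. by move=> [d Pf] [d' Pg]; exists (d + d')%N; exact: polyf_mul. Qed.

Lemma polyfn_add f g : polyfn S f -> polyfn S g -> polyfn S (fun v => f v + g v).
Proof.
move=> [d Pf] [d' Pg]; exists (maxn d d'); apply: polyf_add.
  exact: polyf_leq (leq_maxl _ _) Pf.
exact: polyf_leq (leq_maxr _ _) Pg.
Qed.

Lemma polyfn_scale c f : S c -> polyfn S f -> polyfn S (fun v => c * f v).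
Proof. by move=> Sc Pf; apply: polyfn_mul => //; exact: polyfn_cst. Qed.

Lemma polyfn_opp f : polyfn S f -> polyfn S (fun v => - f v).
Proof. by move=> [d Pf]; exists d; exact: polyf_opp. Qed.

Lemma polyfn_sub f g : polyfn S f -> polyfn S g -> polyfn S (fun v => f v - g v).
Proof. by move=> Pf Pg; apply: polyfn_add => //; exact: polyfn_opp. Qed.

Lemma polyfn_subst f (s : nat -> nat) : polyfn S f -> polyfn S (fun v => f (fun i => v (s i))).
Proof.
by move=> [d Pf]; exists d; apply: (polyf_subst (s := fun i v => v (s i))) => // i; exact: polyf_var.
Qed.

Lemma polyfn_sum (I : eqType) (r : seq I) (Q : pred I) (F : I -> (nat -> R) -> R) :
  (forall i, i \in r -> Q i -> polyfn S (F i)) -> polyfn S (fun v => \sum_(i <- r | Q i) F i v).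
Proof.
elim: r => [|i r IH] h.
  by apply: polyfn_ext (polyfn_cst (subring0 SS)) => v; rewrite big_nil.
have {}IH : polyfn S (fun v => \sum_(i <- r | Q i) F i v).
  by apply: IH => j jr; apply: h; rewrite inE jr orbT.
case Qi: (Q i); last by apply: polyfn_ext IH => v; rewrite big_cons Qi.
apply: polyfn_ext (polyfn_add (h i _ Qi) IH) => [v|]; first by rewrite big_cons Qi.
by rewrite inE eqxx.
Qed.

Lemma polyfn_prod (I : eqType) (r : seq I) (Q : pred I) (F : I -> (nat -> R) -> R) :
  (forall i, i \in r -> Q i -> polyfn S (F i)) -> polyfn S (fun v => \prod_(i <- r | Q i) F i v).
Proof.
elim: r => [|i r IH] h.
  by apply: polyfn_ext (polyfn_cst (subring1 SS)) => v; rewrite big_nil.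
have {}IH : polyfn S (fun v => \prod_(i <- r | Q i) F i v).
  by apply: IH => j jr; apply: h; rewrite inE jr orbT.
case Qi: (Q i); last by apply: polyfn_ext IH => v; rewrite big_cons Qi.
apply: polyfn_ext (polyfn_mul (h i _ Qi) IH) => [v|]; first by rewrite big_cons Qi.
by rewrite inE eqxx.
Qed.

Lemma polyfn_expr k f : polyfn S f -> polyfn S (fun v => f v ^+ k).
Proof. by move=> [d Pf]; exists (k * d)%N; exact: polyf_expr. Qed.
End UngradedClosure.
End PolynomialFunctions.

(** * Functions on lists of coloured points *)

Section ListFunctions.
Variable R : numFieldType.

(* A variable is a pair (colour, value); a list of variables is a point of the configuration space. *)
Notation elt := (nat * R)%type.
Implicit Types (F G H : seq elt -> R) (L A B : seq elt) (x y : elt) (v : nat -> R).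

(** A template [l] lists colours together with variable indices, and [v] fills in the values;
    polynomiality of a function on lists is tested template by template. *)
Definition inst v (l : seq (nat * nat)) : seq elt := [seq (c.1, v c.2) | c <- l].

Lemma inst_cat v l l' : inst v (l ++ l') = inst v l ++ inst v l'.
Proof. exact: map_cat. Qed.

Lemma inst_cons v c l : inst v (c :: l) = (c.1, v c.2) :: inst v l.
Proof. by []. Qed.

Definition lpolyd (S : R -> Prop) d F := forall l, polyf S d (fun v => F (inst v l)).
Definition lpoly (S : R -> Prop) F := forall l, polyfn S (fun v => F (inst v l)).
Definition lsym F := forall L L', perm_eq L L' -> F L = F L'.

Section Product.
Variable om : elt -> elt -> R.

Definition ins x F := fun L => F (x :: L).
Definition twl x F := fun L => F L * \prod_(b <- L) om x b.
Definition twr x F := fun L => F L * \prod_(a <- L) om a x.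

(** The head goes to one of the two factors; its weights against the later points of the other
    factor are stored in the twist of that factor. *)
Fixpoint op F G L := if L is x :: L' then
  op (ins x F) (twl x G) L' + op (twr x F) (ins x G) L' else F [::] * G [::].

Fixpoint splits (T : Type) (s : seq T) : seq (seq T * seq T) :=
  if s is x :: s' then [seq (x :: p.1, p.2) | p <- splits s'] ++ [seq (p.1, x :: p.2) | p <- splits s']
  else [:: ([::], [::])].

Lemma splits_perm (T : eqType) (s : seq T) p : p \in splits s -> perm_eq s (p.1 ++ p.2).
Proof.
elim: s p => [|y s IH] p /=; first by rewrite inE => /eqP ->.
rewrite mem_cat => /orP[] /mapP[q /IH qE ->] /=; first by rewrite perm_cons.
by rewrite -[y :: q.2]cat1s perm_sym perm_catCA perm_cons perm_sym.
Qed.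

Definition weight A B := \prod_(a <- A) \prod_(b <- B) om a b.

Lemma op_splits F G L : op F G L = \sum_(p <- splits L) F p.1 * G p.2 * weight p.1 p.2.
Proof.
elim: L F G => [|x L IH] F G /=; first by rewrite big_seq1 /weight big_nil mulr1.
rewrite big_cat !big_map /= !IH; congr (_ + _); apply: eq_bigr => p _.
  by rewrite /weight big_cons /ins /twl -!mulrA; congr (_ * (_ * _)).
rewrite /weight /ins /twr [in RHS](eq_bigr (fun a => om a x * \prod_(b <- p.2) om a b)) => [|a _]; last by rewrite big_cons.
by rewrite big_split /= -!mulrA; congr (_ * _); rewrite mulrCA.
Qed.

Lemma eq_op F F' G G' : F =1 F' -> G =1 G' -> op F G =1 op F' G'.
Proof. by move=> eF eG L; rewrite !op_splits; apply: eq_bigr => p _; rewrite eF eG. Qed.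

Lemma opDl F F' G L : op (fun A => F A + F' A) G L = op F G L + op F' G L.
Proof. by rewrite !op_splits -big_split; apply: eq_bigr => p _ /=; rewrite -!mulrDl. Qed.

Lemma opDr F G G' L : op F (fun A => G A + G' A) L = op F G L + op F G' L.
Proof. by rewrite !op_splits -big_split; apply: eq_bigr => p _ /=; rewrite -mulrDl -mulrDr. Qed.

Lemma opZl c F G L : op (fun A => c * F A) G L = c * op F G L.
Proof. by rewrite !op_splits mulr_sumr; apply: eq_bigr => p _; rewrite !mulrA. Qed.

Lemma opZr c F G L : op F (fun A => c * G A) L = c * op F G L.
Proof. by rewrite !op_splits mulr_sumr; apply: eq_bigr => p _; rewrite -!mulrA mulrCA. Qed.

Lemma op0l F L : op (fun=> 0) F L = 0.
Proof. by rewrite op_splits big1 // => p _; rewrite !mul0r. Qed.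

Lemma op0r F L : op F (fun=> 0) L = 0.
Proof. by rewrite op_splits big1 // => p _; rewrite mulr0 mul0r. Qed.

Lemma op_sumr (I : Type) (r : seq I) (P : pred I) F (c : I -> R) (G : I -> seq elt -> R) L :
  op F (fun A => \sum_(i <- r | P i) c i * G i A) L = \sum_(i <- r | P i) c i * op F (G i) L.
Proof.
rewrite op_splits (eq_bigr (fun p => \sum_(i <- r | P i) c i * (F p.1 * G i p.2 * weight p.1 p.2))).
  by rewrite exchange_big; apply: eq_bigr => i _; rewrite op_splits mulr_sumr.
move=> p _; rewrite mulr_sumr mulr_suml; apply: eq_bigr => i _.
by rewrite [F p.1 * (c i * _)]mulrCA !mulrA.
Qed.

Definition lone L : R := if L is [::] then 1 else 0.

Lemma op1l F L : op lone F L = F L.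
Proof.
elim: L F => [|x L IH] F /=; first by rewrite mul1r.
rewrite (eq_op (F' := fun=> 0) (G' := twl x F)) // op0l add0r.
rewrite -[RHS](IH (ins x F)); apply: eq_op => // -[|a A]; rewrite /twr /= ?big_nil ?mulr1 //.
by rewrite mul0r.
Qed.

Lemma op1r F L : op F lone L = F L.
Proof.
elim: L F => [|x L IH] F /=; first by rewrite mulr1.
rewrite [X in _ + X](eq_op (F' := twr x F) (G' := fun=> 0)) // op0r addr0.
rewrite -[RHS](IH (ins x F)); apply: eq_op => // -[|a A]; rewrite /twl /= ?big_nil ?mulr1 //.
by rewrite mul0r.
Qed.

(** A product of [chi] over all points factors along every splitting, so twisting by a character is
    an automorphism of the product. Associativity, the Leibniz rule for strings and the passage from
    [e i 0] to [e i r] rest on this. *)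
Lemma op_mulchar (chi : elt -> R) F G L :
  op (fun A => F A * \prod_(a <- A) chi a) (fun B => G B * \prod_(b <- B) chi b) L
   = op F G L * \prod_(a <- L) chi a.
Proof.
rewrite !op_splits mulr_suml.
rewrite big_seq [RHS]big_seq; apply: eq_bigr => p /splits_perm pL; rewrite (perm_big _ pL) big_cat /=.
by rewrite [in RHS]mulrAC [in LHS](mulrACA (F p.1)).
Qed.

Lemma twl_op x F G : twl x (op F G) =1 op (twl x F) (twl x G).
Proof. by move=> L; rewrite /twl op_mulchar. Qed.

(* Consecutive entries of [U] have weight [0], so no term of the product separates them. *)
Lemma op_chain x U F G L : path (fun a b => om a b == 0) x U ->
  op F (twl x G) (U ++ L) =
  op (fun A => F (U ++ A)) (fun B => G B * \prod_(b <- B) \prod_(a <- x :: U) om a b) L.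
Proof.
elim: U x F G => [|u U IH] x F G /=.
  by move=> _; apply: eq_op => // B; congr (_ * _); apply: eq_bigr => b _; rewrite big_seq1.
case/andP=> /eqP xu Up; rewrite (IH u (ins u F) (twl x G) Up).
rewrite [X in _ + X](eq_op (F' := twr u F) (G' := fun=> 0)) // => [|B]; last first.
  by rewrite /ins /twl big_cons xu mul0r mulr0.
rewrite op0r addr0; apply: eq_op => // B; rewrite /twl -mulrA -big_split; congr (_ * _).
by apply: eq_bigr => b _; rewrite [in RHS]big_cons.
Qed.

Hypothesis omC : forall x y, om x y = om y x.

Lemma twlr x F : twr x F =1 twl x F.
Proof. by move=> L; rewrite /twl /twr; congr (_ * _); apply: eq_bigr => a _; rewrite omC. Qed.

Lemma opC F G : op F G =1 op G F.
Proof.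
move=> L; elim: L F G => [|x L IH] F G /=; first by rewrite mulrC.
rewrite addrC IH [X in _ + X]IH; congr (_ + _); apply: eq_op => //; first exact: twlr.
by move=> A; rewrite twlr.
Qed.

Lemma opA F G H : op F (op G H) =1 op (op F G) H.
Proof.
move=> L; elim: L F G H => [|x L IH] F G H /=; first by rewrite mulrA.
rewrite (eq_op (fun=> erefl) (@twl_op x G H)) IH.
rewrite [ins x (op G H)](_ : _ = fun A => op (ins x G) (twl x H) A + op (twr x G) (ins x H) A) //.
rewrite opDr !IH [ins x (op F G)](_ : _ = fun A => op (ins x F) (twl x G) A + op (twr x F) (ins x G) A) //.
rewrite opDl -!addrA; congr (_ + (_ + _)).
apply: eq_op => // A; rewrite twlr twl_op; apply: eq_op => B; by rewrite twlr.
Qed.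
End Product.

Lemma splits_inst v l : splits (inst v l) = [seq (inst v p.1, inst v p.2) | p <- splits l].
Proof. by rewrite /inst; elim: l => //= a l ->; rewrite map_cat -!map_comp. Qed.

Lemma lpoly_op S F G om : subringP S ->
  (forall a b, polyfn S (fun v => om (a.1, v a.2) (b.1, v b.2))) ->
  lpoly S F -> lpoly S G -> lpoly S (op om F G).
Proof.
move=> SS Pom PF PG l.
apply: (@polyfn_ext _ _ (fun v => \sum_(p <- splits l) F (inst v p.1) * G (inst v p.2) * weight om (inst v p.1) (inst v p.2))).
  by move=> v; rewrite op_splits splits_inst big_map.
apply: polyfn_sum => // p _ _; apply: polyfn_mul; first exact: polyfn_mul.
apply: (@polyfn_ext _ _ (fun v => \prod_(a <- p.1) \prod_(b <- p.2) om (a.1, v a.2) (b.1, v b.2))).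
  by move=> v; rewrite /weight /inst big_map; apply: eq_bigr => a _; rewrite big_map.
by apply: polyfn_prod => // a _ _; apply: polyfn_prod.
Qed.

End ListFunctions.

(** * Residues along strings of colours *)

(** Additivity of the first-order term in the direction is what lets [config_double_vanish] combine
    derivatives along different motions. *)
Lemma polyf_taylor (R : numFieldType) (S : R -> Prop) d (f : (nat -> R) -> R) : polyf S d f ->
  exists2 df : (nat -> R) -> (nat -> R) -> R,
    (forall v w w', df v (fun i => w i + w' i) = df v w + df v w') &
    forall v w, exists q : {poly R}, forall t,
      f (fun i => v i + t * w i) = f v + t * df v w + t ^+ 2 * q.[t].
Proof.
elim=> {d f} [c _|i|d f g _ [df dfD dfE] _ [dg dgD dgE]|d d' f g _ [df dfD dfE] _ [dg dgD dgE]
             |//|d f g fg _ [df dfD dfE]].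
- exists (fun _ _ => 0) => [*|v w]; first by rewrite addr0.
  by exists 0 => t; rewrite horner0 !mulr0 !addr0.
- exists (fun v w => w i) => [//|v w].
  by exists 0 => t; rewrite horner0 !mulr0 addr0.
- exists (fun v w => df v w + dg v w) => [v w w'|v w]; first by rewrite dfD dgD addrACA.
  have [q qE] := dfE v w; have [q' qE'] := dgE v w; exists (q + q') => t.
  by rewrite qE qE' hornerD; ring.
- exists (fun v w => df v w * g v + f v * dg v w) => [v w w'|v w]; first by rewrite dfD dgD; ring.
  have [q qE] := dfE v w; have [q' qE'] := dgE v w.
  exists ((df v w * dg v w)%:P + f v *: q' + g v *: q + 'X * (df v w *: q' + dg v w *: q) + 'X^2 * q * q') => t.
  by rewrite qE qE' !hornerE; ring.
- by exists df => // v w; have [q qE] := dfE v w; exists q => t; rewrite -!fg qE.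
Qed.

(** Since [D] is free of variable [a] and nonzero at distinct points, the order of vanishing of [f]
    at [v a = v b] is carried by its cofactor. One factor is split off per step, and density handles
    the points that are not distinct. *)
Lemma polyf_divide_pow (R : numFieldType) (S : R -> Prop) d (f D g : (nat -> R) -> R) a b n k :
  subringP S -> a != b -> polyf S d g -> (forall v, f v = D v * g v) ->
  (forall v x, D (upd v a x) = D v) -> (forall v, injn n v -> D v != 0) ->
  (forall v, exists q : {poly R}, forall t, f (upd v a (v b + t)) = t ^+ k * q.[t]) ->
  exists2 g', polyf S d g' & forall v, f v = D v * (v a - v b) ^+ k * g' v.
Proof.
move=> SS ab Pg fE DE D0; elim: k => [|k IH] h.
  by exists g => // v; rewrite expr0 mulr1.
have [v|g' Pg' g'E] := IH.
  by have [q qE] := h v; exists ('X * q) => t; rewrite qE exprSr hornerM hornerX mulrA.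
have updE v x : upd v a x a = x by rewrite /upd eqxx.
have updN v x : upd v a x b = v b by rewrite /upd eq_sym (negPf ab).
have Pu : polyf S d (fun v => g' (upd v a (v b))).
  by apply: (polyf_subst (s := fun i v => if i == a then v b else v i)) => // i; case: (i == a); exact: polyf_var.
have z : forall v, g' (upd v a (v b)) = 0.
  apply: (polyf_density (n := n) Pu) => v /D0 Dv.
  have [q qE] := h v.
  have [q' _ q'E] := polyf_line (upd v a (v b)) (fun i => (i == a)%:R) Pg'.
  have lE t : g' (upd v a (v b + t)) = q'.[t].
    rewrite -q'E; apply: polyf_eq Pg' _ => i; rewrite /upd; case: eqP => _; by rewrite ?mulr1 ?mulr0 ?addr0.
  have : 'X * q = D v *: q'.
    apply: (@poly_cofinite_eq _ [:: 0]) => t; rewrite inE => t0; apply: (mulfI (expf_neq0 k t0)).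
    by rewrite hornerZ hornerM hornerX mulrA -exprSr -qE g'E DE updE updN -lE addrAC subrr add0r -mulrA mulrCA.
  move/(congr1 (fun q => q.[0])); rewrite hornerZ hornerM hornerX mul0r => /esym/eqP.
  by rewrite mulf_eq0 (negPf Dv) -lE addr0 => /eqP.
have [v vab|g'' Pg'' g''E] := @polyf_divide _ _ _ _ a b SS Pg'.
  rewrite -[RHS](z v); apply: polyf_eq Pg' _ => i; rewrite /upd -vab; by case: eqP => // ->.
by exists g'' => // v; rewrite g'E g''E exprSr -!mulrA.
Qed.

Lemma prod_uniq_if (R : comNzRingType) (T : eqType) (s : seq T) (a : T) (x : R) : uniq s ->
  \prod_(k <- s) (if k == a then x else 1) = if a \in s then x else 1.
Proof.
elim: s => [|b s IH] /=; first by rewrite big_nil.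
move=> /andP[bs /IH E]; rewrite big_cons E inE [a == b]eq_sym.
by case: eqP => [<-|_]; rewrite ?mul1r //= (negPf bs) mulr1.
Qed.

Section Residues.
Variable R : numFieldType.
Notation elt := (nat * R)%type.
Implicit Types (F G T : seq elt -> R) (L A B : seq elt) (v : nat -> R) (S : R -> Prop).

Definition adj (k l : nat) := (k.+1 == l) || (l.+1 == k).

(** For adjacent colours [om0] is the difference of positions, lower colour first: the contribution
    of the pair to the common denominator of the shuffle algebra. For other pairs it is 1. *)
Definition cross (x y : elt) := if x.1.+1 == y.1 then x.2 - y.2 else 1.
Definition om0 (x y : elt) := cross x y * cross y x.

Lemma om0C x y : om0 x y = om0 y x. Proof. by rewrite /om0 mulrC. Qed.

Lemma om0_neq0 x y : x.2 != y.2 -> om0 x y != 0.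
Proof.
move=> xy; apply: mulf_neq0; rewrite /cross; case: ifP => _; rewrite ?oner_neq0 // subr_eq0 //.
by rewrite eq_sym.
Qed.

Lemma om0_adj k l (p : R) : adj k l -> om0 (k, p) (l, p) = 0.
Proof.
by rewrite /adj /om0 /cross /= => /orP[]/eqP ->; rewrite eqxx subrr ?mul0r ?mulr0.
Qed.

Definition roots i j := iota i (j.+1 - i).
Definition str i j (p : R) : seq elt := [seq (k, p) | k <- roots i j].

Lemma mem_roots i j k : (i <= j)%N -> (k \in roots i j) = (i <= k <= j)%N.
Proof. by move=> ij; rewrite mem_iota; lia. Qed.

Fixpoint lstd (w : seq nat) o := if w is c :: w' then (c, o) :: lstd w' o.+1 else [::].

Lemma inst_lstd v L o : (forall s, (s < size L)%N -> v (o + s)%N = nth 0 (unzip2 L) s) ->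
  inst v (lstd (unzip1 L) o) = L.
Proof.
elim: L o => //= -[c x] L IH o h; congr (_ :: _); first by rewrite -[o]addn0 (h 0%N).
by apply: IH => s sL; rewrite addSnnS h.
Qed.

Definition cw i j p L := weight om0 (str i j p) L.

(** The number of neighbours of colour [c] in the string; the guard excludes [c = 0], where [c.-1]
    is again 0. *)
Definition nbr i j c := ((c.+1 \in roots i j) + ((0 < c) && (c.-1 \in roots i j)))%N.

Lemma prod_str_om0 i j c (x p : R) :
  \prod_(a <- str i j p) om0 a (c, x)
   = (-1) ^+ ((0 < c)%N && (c.-1 \in roots i j)) * (x - p) ^+ nbr i j c.
Proof.
rewrite /str big_map big_split /=.
rewrite [X in X * _](_ : _ = if (0 < c)%N && (c.-1 \in roots i j) then p - x else 1); last first.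
  case: c => [|c] /=; first by rewrite big1.
  by rewrite -prod_uniq_if ?iota_uniq //; apply: eq_bigr => k _; rewrite /cross eqSS.
rewrite [X in _ * X](_ : _ = if c.+1 \in roots i j then x - p else 1); last first.
  by rewrite -prod_uniq_if ?iota_uniq //; apply: eq_bigr => k _; rewrite /cross eq_sym.
rewrite /nbr; case: ifP => _; case: ifP => _ /=; rewrite ?expr1 ?expr0 ?expr2 ?mul1r ?mulr1 //; ring.
Qed.

Lemma cw_neq0 i j p L : p \notin unzip2 L -> cw i j p L != 0.
Proof.
move=> pL; rewrite /cw /weight prodf_seq_neq0; apply/allP => _ /mapP[k _ ->] /=.
rewrite prodf_seq_neq0; apply/allP => b bL /=; apply: om0_neq0 => /=.
by apply: contraNneq pL => ->; exact: map_f.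
Qed.

Lemma cw_cat i j p L L' : cw i j p (L ++ L') = cw i j p L * cw i j p L'.
Proof. by rewrite /cw /weight -big_split; apply: eq_bigr => a _; rewrite big_cat. Qed.

Lemma perm_cw i j p L L' : perm_eq L L' -> cw i j p L = cw i j p L'.
Proof. by move=> LL'; apply: eq_bigr => a _; apply: perm_big. Qed.

Lemma cw_str i j p p' : cw i j p (str i j p') = cw i j p' (str i j p).
Proof.
by rewrite /cw /weight exchange_big; apply: eq_bigr => a _ /=; apply: eq_bigr => b _; rewrite om0C.
Qed.

(* The residue of [T] along the string of colours [i..j], i.e. the unique polynomial [q] in the position [p] of the
   string with [T (str i j p ++ L) = cw i j p L * q.[p]]; junk when there is none. *)
Definition resid i j T L : {poly R} :=
  epsilon (inhabits 0) (fun q => forall p, T (str i j p ++ L) = cw i j p L * q.[p]).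

Lemma resid_unique i j T L (q : {poly R}) :
  (forall p, T (str i j p ++ L) = cw i j p L * q.[p]) -> resid i j T L = q.
Proof.
move=> qE; have h : exists q : {poly R}, forall p, T (str i j p ++ L) = cw i j p L * q.[p] by exists q.
have := epsilon_spec (inhabits 0) _ h; rewrite -/(resid i j T L) => E.
apply: (@poly_cofinite_eq _ (unzip2 L)) => p pL; apply: (mulfI (cw_neq0 i j pL)).
by rewrite -E qE.
Qed.

(** What membership in the shuffle algebra becomes for a top-degree component: the points [x + 1],
    [x], [x + 1/2] of the wheel condition collapse to one position. One degree bound serves all
    lists. *)
Record config (m : nat) S T : Prop := Config {
  config_sym : lsym T;
  config_poly : exists d, lpolyd S d T;
  config_wheel : forall i j (p : R) L, adj i j -> T [:: (i, p), (i, p), (j, p) & L] = 0;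
  config_col : forall L, ~~ all (fun a : elt => (a.1 < m)%N) L -> T L = 0
}.

Definition killed i j T := forall p L, T (str i j p ++ L) = 0.

Section Vanishing.
Variables (m : nat) (S : R -> Prop) (T : seq elt -> R) (i j : nat).
Hypotheses (SS : subringP S) (cT : config m S T) (ij : (i <= j)%N).

Lemma str_rem c k (p : R) : c \in roots i j -> k \in roots i j -> c != k ->
  perm_eq (str i j p) [:: (c, p), (k, p) & [seq (l, p) | l <- rem k (rem c (roots i j))]].
Proof.
move=> ci ki ck; rewrite /str.
have -> : [:: (c, p), (k, p) & [seq (l, p) | l <- rem k (rem c (roots i j))]]
   = [seq (l, p) | l <- [:: c, k & rem k (rem c (roots i j))]] by [].
apply: perm_map; rewrite (permPl (perm_to_rem ci)) perm_cons; apply: perm_to_rem.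
by rewrite (rem_filter _ (iota_uniq _ _)) mem_filter /= eq_sym ck.
Qed.

(** If [c] lies in the string, its colour is doubled next to [k] and the wheel condition applies. If
    [c] lies just outside, it extends the string to a longer one on which [T] is killed. *)
Lemma config_adj_vanish c k (p : R) L : (0 < i -> killed i.-1 j T)%N -> killed i j.+1 T ->
  k \in roots i j -> adj c k -> T (str i j p ++ (c, p) :: L) = 0.
Proof.
move=> kl kr kij ck; have [cij|cij] := boolP (c \in roots i j).
  have cNk : c != k by move: ck; rewrite /adj; lia.
  have P := str_rem p cij kij cNk.
  rewrite (config_sym cT (L' := [:: (c, p), (c, p), (k, p) & [seq (l, p) | l <- rem k (rem c (roots i j))] ++ L])).
    exact: (config_wheel cT).
  rewrite -cat1s (permPl (permEl (perm_catCA _ _ _))) perm_cons.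
  by rewrite (permPl (perm_cat P (perm_refl L))).
move: kij cij; rewrite !mem_roots // => kij cij.
have [E|E] : (c = j.+1 \/ c.+1 = i)%N by move: ck kij cij; rewrite /adj; lia.
  rewrite E -(kr p L); congr T; rewrite /str /roots.
  have -> : (j.+2 - i = (j.+1 - i) + 1)%N by lia.
  by rewrite iotaD map_cat -catA /= subnKC // (leq_trans ij).
rewrite -(kl _ p L); last by rewrite -E.
apply: (config_sym cT).
rewrite -cat1s (permPl (permEl (perm_catCA _ _ _))) /= /str /roots.
have -> : (j.+1 - i.-1 = (j.+1 - i).+1)%N by lia.
by rewrite -E /=.
Qed.

(** Each neighbour alone gives only a simple zero. Consider the derivatives in the four points of
    colours [c], [c], [c-1], [c+1] at the common position. The third is 0 by the wheel condition
    with [c+1]; the first three sum to 0 since those points may move together; the first two agree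
    by symmetry. So twice the first is 0. *)
Lemma config_double_vanish c (p : R) L : (0 < c)%N ->
  c.-1 \in roots i j -> c \in roots i j -> c.+1 \in roots i j ->
  exists q : {poly R}, forall t, T (str i j p ++ (c, p + t) :: L) = t ^+ 2 * q.[t].
Proof.
move=> c0 cl cc cr; pose M := [seq (l, p) | l <- rem c.+1 (rem c.-1 (rem c (roots i j)))] ++ L.
have TE t : T (str i j p ++ (c, p + t) :: L) = T [:: (c, p + t), (c, p), (c.-1, p), (c.+1, p) & M].
  apply: (config_sym cT).
  rewrite -cat1s (permPl (permEl (perm_catCA _ _ _))) perm_cons.
  have cNl : c != c.-1 by lia.
  rewrite (permPl (perm_cat (str_rem p cc cl cNl) (perm_refl L))) /= !perm_cons.
  rewrite /M -cat_cons perm_cat2r -(map_cons (fun l => (l, p))) perm_map // perm_to_rem //.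
  rewrite (rem_filter _ (rem_uniq _ (iota_uniq _ _))) mem_filter (rem_filter _ (iota_uniq _ _)) mem_filter cr /=; lia.
have [d Td] := config_poly cT.
(* Variables 0 to 3 are the points that may move; the remaining ones stay fixed. *)
pose lM := [:: (c, 0), (c, 1), (c.-1, 2), (c.+1, 3) & lstd (unzip1 M) 4]%N.
pose v s := nth 0 ([:: p; p; p; p] ++ unzip2 M) s.
have [df dfD dfE] := polyf_taylor (Td lM).
have vE w t a0 a1 a2 a3 : w 0%N = a0 -> w 1%N = a1 -> w 2%N = a2 -> w 3%N = a3 ->
    (forall s, (3 < s)%N -> w s = 0) ->
    inst (fun s => v s + t * w s) lM = [:: (c, p + t * a0), (c, p + t * a1), (c.-1, p + t * a2), (c.+1, p + t * a3) & M].
  move=> <- <- <- <- wE; rewrite /= {1 2 3 4}/v /=; do 4!congr (_ :: _).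
  by apply: inst_lstd => s sM; rewrite wE // mulr0 addr0.
pose E4 a0 a1 a2 a3 (s : nat) : R := nth 0 [:: a0; a1; a2; a3] s.
have E4E a0 a1 a2 a3 t : inst (fun s => v s + t * E4 a0 a1 a2 a3 s) lM =
    [:: (c, p + t * a0), (c, p + t * a1), (c.-1, p + t * a2), (c.+1, p + t * a3) & M].
  by apply: vE => // -[|[|[|[|s]]]] //= _; rewrite /E4 nth_default.
have TM (u a b : R) : T [:: (c, u), (c, u), (c.-1, u), (c.+1, a) & M] = 0 /\ T [:: (c, u), (c, u), (c.-1, b), (c.+1, u) & M] = 0.
  split; first by apply: (config_wheel cT); rewrite /adj prednK // eqxx orbT.
  rewrite (config_sym cT (L' := [:: (c, u), (c, u), (c.+1, u), (c.-1, b) & M])).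
    by apply: (config_wheel cT); rewrite /adj eqxx.
  by rewrite !perm_cons -cat1s -[X in perm_eq _ X]cat1s -[X in perm_eq (_ ++ X) _]cat1s
     -[X in perm_eq _ (_ ++ X)]cat1s perm_catCA.
have T0 : T (inst v lM) = 0.
  have := E4E 0 0 0 0 0; rewrite !mul0r !addr0 => E0.
  rewrite -[RHS](TM p p p).1 -E0; apply: polyf_eq (Td lM) _ => s; by rewrite mul0r addr0.
have dfC w1 w2 : (forall t, T (inst (fun s => v s + t * w1 s) lM) = T (inst (fun s => v s + t * w2 s) lM)) ->
    df v w1 = df v w2.
  move=> E; have [q1 q1E] := dfE v w1; have [q2 q2E] := dfE v w2.
  have : (df v w1)%:P + 'X * q1 = (df v w2)%:P + 'X * q2.
    apply: (@poly_cofinite_eq _ [:: 0]) => t; rewrite inE => t0; apply: (mulfI t0).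
    have := E t; rewrite q1E q2E T0 !add0r !hornerE => e; rewrite !mulrDr !mulrA -!expr2 e //.
  by move/(congr1 (fun q => q.[0])); rewrite !hornerE ?mul0r ?addr0.
have df0 : df v (fun=> 0) = 0.
  have := dfD v (fun=> 0) (fun=> 0); rewrite (dfC (fun=> 0 + 0) (fun=> 0)) => [e|t].
    by apply: (addrI (df v (fun=> 0))); rewrite -e addr0.
  by congr T; rewrite addr0.
have dfz a0 a1 a2 a3 : (forall t, T [:: (c, p + t * a0), (c, p + t * a1), (c.-1, p + t * a2), (c.+1, p + t * a3) & M] = 0) ->
    df v (E4 a0 a1 a2 a3) = 0.
  move=> E; rewrite -df0; apply: dfC => t; rewrite E4E E -[LHS]T0.
  by apply: polyf_eq (Td lM) _ => s; rewrite mulr0 addr0.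
have dfA a0 a1 a2 a3 b0 b1 b2 b3 : df v (E4 (a0 + b0) (a1 + b1) (a2 + b2) (a3 + b3)) =
    df v (E4 a0 a1 a2 a3) + df v (E4 b0 b1 b2 b3).
  rewrite -dfD; apply: dfC => t; apply: polyf_eq (Td lM) _ => -[|[|[|[|s]]]] //=.
  by rewrite /E4 !nth_default //= addr0.
have D3 : df v (E4 0 0 1 0) = 0 by apply: dfz => t; rewrite !mulr0 !addr0; case: (TM p p (p + t * 1)).
have D12 : df v (E4 1 1 1 0) = 0 by apply: dfz => t; rewrite mulr1; case: (TM (p + t) (p + t * 0) p).
have Dsym : df v (E4 1 0 0 0) = df v (E4 0 1 0 0).
  apply: dfC => t; rewrite !E4E; apply: (config_sym cT).
  by rewrite -cat1s -[X in perm_eq _ X]cat1s -[X in perm_eq (_ ++ X) _]cat1s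
     -[X in perm_eq _ (_ ++ X)]cat1s perm_catCA.
have D1 : df v (E4 1 0 0 0) = 0.
  have := dfA 1 1 0 0 0 0 1 0; rewrite !addr0 !add0r D12 D3 addr0.
  have := dfA 1 0 0 0 0 1 0 0; rewrite !addr0 !add0r -Dsym => -> /esym/eqP.
  by rewrite -mulr2n mulrn_eq0 => /eqP.
have [q qE] := dfE v (E4 1 0 0 0); exists q => t.
rewrite TE; have := E4E 1 0 0 0 t; rewrite mulr1 !mulr0 !addr0 => <-.
by rewrite qE T0 D1 mulr0 !add0r.
Qed.

Hypotheses (kl : (0 < i)%N -> killed i.-1 j T) (kr : killed i j.+1 T).

Lemma config_vanish_order c (p : R) L : exists q : {poly R},
  forall t, T (str i j p ++ (c, p + t) :: L) = t ^+ nbr i j c * q.[t].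
Proof.
have [d Td] := config_poly cT.
have [Q QE] : exists Q : {poly R}, forall t, T (str i j p ++ (c, p + t) :: L) = Q.[t].
  pose M := str i j p ++ (c, p) :: L.
  pose w k : R := (k == size (str i j p))%:R.
  have [Q _ QE] := polyf_line (nth 0 (unzip2 M)) w (Td (lstd (unzip1 M) 0)).
  exists Q => t; rewrite -QE; congr T; rewrite -[LHS](@inst_lstd (nth 0 (unzip2 (str i j p ++ (c, p + t) :: L))) _ 0) //.
  rewrite /M /unzip1 /unzip2 !map_cat /=; set l := lstd _ _.
  apply: eq_map => -[b k] /=; congr (_, _); rewrite !nth_cat size_map /w.
  case: ltnP => sk; first by rewrite ltn_eqF // mulr0 addr0.
  case: eqP => [->|/eqP kn]; first by rewrite subnn mulr1.
  rewrite mulr0 addr0; case E: (k - _)%N => [|r] //.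
  by move: E; lia.
have root1 k : k \in roots i j -> adj c k -> exists q : {poly R}, forall t, Q.[t] = t * q.[t].
  move=> kij ck; have := config_adj_vanish p L kl kr kij ck.
  have := QE 0; rewrite addr0 => -> /eqP; rewrite -/(root Q 0) => /factor_theorem[q ->].
  by exists q => t; rewrite hornerM hornerXsubC subr0 mulrC.
rewrite /nbr; case: (boolP (c.+1 \in _)) => cr; case: (boolP ((0 < c)%N && _)) => cl /=.
- case/andP: cl => c0 cl; apply: config_double_vanish => //.
  by move: cl cr; rewrite !mem_roots //; lia.
- by have [|q qE] := root1 _ cr; [rewrite /adj eqxx|exists q => t; rewrite QE qE].
- case/andP: cl => c0 cl.
  by have [|q qE] := root1 _ cl; [rewrite /adj prednK // eqxx orbT|exists q => t; rewrite QE qE].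
- by exists Q => t; rewrite QE mul1r.
Qed.

Lemma unzip2_lstd w o : unzip2 (lstd w o) = iota o (size w).
Proof. by elim: w o => //= c w IH o; rewrite IH. Qed.

(** The position of the string is the extra variable [size w]. Points are divided off one at a time:
    those already treated form the factor [D] of [polyf_divide_pow], which does not involve the next
    point. *)
Lemma config_divide d w : lpolyd S d T -> exists2 g, polyf S d g &
  forall v, T (str i j (v (size w)) ++ inst v (lstd w 0)) = cw i j (v (size w)) (inst v (lstd w 0)) * g v.
Proof.
move=> Td; set n := size w; set lw := lstd w 0.
pose f v := T (str i j (v n) ++ inst v lw).
have Pf : polyf S d f.
  apply: polyf_ext (Td ([seq (k, n) | k <- roots i j] ++ lw)) => v.
  by rewrite /f /inst map_cat -map_comp.
have lwU : uniq (unzip2 lw) by rewrite unzip2_lstd iota_uniq.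
have lwn b : b \in lw -> (b.2 < n)%N.
  by move=> /(map_f snd); rewrite -/(unzip2 _) unzip2_lstd mem_iota.
suff H l1 l2 : lw = l1 ++ l2 -> exists2 g, polyf S d g &
    forall v, f v = (\prod_(b <- l1) \prod_(a <- str i j (v n)) om0 a (b.1, v b.2)) * g v.
  have [|g Pg gE] := H lw [::]; first by rewrite cats0.
  exists g => // v; rewrite -/(f v) gE; congr (_ * _); rewrite /cw /weight [RHS]exchange_big /=.
  by rewrite /inst big_map.
elim/last_ind: l1 l2 => [|l1 [c s] IH] l2 E.
  by exists f => // v; rewrite big_nil mul1r.
rewrite cat_rcons in E; have [g Pg gE] := IH _ E.
have sl1 b : b \in l1 -> b.2 != s.
  move=> bl; move: lwU; rewrite E /unzip2 map_cat cat_uniq /= => /and3P[_ + _].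
  by rewrite negb_or => /andP[sl _]; apply: contraNneq sl => <-; exact: map_f.
have sl2 b : b \in l2 -> b.2 != s.
  move=> bl; move: lwU; rewrite E /unzip2 map_cat cat_uniq /= => /and3P[_ _ /andP[sl _]].
  by apply: contraNneq sl => <-; exact: map_f.
have sn : (s < n)%N by apply: (lwn (c, s)); rewrite E mem_cat inE eqxx orbT.
have updn v (x : R) : upd v s x n = v n by rewrite /upd gtn_eqF.
have [|v x|v iv|v|g' Pg' g'E] := @polyf_divide_pow _ S d f _ g s n n.+1 (nbr i j c) SS _ Pg gE.
- by rewrite ltn_eqF.
- rewrite /= !updn; apply: eq_big_seq => b /sl1 bs; by rewrite /upd (negPf bs).
- rewrite prodf_seq_neq0; apply/allP => b bl /=.
  rewrite prodf_seq_neq0; apply/allP => _ /mapP[k _ ->] /=; apply: om0_neq0 => /=.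
  have bn : (b.2 < n)%N by apply: lwn; rewrite E mem_cat bl.
  by apply/eqP => e; have := bn; rewrite -(iv n b.2 _ _ e) ?ltnn // ltnS ltnW.
- have [q qE] := config_vanish_order c (v n) (inst v (l1 ++ l2)); exists q => t.
  have updl l x : (forall b, b \in l -> b.2 != s) -> inst (upd v s x) l = inst v l.
    by move=> ls; apply/eq_in_map => b /ls bs; rewrite /upd (negPf bs).
  rewrite -qE /f updn E !inst_cat inst_cons !updl //= {1}/upd eqxx; apply: (config_sym cT).
  by rewrite perm_cat2l -cat1s (permPl (permEl (perm_catCA _ _ _))).
(* The powers of [x - p] are converted to products of [om0], which subtracts the higher colour from
   the lower one; hence the sign. *)
exists (fun v => (-1) ^+ ((0 < c)%N && (c.-1 \in roots i j)) * g' v).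
  by apply: polyf_scale => //; exact: subring_sign.
move=> v; rewrite g'E -cats1 big_cat big_seq1 /= prod_str_om0 -!mulrA; congr (_ * _).
by rewrite [RHS]mulrCA; congr (_ * _); rewrite mulrA -signr_addb addbb mul1r.
Qed.

Lemma resid_coefs d w : lpolyd S d T -> exists2 gk : nat -> (nat -> R) -> R, (forall k, polyf S d (gk k)) &
  forall L, unzip1 L = w -> forall p, T (str i j p ++ L) =
    cw i j p L * (\poly_(k < d.+1) gk k (nth 0 (unzip2 L))).[p].
Proof.
move=> Td; have [g Pg gE] := config_divide w Td; set n := size w in gE.
(* Variable [n], the position of the string, becomes the expansion parameter. *)
pose al s v := if (s < n)%N then v s else 0 : R.
pose be s v := (s == n)%:R : R.
have [s|s|gk Pgk gkE] := polyf_affine_subst SS (al := al) (be := be) Pg.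
- by rewrite /al; case: ltnP => _; [exact: polyf_var|exact: polyf0].
- by rewrite /be; apply: polyf_cst; exact: subring_nat.
exists gk => // L Lw p; have := gE (fun s => al s (nth 0 (unzip2 L)) + p * be s (nth 0 (unzip2 L))).
have -> v : al n v + p * be n v = p by rewrite /al /be ltnn eqxx mulr1 add0r.
rewrite gkE -Lw inst_lstd => [->|s sL].
  by rewrite horner_poly; congr (_ * _); apply: eq_bigr => k _; rewrite mulrC.
by rewrite /al /be add0n /n -Lw size_map sL ltn_eqF // mulr0 addr0.
Qed.

Lemma residE L p : T (str i j p ++ L) = cw i j p L * (resid i j T L).[p].
Proof.
have [d Td] := config_poly cT; have [gk _ gkE] := resid_coefs (unzip1 L) Td.
by rewrite (resid_unique (gkE L erefl)) gkE.
Qed.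

Lemma size_resid d L : lpolyd S d T -> (size (resid i j T L) <= d.+1)%N.
Proof.
move=> Td; have [gk _ gkE] := resid_coefs (unzip1 L) Td.
by rewrite (resid_unique (gkE L erefl)) size_poly.
Qed.

Lemma lpolyd_resid d r : lpolyd S d T -> lpolyd S d (fun L => (resid i j T L)`_r).
Proof.
move=> Td l; have [gk Pgk gkE] := resid_coefs (unzip1 l) Td.
have E v : (resid i j T (inst v l))`_r = if (r < d.+1)%N then
    gk r (fun s => if (s < size l)%N then v (nth 0%N (unzip2 l) s) else 0) else 0.
  have /gkE : unzip1 (inst v l) = unzip1 l by rewrite /unzip1 /inst -map_comp.
  move=> /resid_unique ->; rewrite coef_poly; case: ifP => // _; apply: polyf_eq (Pgk r) _ => s.
  case: ltnP => sl; last by rewrite nth_default // !size_map.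
  by rewrite /unzip2 /inst -map_comp !(nth_map (0, 0)%N).
case: (ltnP r d.+1) => rd; last first.
  by apply: polyf_ext (polyf0 SS d) => v; rewrite E ltnNge rd.
apply: (@polyf_ext _ _ _ (fun v => gk r (fun s => if (s < size l)%N then v (nth 0%N (unzip2 l) s) else 0))).
  by move=> v; rewrite E rd.
apply: (polyf_subst (s := fun s v => if (s < size l)%N then v (nth 0%N (unzip2 l) s) else 0)) => // s.
by case: (s < size l)%N; [exact: polyf_var|exact: polyf0].
Qed.

Lemma resid_eq0 L : (forall p, T (str i j p ++ L) = 0) -> resid i j T L = 0.
Proof. by move=> h; apply: resid_unique => p; rewrite h horner0 mulr0. Qed.

Lemma config_resid r : config m S (fun L => (resid i j T L)`_r).
Proof.
split.
- move=> L L' LL'; suff -> : resid i j T L = resid i j T L' by []; apply: resid_unique => p.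
  by rewrite (perm_cw _ _ _ LL') -residE; apply: (config_sym cT); rewrite perm_cat2l.
- by have [d Td] := config_poly cT; exists d; exact: lpolyd_resid.
- move=> i' j' p' L ij'; rewrite resid_eq0 ?coef0 // => p.
  by rewrite -(config_wheel cT p' (str i j p ++ L) ij'); apply: (config_sym cT); exact: (permEl (perm_catCA _ [:: (i', p'); (i', p'); (j', p')] _)).
- move=> L Lm; rewrite resid_eq0 ?coef0 // => p; apply: (config_col cT).
  by rewrite all_cat negb_and Lm orbT.
Qed.

Lemma killed_resid i' j' r : killed i' j' T -> killed i' j' (fun L => (resid i j T L)`_r).
Proof.
move=> kT p' L; rewrite resid_eq0 ?coef0 // => p.
by rewrite -(kT p' (str i j p ++ L)); apply: (config_sym cT); exact: (permEl (perm_catCA _ _ _)).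
Qed.

Lemma bounded_resid N r : (forall L, (N <= size L)%N -> T L = 0) ->
  forall L, (N - (j.+1 - i) <= size L)%N -> (resid i j T L)`_r = 0.
Proof.
move=> h L NL; rewrite resid_eq0 ?coef0 // => p; apply: h.
by rewrite size_cat size_map size_iota; move: NL; clear; lia.
Qed.
End Vanishing.
End Residues.

(** * Divided monomials in the elementary functions and their residues *)

Section Monomials.
Variable R : numFieldType.
Notation elt := (nat * R)%type.
Local Notation om0 := (@om0 R).
Implicit Types (F G T : seq elt -> R) (L A B : seq elt) (v : nat -> R) (S : R -> Prop).

(** Two strings of the same colours can be exchanged in [T], and the factor between them is
    symmetric as well. The double residue is therefore a symmetric polynomial in the two
    positions. *)
Lemma resid_swap m S T i j (d r r' : nat) L : subringP S -> config m S T -> (i <= j)%N -> lpolyd S d T ->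
  ((0 < i)%N -> killed i.-1 j T) -> killed i j.+1 T ->
  (resid i j (fun L => (resid i j T L)`_r) L)`_r' = (resid i j (fun L => (resid i j T L)`_r') L)`_r.
Proof.
move=> SS cT ij Td kl kr.
pose Tr r := fun L => (resid i j T L)`_r; rewrite -/(Tr r) -/(Tr r').
have cTr k : config m S (Tr k) by exact: (config_resid SS cT ij kl kr k).
have krl k : (0 < i)%N -> killed i.-1 j (Tr k) by move=> i0; exact: (killed_resid _ _ cT _ (kl i0)).
have krr k : killed i j.+1 (Tr k) by exact: (killed_resid _ _ cT _ kr).
have Trd k : lpolyd S d (Tr k) by exact: (lpolyd_resid SS cT ij kl kr _ Td).
pose B a b := (resid i j (Tr a) L)`_b; rewrite -/(B r r') -/(B r' r).
have Bd a b : (d < a)%N || (d < b)%N -> B a b = 0.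
  case/orP=> h.
    rewrite /B resid_eq0 ?coef0 // => p; rewrite /Tr nth_default //.
    by apply: leq_trans (size_resid SS cT ij kl kr _ Td) h.
  by rewrite /B nth_default // (leq_trans (size_resid SS (cTr a) ij (krl a) (krr a) _ (Trd a))).
have TE p p' : T (str i j p ++ str i j p' ++ L) =
    cw i j p (str i j p') * cw i j p L * cw i j p' L * \sum_(a < d.+1) \sum_(b < d.+1) p ^+ a * p' ^+ b * B a b.
  rewrite (residE SS cT ij kl kr) cw_cat -!mulrA; congr (_ * (_ * _)).
  rewrite (horner_coef_wide _ (size_resid SS cT ij kl kr _ Td)) mulr_sumr; apply: eq_bigr => a _.
  rewrite -/(Tr a _) (residE SS (cTr a) ij (krl a) (krr a)) -mulrA; congr (_ * _).
  rewrite (horner_coef_wide _ (size_resid SS (cTr a) ij (krl a) (krr a) _ (Trd a))) mulr_suml.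
  by apply: eq_bigr => b _; rewrite /B; ring.
have H p p' : p \notin p' :: unzip2 L -> p' \notin unzip2 L ->
    \sum_(a < d.+1) \sum_(b < d.+1) p ^+ a * p' ^+ b * B a b = \sum_(a < d.+1) \sum_(b < d.+1) p ^+ a * p' ^+ b * B b a.
  rewrite inE negb_or => /andP[pp pL] p'L.
  have nz : cw i j p (str i j p') * cw i j p L * cw i j p' L != 0.
    rewrite !mulf_neq0 ?cw_neq0 //; apply/mapP => -[_ /mapP[k _ ->]] /= e.
    by rewrite e eqxx in pp.
  apply: (mulfI nz); rewrite -TE.
  rewrite (config_sym cT (L' := str i j p' ++ str i j p ++ L)); last exact: (permEl (perm_catCA _ _ _)).
  rewrite TE [cw i j p' (str i j p)]cw_str [_ * cw i j p' L * cw i j p L]mulrAC; congr (_ * _).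
  by rewrite exchange_big; apply: eq_bigr => a _; apply: eq_bigr => b _; rewrite [p' ^+ _ * _]mulrC.
case: (ltnP d r) => [rd|rd]; first by rewrite !Bd ?rd ?orbT.
case: (ltnP d r') => [rd'|rd']; first by rewrite !Bd ?rd' ?orbT.
have : \poly_(b < d.+1) B r b = \poly_(b < d.+1) B b r.
  apply: (@poly_cofinite_eq _ (unzip2 L)) => p' p'L; rewrite !horner_poly.
  have : \poly_(a < d.+1) (\sum_(b < d.+1) B a b * p' ^+ b) = \poly_(a < d.+1) (\sum_(b < d.+1) B b a * p' ^+ b).
    apply: (@poly_cofinite_eq _ (p' :: unzip2 L)) => p pL; rewrite !horner_poly.
    have := H p p' pL p'L; under eq_bigr do under eq_bigr do rewrite -mulrA [p' ^+ _ * _]mulrC.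
    under [X in _ = X]eq_bigr do under eq_bigr do rewrite -mulrA [p' ^+ _ * _]mulrC.
    move=> e; transitivity (\sum_(a < d.+1) \sum_(b < d.+1) p ^+ a * (B a b * p' ^+ b)).
      by apply: eq_bigr => a _; rewrite mulrC mulr_sumr.
    by rewrite e; apply: eq_bigr => a _; rewrite [RHS]mulrC mulr_sumr.
  by move/(congr1 (fun q : {poly R} => q`_r)); rewrite !coef_poly ltnS rd.
by move/(congr1 (fun q : {poly R} => q`_r')); rewrite !coef_poly ltnS rd'.
Qed.

(* [(i, j, r)] stands for the root vector [eroot i j r]. *)
Notation gen := (nat * nat * nat)%type.

(** The numerator of a root vector: each of the [j - i] commutators contributes a factor -1, and
    only the lowest colour carries the power. *)
Definition eps (b : gen) L : R := let: (i, j, r) := b in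
  if perm_eq (unzip1 L) (roots i j) then (-1) ^+ (j - i) * \prod_(a <- L) (if a.1 == i then a.2 ^+ r else 1) else 0.

Definition epsprod (s : seq gen) : seq elt -> R := foldr (fun b F => op om0 (eps b) F) (@lone R) s.

(** The product of the factorials of the multiplicities, arranged so that adding one generator
    multiplies it by the new multiplicity of that generator. *)
Fixpoint cfac (s : seq gen) : nat := if s is b :: s' then (count_mem b s').+1 * cfac s' else 1.

Definition mono s L : R := (cfac s)%:R^-1 * epsprod s L.

Lemma cfac_gt0 s : (0 < cfac s)%N.
Proof. by elim: s => //= b s IH; rewrite muln_gt0. Qed.

Lemma perm_epsprod s s' : perm_eq s s' -> epsprod s =1 epsprod s'.
Proof.
elim: s s' => [|b s IH] s' P L; first by move: P; rewrite perm_sym => /perm_nilP ->.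
have bs : b \in s' by rewrite -(perm_mem P) inE eqxx.
case/splitPr: bs P => s1 s2; rewrite -[b :: s2]cat1s perm_sym perm_catCA perm_sym perm_cons => /IH {}IH.
rewrite /= (eq_op _ (frefl _) IH) {IH}; elim: s1 L => //= a s1 IH L.
rewrite -(eq_op _ (frefl _) IH) !(opA (@om0C R)).
by apply: eq_op => // A; rewrite opC //; exact: om0C.
Qed.

Lemma perm_cfac s s' : perm_eq s s' -> cfac s = cfac s'.
Proof.
elim: s s' => [|b s IH] s' P; first by move: P; rewrite perm_sym => /perm_nilP ->.
have bs : b \in s' by rewrite -(perm_mem P) inE eqxx.
case/splitPr: bs P => s1 s2; rewrite -[b :: s2]cat1s perm_sym perm_catCA perm_sym perm_cons => P.
rewrite /= (IH _ P) (seq.permP P) {P IH}; elim: s1 => //= a s1 <-.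
rewrite !count_cat /= [a == b]eq_sym; case: eqP => [->|_]; rewrite ?add0n ?add1n //; lia.
Qed.

Lemma perm_mono s s' : perm_eq s s' -> mono s =1 mono s'.
Proof. by move=> P L; rewrite /mono (perm_cfac P) (perm_epsprod P). Qed.

Definition gsize (s : seq gen) := (\sum_(b <- s) (b.1.2.+1 - b.1.1))%N.

Lemma epsprod_size s L : size L != gsize s -> epsprod s L = 0.
Proof.
elim: s L => [|[[i j] r] s IH] L; first by rewrite /gsize big_nil; case: L.
rewrite /gsize big_cons -/(gsize s) /= => sL; rewrite op_splits big_seq big1 // => p pL.
have E : (size p.1 + size p.2 = size L)%N.
  elim: L p pL {sL} => [|x L IHL] p /=; first by rewrite inE => /eqP ->.
  rewrite mem_cat => /orP[] /mapP[q /IHL <- ->] //=; by rewrite addnS.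
rewrite {1}/eps; case: ifP => [/perm_size|_]; last by rewrite !mul0r.
rewrite size_map size_iota => E1; rewrite IH ?mulr0 ?mul0r //.
by apply: contraNneq sL => E2; rewrite -E E1 E2.
Qed.

Lemma mono_size s L : size L != gsize s -> mono s L = 0.
Proof. by move=> h; rewrite /mono epsprod_size ?mulr0. Qed.

Definition der i j F (F' : R -> seq elt -> R) := forall p L, F (str i j p ++ L) = cw i j p L * F' p L.

Lemma path_str i n (p : R) : path (fun a b => om0 a b == 0) (i, p) [seq (k, p) | k <- iota i.+1 n].
Proof. by elim: n i => //= n IH i; rewrite om0_adj ?eqxx //= /adj eqxx. Qed.

(** A Leibniz rule. Neighbouring points of a string have weight 0, so the whole string goes to one
    factor; its weights against the other factor complete [cw]. *)
Lemma der_op i j F (F' : R -> seq elt -> R) G (G' : R -> seq elt -> R) : (i <= j)%N -> der i j F F' -> der i j G G' ->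
  der i j (op om0 F G) (fun p L => op om0 (F' p) G L + op om0 F (G' p) L).
Proof.
move=> ij dF dG p L; set U := [seq (k, p) | k <- iota i.+1 (j - i)].
have strE : str i j p = (i, p) :: U by rewrite /str /roots subSn.
pose chi (b : elt) := \prod_(a <- (i, p) :: U) om0 a b.
have cwE B : cw i j p B = \prod_(b <- B) chi b by rewrite /cw strE /weight exchange_big.
have half H (H' : R -> seq elt -> R) K : der i j H H' -> op om0 (ins (i, p) H) (twl om0 (i, p) K) (U ++ L) =
    cw i j p L * op om0 (H' p) K L.
  move=> dH; rewrite op_chain; last exact: path_str.
  rewrite cwE [RHS]mulrC -op_mulchar; apply: eq_op => // A.
  by rewrite /ins -cat_cons -strE dH cwE mulrC.
rewrite strE /= (half _ _ _ dF) [X in _ + X](opC (@om0C R)).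
rewrite (eq_op _ (frefl _) (twlr (@om0C R) (i, p) F)) (half _ _ _ dG) mulrDr; congr (_ + _ * _).
by rewrite (opC (@om0C R)).
Qed.

(** The root [b] does not strictly contain [[i..j]]; this is what makes the residue of its function
    along the string vanish unless both roots agree. *)
Definition notabove i j (b : nat * nat) := (b.1 <= i)%N && (j <= b.2)%N ==> (b == (i, j)).

Lemma der_eps i j i' j' r : (i <= j)%N -> (i' <= j')%N -> notabove i j (i', j') ->
  der i j (eps (i', j', r)) (fun p L => if (i', j') == (i, j) then (-1) ^+ (j - i) * p ^+ r * lone L else 0).
Proof.
move=> ij ij' na p L; rewrite /eps.
have u1 : unzip1 (str i j p ++ L) = roots i j ++ unzip1 L.
  by rewrite /unzip1 map_cat; congr (_ ++ _); rewrite /str -map_comp map_id.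
case: ifP => [P|P]; last first.
  case: eqP => [[ei ej]|_]; last by rewrite mulr0.
  case: L P u1 => [|x L] P u1; last by rewrite /= !mulr0.
  by move: P; rewrite u1 cats0 ei ej perm_refl.
have sub k : (i <= k <= j)%N -> (i' <= k <= j')%N.
  by rewrite -!mem_roots // -(perm_mem P) u1 mem_cat => ->.
have E : (i', j') = (i, j).
  apply/eqP; move/implyP: na; apply => /=; have := sub i; have := sub j; lia.
rewrite E eqxx; case: E => Ei Ej; subst i' j'.
have : unzip1 L = [::].
  have := perm_size P; rewrite u1 size_cat => /eqP; rewrite -[X in _ == X]addn0 eqn_add2l.
  by rewrite size_eq0 => /eqP.
case: L {P u1} => //= _; rewrite mulr1 cats0 /cw /weight; rewrite [X in _ = X * _]big1 ?mul1r; last by move=> a _; rewrite big_nil.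
congr (_ * _); rewrite big_map /= prod_uniq_if ?iota_uniq // mem_roots // leqnn ij //.
Qed.

Definition goodgen i j (b : gen) := (b.1.1 <= b.1.2)%N && notabove i j b.1.

Lemma der_epsprod N i j s : (i <= j)%N -> all (goodgen i j) s -> all (fun b => b.2 < N)%N s ->
  der i j (epsprod s) (fun p L => \sum_(r < N) (-1) ^+ (j - i) * p ^+ r * (count_mem (i, j, r : nat) s)%:R
     * epsprod (rem (i, j, r : nat) s) L).
Proof.
move=> ij; elim: s => [_ _ p L|b s IH /= /andP[gb gs] /andP[bN sN]].
  rewrite big1 ?mulr0 => [|r _]; last by rewrite mulr0 mul0r.
  by rewrite /= /str /roots subSn.
case: b gb bN => -[i' j'] r' /andP[/= ij' na] bN p L.
rewrite (der_op ij (der_eps _ ij ij' na) (IH gs sN)); congr (_ * _).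
rewrite op_sumr.
transitivity (\sum_(r < N) (if (i', j', r') == (i, j, r : nat) then (-1) ^+ (j - i) * p ^+ r * epsprod s L else 0)
  + \sum_(r < N) (-1) ^+ (j - i) * p ^+ r * (count_mem (i, j, r : nat) s)%:R
     * op om0 (eps (i', j', r')) (epsprod (rem (i, j, r : nat) s)) L).
  congr (_ + _); case: eqP => [[-> ->]|nE].
    rewrite (bigD1 (Ordinal bN)) //= eqxx big1 ?addr0 => [|r rN].
      rewrite -[op _ _ _ L]/(op om0 (fun A => (-1) ^+ (j - i) * p ^+ r' * lone A) (epsprod s) L).
      by rewrite opZl op1l.
    by rewrite ifN //; apply: contraNneq rN => e; apply/eqP/val_inj; case: e.
  rewrite op0l big1 // => r _; rewrite ifN //; apply/eqP => -[e1 e2 _]; case: nE; by rewrite e1 e2.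
rewrite -big_split; apply: eq_bigr => r _ /=.
case: eqP => [->|_]; last by rewrite add0r add0n.
rewrite add1n -natr1 mulrDr mulr1 mulrDl addrC; congr (_ + _).
have [rs|rs] := boolP ((i, j, r : nat) \in s); last by rewrite (count_memPn rs) !mulr0 !mul0r.
by congr (_ * _); rewrite -[LHS]/(epsprod ((i, j, r : nat) :: rem (i, j, r : nat) s) L); apply: perm_epsprod; rewrite perm_sym perm_to_rem.
Qed.

(** The Leibniz rule produces the multiplicity of the removed generator, and [cfac] absorbs exactly
    this number. The coefficients that remain are signs, which keeps the elimination integral. *)
Lemma mono_str i j s L : (i <= j)%N -> all (goodgen i j) s -> exists2 q : {poly R},
  forall p, mono s (str i j p ++ L) = cw i j p L * q.[p] &
  forall r, q`_r = if (i, j, r) \in s then (-1) ^+ (j - i) * mono (rem (i, j, r) s) L else 0.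
Proof.
move=> ij gs; pose N := (\max_(b <- s) b.2).+1.
have sN : all (fun b => b.2 < N)%N s.
  by apply/allP => b bs; rewrite ltnS; exact: (@leq_bigmax_seq _ s xpredT snd b bs).
exists (\poly_(r < N) if (i, j, r) \in s then (-1) ^+ (j - i) * mono (rem (i, j, r) s) L else 0) => [p|r].
  rewrite /mono (der_epsprod ij gs sN) horner_poly mulrCA; congr (_ * _).
  rewrite mulr_sumr; apply: eq_bigr => r _; case: ifP => rs; last first.
    by rewrite (count_memPn (negbT rs)) mulr0 !mul0r mulr0.
  rewrite (perm_cfac (perm_to_rem rs)) /=.
  have := seq.permP (perm_to_rem rs) (pred1 (i, j, r : nat)); rewrite /= eqxx add1n => ->.
  rewrite natrM invfM mulrACA -!mulrA; field.
  by rewrite nat1r !pnatr_eq0 -lt0n cfac_gt0.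
rewrite coef_poly; case: ltnP => // Nr; case: ifP => // /(allP sN) /=; by rewrite ltnNge Nr.
Qed.

Lemma rem_all (T : eqType) (P : pred T) (x : T) s : all P s -> all P (rem x s).
Proof. by move/allP=> h; apply/allP => y /mem_rem /h. Qed.
End Monomials.

(** * The monomial basis for the undeformed product *)

Section Basis.
Variable R : numFieldType.
Notation elt := (nat * R)%type.
Notation gen := (nat * nat * nat)%type.
Local Notation om0 := (@om0 R).
Local Notation mono := (@mono R).
Implicit Types (F G T : seq elt -> R) (L : seq elt) (s : seq gen) (l : seq (R * seq gen)).

Definition longer (a b : nat * nat) := (b.2 - b.1 <= a.2 - a.1)%N.

Definition rootlist m : seq (nat * nat) :=
  sort longer [seq a <- [seq (i, j) | i <- iota 0 m, j <- iota 0 m] | (a.1 <= a.2)%N].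

Lemma mem_rootlist m a : (a \in rootlist m) = (a.1 <= a.2 < m)%N.
Proof.
rewrite mem_sort mem_filter; case: a => i j /=.
apply/andP/andP => -[ij].
  by case/allpairsP => -[a b] /= [_ bm [_ e]]; rewrite ij e; move: bm; rewrite mem_iota.
by move=> jm; split=> //; apply/allpairsP; exists (i, j); rewrite !mem_iota /= !add0n (leq_ltn_trans ij).
Qed.

Lemma uniq_rootlist m : uniq (rootlist m).
Proof.
rewrite sort_uniq filter_uniq // allpairs_uniq ?iota_uniq //.
by move=> [a b] [c d] _ _ [-> ->].
Qed.

Lemma pairwise_rootlist m : pairwise longer (rootlist m).
Proof.
have tr : transitive longer by move=> x y z h1 h2; exact: leq_trans h2 h1.
by rewrite -(sorted_pairwise tr); apply: sort_sorted => x y; exact: leq_total.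
Qed.

Section Cut.
Variables (m i j : nat) (done rest : seq (nat * nat)).
Hypothesis cut : rootlist m = done ++ (i, j) :: rest.

Lemma cut_root : (i <= j < m)%N.
Proof. by rewrite -(mem_rootlist m (i, j)) cut mem_cat inE eqxx orbT. Qed.

(** A root containing [d] is at least as long as [d], while the sorting makes later roots at most as
    long; so containment would force equality. *)
Lemma cut_notabove (d g : nat * nat) : d \in done -> g \in (i, j) :: rest -> notabove d.1 d.2 g && (g != d).
Proof.
move=> dd gg; have := pairwise_rootlist m; rewrite cut pairwise_cat => /andP[/allrelP /(_ _ _ dd gg) dg _].
have := uniq_rootlist m; rewrite cut cat_uniq => /and3P[_ /hasPn /(_ _ gg) /= gd _].
have gNd : g != d by apply: contraNneq gd => ->.
rewrite gNd andbT; apply/implyP => /andP[h1 h2].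
have dm : (d.1 <= d.2 < m)%N by rewrite -mem_rootlist cut mem_cat dd.
case/negP: gNd; move: dg h1 h2 dm; case: g d {gg dd gd} => g1 g2 [d1 d2]; rewrite /longer /= => *; apply/eqP; congr (_, _); lia.
Qed.

Lemma cut_notabove_rest (g : nat * nat) : g \in rest -> notabove i j g && (g != (i, j)).
Proof.
move=> gg; have := pairwise_rootlist m; rewrite cut pairwise_cat => /and3P[_ _ /= /andP[/allP /(_ _ gg) dg _]].
have := uniq_rootlist m; rewrite cut cat_uniq => /and3P[_ _ /= /andP[gd _]].
have gNd : g != (i, j) by apply: contraNneq gd => <-.
rewrite gNd andbT; apply/implyP => /andP[h1 h2].
have /andP[? ?] := cut_root.
case/negP: gNd; move: dg h1 h2; case: g {gg} => g1 g2; rewrite /longer /= => *; apply/eqP; congr (_, _); lia.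
Qed.

Lemma cut_longer (d : nat * nat) : (d.1 <= d.2 < m)%N -> (j - i < d.2 - d.1)%N -> d \in done.
Proof.
rewrite -mem_rootlist cut mem_cat => /orP[//|dd] ijd.
have := pairwise_rootlist m; rewrite cut pairwise_cat => /and3P[_ _ /= /andP[/allP h _]].
move: dd; rewrite inE => /orP[/eqP e|/h]; first by move: ijd; rewrite e ltnn.
by rewrite /longer leqNgt ijd.
Qed.

Lemma cut_left : (0 < i)%N -> (i.-1, j) \in done.
Proof. by move=> i0; apply: cut_longer => /=; have := cut_root; lia. Qed.

Lemma cut_right : (j.+1 < m)%N -> (i, j.+1) \in done.
Proof. by move=> i0; apply: cut_longer => /=; have := cut_root; lia. Qed.
End Cut.

Definition combo l L : R := \sum_(cs <- l) cs.1 * mono cs.2 L.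

Lemma combo_str i j l L : (i <= j)%N -> (forall cs, cs \in l -> all (goodgen i j) cs.2) ->
  exists2 q : {poly R}, forall p, combo l (str i j p ++ L) = cw i j p L * q.[p] &
  forall r, q`_r = \sum_(cs <- l) cs.1 * (if (i, j, r) \in cs.2 then (-1) ^+ (j - i) * mono (rem (i, j, r) cs.2) L else 0).
Proof.
move=> ij; elim: l => [_|[c s] l IH gl].
  by exists 0 => [p|r]; rewrite ?coef0 ?big_nil // /combo big_nil horner0 mulr0.
have [cs csl|q qE qr] := IH; first by apply: gl; rewrite inE csl orbT.
have [|q1 q1E q1r] := @mono_str R i j s L ij; first by apply: (gl (c, s)); rewrite inE eqxx.
exists (c *: q1 + q) => [p|r].
  by rewrite /combo big_cons -/(combo l _) qE /= q1E hornerD hornerZ mulrDr mulrCA.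
by rewrite big_cons coefD coefZ qr q1r.
Qed.

Section Span.
Variables (m : nat) (S : R -> Prop).
Hypothesis SS : subringP S.
Hypothesis config_mono : forall s, all (fun b : gen => b.1 \in rootlist m) s -> config m S (mono s).

Lemma config_sub_combo T l : config m S T ->
  (forall cs, cs \in l -> S cs.1 /\ all (fun b : gen => b.1 \in rootlist m) cs.2) ->
  config m S (fun L => T L - combo l L).
Proof.
move=> cT; elim: l => [|[c s] l IH] h.
  case: cT => h1 [d h2] h3 h4; split=> [L L' P|| i j p L a|L a].
  - by rewrite /combo !big_nil (h1 _ _ P).
  - by exists d => l; apply: polyf_ext (h2 l) => v; rewrite /combo big_nil subr0.
  - by rewrite /combo big_nil h3 // subr0.
  - by rewrite /combo big_nil h4 // subr0.
have {IH} : config m S (fun L => T L - combo l L) by apply: IH => cs csl; apply: h; rewrite inE csl orbT.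
have [Sc ss] : S c /\ all (fun b : gen => b.1 \in rootlist m) s by apply: (h (c, s)); rewrite inE eqxx.
have E L : T L - combo ((c, s) :: l) L = (T L - combo l L) - c * mono s L.
  by rewrite /combo big_cons /= [c * _ + _]addrC opprD addrA.
have [g1 [d1 g2] g3 g4] := config_mono ss.
move=> [h1 [d h2] h3 h4]; split=> [L L' P|| i j p L a|L a]; rewrite ?E.
- by rewrite (h1 _ _ P) (g1 _ _ P).
- exists (maxn d d1) => k; apply: (@polyf_ext _ _ _ (fun v => (T (inst v k) - combo l (inst v k)) - c * mono s (inst v k))).
    by move=> v; rewrite E.
  apply: polyf_sub => //; first exact: polyf_leq (leq_maxl _ _) (h2 k).
  by apply: polyf_scale => //; apply: polyf_leq (leq_maxr _ _) (g2 k).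
- by rewrite h3 // g3 // mulr0 subr0.
- by rewrite h4 // g4 // mulr0 subr0.
Qed.

Definition spans (P : pred gen) n T := exists2 l,
  forall cs, cs \in l -> [/\ S cs.1, all P cs.2 & (gsize cs.2 < n)%N] &
  forall L, T L = combo l L.

(** Triangular elimination with three nested inductions: on the roots not yet killed, on the number
    of points (a residue has fewer), and on the exponents of the current root, cleared from below.
    Once every string is killed, single points included, only the constant [T [::]] remains. *)
Lemma span_main (rest done : seq (nat * nat)) : rootlist m = done ++ rest -> forall n T, config m S T ->
  (forall L, (n <= size L)%N -> T L = 0) -> (forall d, d \in done -> killed d.1 d.2 T) ->
  spans (fun b => b.1 \in rest) n T.
Proof.
elim: rest done => [|[i j] rest IHrest] done cut n T cT Tn Tk.
  case: n Tn => [|n] Tn.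
    by exists [::] => // L; rewrite /combo big_nil Tn.
  have [d Td] := config_poly cT.
  exists [:: (T [::], [::])] => [cs|L].
    rewrite inE => /eqP -> /=; split=> //; last by rewrite /gsize big_nil.
    exact: (polyf_in (v := fun=> 0) SS (fun=> subring0 SS) (Td [::])).
  rewrite /combo big_seq1 /mono /= invr1 mul1r.
  case: L => [|[c x] L]; first by rewrite mulr1.
  rewrite mulr0; have [Lm|Lm] := boolP (all (fun a : elt => a.1 < m)%N ((c, x) :: L)); last exact: (config_col cT).
  have /Tk /(_ x L) : (c, c) \in done.
    by move: cut; rewrite cats0 => <-; rewrite mem_rootlist leqnn; case/andP: Lm.
  by rewrite /= /str /roots subSnn.
have /andP[ij jm] := cut_root cut.
have TkL T' : (forall d, d \in done -> killed d.1 d.2 T') -> (0 < i)%N -> killed i.-1 j T'.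
  by move=> h i0; exact: (h (_, _) (cut_left cut i0)).
(* When [j.+1 = m] there is no longer root on this side, but then colour [m] is out of range and
   [T'] vanishes anyway. *)
have TkR T' : config m S T' -> (forall d, d \in done -> killed d.1 d.2 T') -> killed i j.+1 T'.
  move=> cT' h; have [jm'|jm'] := ltnP j.+1 m; first exact: (h (_, _) (cut_right cut jm')).
  move=> p L; apply: (config_col cT'); rewrite all_cat negb_and; apply/orP; left.
  apply/allPn; exists (j.+1, p); last by rewrite -leqNgt.
  by apply/mapP; exists j.+1; rewrite ?mem_roots //; lia.
(* The residue of [T] lives in degrees [r0] to [d], so [k] exponents of [[i..j]] are left to
   clear. *)
suff inner k r0 d : (r0 + k)%N = d.+1 -> forall n T, config m S T ->
    (forall L, (n <= size L)%N -> T L = 0) -> (forall d, d \in done -> killed d.1 d.2 T) ->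
    (forall L r, (r < r0)%N || (d < r)%N -> (resid i j T L)`_r = 0) ->
    spans (fun b => (b.1 \in rest) || (b.1 == (i, j)) && (r0 <= b.2 <= d)%N) n T.
  have [d Td] := config_poly cT.
  have [L r /= dr|l lP lE] := @inner d.+1 0%N d (add0n _) n T cT Tn Tk.
    by rewrite nth_default // (leq_trans (size_resid SS cT ij (TkL _ Tk) (TkR _ cT Tk) L Td)).
  exists l => // cs /lP[h1 h h2]; split=> //; apply: sub_all h => b /orP[h|/andP[/eqP ->]].
    by rewrite inE h orbT.
  by rewrite inE eqxx.
move=> {n T cT Tn Tk} rk n; elim/ltn_ind: n k r0 rk => n IHn.
elim=> [|k IHk] r0 rk T cT Tn Tk T0.
  (* No exponent is left: the residue vanishes and [(i, j)] joins the killed roots. *)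
  have kT : killed i j T.
    move=> p L; rewrite (residE SS cT ij (TkL _ Tk) (TkR _ cT Tk)).
    suff -> : resid i j T L = 0 by rewrite horner0 mulr0.
    by apply/polyP => r; rewrite coef0 T0 //; move: rk; lia.
  have [|e|l lP lE] := IHrest (rcons done (i, j)) _ n T cT Tn; first by rewrite cat_rcons.
    by rewrite mem_rcons inE => /orP[/eqP ->|/Tk].
  by exists l => // cs /lP[h1 h h2]; split=> //; apply: sub_all h => b /= ->.
have [n0|n0] := posnP n.
  by exists [::] => // L; rewrite /combo big_nil Tn // n0.
pose Tr L := (resid i j T L)`_r0; pose sg : R := (-1) ^+ (j - i).
have cTr : config m S Tr := config_resid SS cT ij (TkL _ Tk) (TkR _ cT Tk) r0.
have [d' Td'] := config_poly cT.
have [||d1 d1d|L r r0r|l lP lE] := IHn (n - (j.+1 - i))%N _ k.+1 r0 rk Tr cTr.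
- by move: n0 ij; lia.
- by move=> L; exact: (bounded_resid r0 Tn).
- exact: (killed_resid i j cT r0 (Tk _ d1d)).
(* Exchanging the two residues shows that the residue of [Tr] lives in the same range of degrees, so
   no smaller exponent enters the monomials obtained by induction. *)
- rewrite (resid_swap _ _ _ SS cT ij Td' (TkL _ Tk) (TkR _ cT Tk)).
  rewrite resid_eq0 ?coef0 // => p; exact: T0.
(* Adjoining [(i, j, r0)] inverts the residue in degree [r0]; [sg] cancels the sign of [eps]. *)
pose l' := [seq (sg * cs.1, (i, j, r0) :: cs.2) | cs <- l].
have Ssg : S sg by exact: subring_sign.
have genP (b : gen) : (b.1 \in rest) || (b.1 == (i, j)) && (r0 <= b.2 <= d)%N -> b.1 \in (i, j) :: rest.
  by case/orP => [h|/andP[/eqP -> _]]; rewrite inE ?eqxx ?h ?orbT.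
have restP (g : nat * nat) : g \in (i, j) :: rest -> g \in rootlist m.
  by move=> h; rewrite cut mem_cat h orbT.
have l'P cs : cs \in l' -> [/\ S cs.1, all (fun b => (b.1 \in rest) || (b.1 == (i, j)) && (r0 <= b.2 <= d)%N) cs.2
    & (gsize cs.2 < n)%N].
  case/mapP=> -[c s] /lP[/= Sc Ps sn] -> /=; split.
  - exact: subringM.
  - by rewrite eqxx leqnn Ps andbT; apply/orP; right => /=; move: rk; lia.
  - by rewrite /gsize big_cons -/(gsize s) /=; move: sn; lia.
have l'root cs : cs \in l' -> all (fun b : gen => b.1 \in rootlist m) cs.2.
  by case/l'P=> _ h _; apply: sub_all h => b /genP /restP.
have l'good cs : cs \in l' -> all (goodgen i j) cs.2.
  case/l'P=> _ h _; apply: sub_all h => b /genP bb; apply/andP; split.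
    by have := restP _ bb; rewrite mem_rootlist => /andP[].
  move: bb; rewrite inE => /orP[/eqP ->|/(cut_notabove_rest cut)/andP[]//].
  by rewrite /notabove eqxx implybT.
pose T' L := T L - combo l' L.
have cT' : config m S T'.
  by apply: config_sub_combo => // cs cl; split; [case: (l'P _ cl)|exact: l'root].
(* Degree [r0] is cancelled, and degrees below it are untouched because no exponent smaller than
   [r0] occurs in [l']. Degrees above [r0] up to [d] may change; they are still to be treated. *)
have T'E L : exists2 q, resid i j T' L = resid i j T L - q &
    forall r, (r <= r0)%N || (d < r)%N -> q`_r = if r == r0 then Tr L else 0.
  have [q qE qr] := combo_str L ij l'good.
  exists q => [|r].
    apply: resid_unique => p; rewrite /T' qE (residE SS cT ij (TkL _ Tk) (TkR _ cT Tk)).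
    by rewrite hornerD hornerN mulrBr.
  move=> rr; rewrite qr; case: eqP => [->|/eqP rr0].
    rewrite big_map lE /combo; apply: eq_bigr => cs _ /=; rewrite inE eqxx /= ?eqxx.
    by rewrite mulrACA -expr2 sqrr_sign mul1r.
  rewrite big_seq big1 // => cs /l'P[_ h _]; rewrite ifN ?mulr0 //; apply/negP => bs.
  have /= := allP h _ bs; rewrite eqxx /= => /orP[|]; last by move: rr rr0; lia.
  by move/(cut_notabove_rest cut)/andP => [_]; rewrite eqxx.
have T'n L : (n <= size L)%N -> T' L = 0.
  move=> nL; rewrite /T' Tn // /combo big_seq big1 ?subr0 // => cs /l'P[_ _ sn].
  by rewrite mono_size ?mulr0 // gtn_eqF // (leq_trans sn).
have T'k e : e \in done -> killed e.1 e.2 T'.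
  move=> ed p L; rewrite /T' Tk //.
  have ee : (e.1 <= e.2)%N by move: (mem_rootlist m e); rewrite cut mem_cat ed => /esym/andP[].
  have [cs cl|q qE qr] := @combo_str e.1 e.2 l' L ee.
    case/l'P: (cl) => _ h _; apply/allP => b bs; apply/andP; split.
      by have := allP (l'root _ cl) _ bs; rewrite mem_rootlist => /andP[].
    by have /genP /(cut_notabove cut ed) /andP[] := allP h _ bs.
  suff -> : combo l' (str e.1 e.2 p ++ L) = 0 by rewrite subr0.
  rewrite qE (_ : q = 0) ?horner0 ?mulr0 //; apply/polyP => r; rewrite qr coef0 big_seq big1 // => cs /l'P[_ h _].
  rewrite ifN ?mulr0 //; apply/negP => bs; have /genP /(cut_notabove cut ed) /andP[_] := allP h _ bs.
  by rewrite /= -surjective_pairing eqxx.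
have [|L r rr|l2 l2P l2E] := IHk r0.+1 _ T' cT' T'n T'k.
- by move: rk; lia.
- have [q -> qr] := T'E L; rewrite coefB qr; last by move: rr; rewrite ltnS.
  case: eqP => [->|rr0]; first by rewrite subrr.
  by rewrite subr0 T0 //; move: rr rr0; lia.
exists (l' ++ l2) => [cs|L].
  rewrite mem_cat => /orP[/l'P//|/l2P[h1 h2 h3]]; split=> //; apply: sub_all h2 => b.
  case/orP => [->//|/andP[-> h]]; apply/orP; right; move: h; lia.
by rewrite /combo big_cat /= -/(combo l' L) -/(combo l2 L) -l2E /T' addrCA subrr addr0.
Qed.
End Span.

Lemma rem_perm (T : eqType) (x : T) (s s' : seq T) : x \in s -> x \in s' ->
  perm_eq (rem x s) (rem x s') -> perm_eq s s'.
Proof.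
move=> xs xs' h; rewrite (permPl (perm_to_rem xs)) perm_sym (permPl (perm_to_rem xs')).
by rewrite perm_cons perm_sym.
Qed.

(** The residues of a relation are relations between the monomials with one generator [(i, j, r)]
    removed. Induction on size disposes of the monomials containing such a generator, and the others
    only use roots in [rest]. *)
Lemma mono_indep m (rest done : seq (nat * nat)) : rootlist m = done ++ rest ->
  forall (J : finType) (c : J -> R) (s : J -> seq gen) (P : pred J),
  (forall j, P j -> all (fun b => b.1 \in rest) (s j)) ->
  (forall j j', P j -> P j' -> perm_eq (s j) (s j') -> j = j') ->
  (forall L, \sum_(j | P j) c j * mono (s j) L = 0) -> forall j, P j -> c j = 0.
Proof.
elim: rest done => [|[i j] rest IHrest] done cut J c s P sP sI s0.
  have sE k : P k -> s k = [::] by move/sP; case: (s k).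
  move=> k Pk; have := s0 [::]; rewrite (eq_bigr c) => [|k' /sE ->]; last first.
    by rewrite /mono /= invr1 !mulr1.
  rewrite (eq_bigl (pred1 k)) ?big_pred1_eq // => k' /=.
  by apply/idP/eqP => [Pk'|->//]; apply: sI; rewrite ?sE.
have /andP[ij jm] := cut_root cut.
have restP (g : nat * nat) : g \in (i, j) :: rest -> g \in rootlist m.
  by move=> h; rewrite cut mem_cat h orbT.
have [n nP] : exists n, forall k, P k -> (size (s k) <= n)%N.
  by exists (\max_(k | P k) size (s k)) => k Pk; exact: (@leq_bigmax_cond _ P (fun k => size (s k)) k Pk).
elim: n s P sP sI s0 nP => [|n IHn] s P sP sI s0 nP.
  apply: (IHrest (rcons done (i, j))) sI s0; first by rewrite cat_rcons.
  by move=> k /nP; rewrite leqn0 size_eq0 => /eqP ->.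
have c0 r k : P k -> (i, j, r) \in s k -> c k = 0.
  move=> Pk rk; apply: (IHn (fun k => rem (i, j, r) (s k)) (fun k => P k && ((i, j, r) \in s k))).
  - by move=> k' /andP[Pk' _]; apply/rem_all/sP.
  - by move=> k1 k2 /andP[P1 r1] /andP[P2 r2] /rem_perm h; apply: sI => //; apply: h.
  - move=> L; have : exists2 q : {poly R}, forall p, \sum_(k | P k) c k * mono (s k) (str i j p ++ L) = cw i j p L * q.[p]
        & q`_r = \sum_(k | P k && ((i, j, r) \in s k)) c k * ((-1) ^+ (j - i) * mono (rem (i, j, r) (s k)) L).
      pose l := [seq (c k, s k) | k <- enum P].
      have [cs|q qE qr] := @combo_str i j l L ij.
        case/mapP=> k'; rewrite mem_enum => Pk' -> /=; apply/allP => b bs; apply/andP.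
        have bb := allP (sP _ Pk') _ bs; split; first by have := restP _ bb; rewrite mem_rootlist => /andP[].
        move: bb; rewrite inE => /orP[/eqP ->|/(cut_notabove_rest cut)/andP[]//].
        by rewrite /notabove eqxx implybT.
      exists q => [p|]; first by rewrite -qE /combo big_map big_enum.
      rewrite qr big_map big_enum /= big_mkcondr; apply: eq_bigr => k' _.
      by case: ifP; rewrite ?mulr0.
    case=> q qE qr.
    have q0 : q = 0.
      apply: (@poly_cofinite_eq0 _ (unzip2 L)) => p pL; apply: (mulfI (cw_neq0 i j pL)).
      by rewrite -qE s0 mulr0.
    move: qr; rewrite q0 coef0 => /esym.
    under eq_bigr do rewrite mulrCA; rewrite -mulr_sumr => /eqP.
    by rewrite mulf_eq0 signr_eq0 => /eqP.
  - move=> k' /andP[Pk' rk']; rewrite size_rem //; by have := nP _ Pk'; case: (size _).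
  - by rewrite Pk.
pose Q k := P k && ~~ has (fun b : gen => b.1 == (i, j)) (s k).
have cQ k : P k -> ~~ Q k -> c k = 0.
  move=> Pk; rewrite /Q Pk negbK => /hasP[[b r] bs /eqP /= e]; by apply: (c0 r); rewrite // -e.
move=> k Pk; have [Qk|/(cQ _ Pk)//] := boolP (Q k).
apply: (IHrest (rcons done (i, j)) _ J c s Q) => //; first by rewrite cat_rcons.
- move=> k' /andP[/sP/allP h /hasPn h']; apply/allP => b bs.
  by have := h _ bs; rewrite inE (negPf (h' _ bs)).
- by move=> k1 k2 /andP[P1 _] /andP[P2 _]; exact: sI.
- move=> L; rewrite -[RHS](s0 L) [RHS](bigID Q) /= [X in _ = _ + X]big1 ?addr0.
    by apply: eq_bigl => k'; rewrite /Q andbA andbb.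
  by move=> k' /andP[Pk' nQ]; rewrite cQ ?mul0r.
Qed.
End Basis.

(** * The deformed product and its leading term *)

Section Deformation.
Variable R : numFieldType.
Notation elt := (nat * R)%type.
Notation gen := (nat * nat * nat)%type.
Local Notation om0 := (@om0 R).
Implicit Types (F G T : seq elt -> R) (L : seq elt) (S : R -> Prop) (v : nat -> R).

Definition cart (k l : nat) : R := if k == l then 2 else if adj k l then -1 else 0.

(* [om1] is the factor [zeta] of the shuffle product, multiplied by the part of the common denominator that
   separates the two variables; [om0] is its leading term. *)
Definition om1 (a b : elt) : R := om0 a b * (1 + cart a.1 b.1 / (2 * (a.2 - b.2))).

Lemma adjC k l : adj k l = adj l k. Proof. by rewrite /adj orbC. Qed.

Lemma adjnn k : adj k k = false.
Proof. by rewrite /adj orbb; apply/eqP; lia. Qed.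

(** The number of pairs of points with adjacent colours, that is, the degree of the common
    denominator. *)
Fixpoint adjn (w : seq nat) : nat := if w is c :: w' then (\sum_(b <- w') adj c b + adjn w')%N else 0.

Lemma adjn_double w : ((adjn w).*2 = \sum_(a <- w) \sum_(b <- w) adj a b)%N.
Proof.
elim: w => [|c w IH] /=; first by rewrite big_nil.
rewrite !big_cons adjnn add0n.
rewrite [X in (_ = _ + X)%N](eq_bigr (fun a => adj a c + \sum_(b <- w) adj a b)%N) => [|a _]; last by rewrite big_cons.
rewrite big_split /= -IH (eq_bigr (fun a => adj a c : nat)) => [|a _]; last by rewrite adjC.
by rewrite doubleD -!addnn !addnA.
Qed.

Lemma perm_adjn w w' : perm_eq w w' -> adjn w = adjn w'.
Proof.
move=> P; apply: double_inj; rewrite !adjn_double (perm_big _ P); apply: eq_bigr => a _.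
exact: perm_big.
Qed.

Lemma adjn_roots i j : (i <= j)%N -> adjn (roots i j) = (j - i)%N.
Proof.
move=> ij; rewrite /roots subSn //; move: (j - i)%N => {ij} n.
elim: n i => [|n IH] i; first by rewrite /= big_nil.
have -> : adjn (iota i n.+2) = (\sum_(b <- i.+1 :: iota i.+2 n) adj i b + adjn (iota i.+1 n.+1))%N by [].
rewrite IH big_cons {1}/adj eqxx /= big_seq big1 ?addn0 // => k; rewrite mem_iota /adj => /andP[h _].
by move: h; case: eqP => //; case: eqP => //; lia.
Qed.

Lemma adjn_cat w w' : (adjn (w ++ w') = adjn w + adjn w' + \sum_(a <- w) \sum_(b <- w') adj a b)%N.
Proof.
elim: w => [|c w IH] /=; first by rewrite big_nil addn0.
rewrite IH big_cat big_cons /=; lia.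
Qed.

Lemma adjn_splits L p : p \in splits L ->
  (adjn (unzip1 L) = adjn (unzip1 p.1) + adjn (unzip1 p.2) + \sum_(a <- p.1) \sum_(b <- p.2) adj a.1 b.1)%N.
Proof.
move=> /splits_perm pL; rewrite (perm_adjn (perm_map _ pL)) /unzip1 map_cat adjn_cat; congr (_ + _)%N.
by rewrite big_map; apply: eq_bigr => a _; rewrite big_map.
Qed.

Definition dil (t : R) L := [seq (a.1, t * a.2) | a <- L].

(* [lead e F T]: the numerator [F] has degree at most [e + adjn - size] (so [e] bounds the degree of the rational
   function, shifted by one for every variable), with component [T] in that degree.  This is expressed through the
   behaviour at the point [s^-1 L] for [s] near [0]. *)
Definition lead e F T := forall L, uniq (unzip2 L) -> exists2 q : {poly R}, q.[0] = T L &
  forall s, s != 0 -> q.[s] * s ^+ size L = s ^+ (e + adjn (unzip1 L)) * F (dil s^-1 L).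

Lemma unzip1_dil t L : unzip1 (dil t L) = unzip1 L.
Proof. by rewrite /unzip1 -map_comp. Qed.

Lemma uniq_dil t L : t != 0 -> uniq (unzip2 L) -> uniq (unzip2 (dil t L)).
Proof.
move=> t0; have -> : unzip2 (dil t L) = [seq t * x | x <- unzip2 L] by rewrite /unzip2 /dil -!map_comp.
by rewrite (map_inj_uniq (mulfI t0)).
Qed.

Lemma splits_map (T T' : Type) (f : T -> T') (s : seq T) :
  splits (map f s) = [seq (map f p.1, map f p.2) | p <- splits s].
Proof. by elim: s => //= a s ->; rewrite map_cat -!map_comp. Qed.

Lemma om0_dil t (a b : elt) : om0 (a.1, t * a.2) (b.1, t * b.2) = t ^+ adj a.1 b.1 * om0 a b.
Proof.
rewrite /om0 /cross /adj /=; have [E|_] := eqVneq a.1.+1 b.1; rewrite /= ?mul1r.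
  have -> : (b.1.+1 == a.1) = false by lia.
  by rewrite !mulr1 expr1 mulrBr.
by case: eqP => _; rewrite ?expr0 ?expr1 ?mulr1 ?mul1r ?mulrBr.
Qed.

(** Enlarging all positions by [s^-1] multiplies the correction [cart / (2 (x - y))] by [s], so it
    disappears at [s = 0]. *)
Lemma om1_dil (a b : elt) : a.2 != b.2 -> exists2 q : {poly R}, q.[0] = om0 a b &
  forall s, s != 0 -> q.[s] = s ^+ adj a.1 b.1 * om1 (a.1, s^-1 * a.2) (b.1, s^-1 * b.2).
Proof.
move=> ab; exists (om0 a b *: (1 + (cart a.1 b.1 / (2 * (a.2 - b.2))) *: 'X)); first by rewrite !hornerE.
move=> s s0; rewrite hornerZ hornerD hornerC hornerZ hornerX /om1 om0_dil /= exprVn !mulrA divff ?expf_neq0 // mul1r -mulrBr.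
have ab' : a.2 - b.2 != 0 by rewrite subr_eq0.
congr (_ * (1 + _)); field; by rewrite s0 ab'.
Qed.

Lemma lead_eq e F F' T : (forall L, uniq (unzip2 L) -> F L = F' L) -> lead e F T -> lead e F' T.
Proof.
move=> FF lF L uL; have [q q0 qE] := lF L uL; exists q => // s s0.
by rewrite qE // FF // uniq_dil // invr_neq0.
Qed.

Lemma sum_poly_family (I : eqType) (r : seq I) (t : I -> R) (f : I -> R -> R) :
  (forall i, i \in r -> exists2 q : {poly R}, q.[0] = t i & forall s, s != 0 -> q.[s] = f i s) ->
  exists2 q : {poly R}, q.[0] = \sum_(i <- r) t i & forall s, s != 0 -> q.[s] = \sum_(i <- r) f i s.
Proof.
elim: r => [|i r IH] h; first by exists 0 => [|s _]; rewrite horner0 big_nil.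
have [q q0 qE] := h i (mem_head _ _).
have [j jr|q' q0' qE'] := IH; first by apply: h; rewrite inE jr orbT.
by exists (q + q') => [|s s0]; rewrite big_cons hornerD ?q0 ?q0' ?qE ?qE'.
Qed.

Lemma prod_poly_family (I : eqType) (r : seq I) (t : I -> R) (f : I -> R -> R) :
  (forall i, i \in r -> exists2 q : {poly R}, q.[0] = t i & forall s, s != 0 -> q.[s] = f i s) ->
  exists2 q : {poly R}, q.[0] = \prod_(i <- r) t i & forall s, s != 0 -> q.[s] = \prod_(i <- r) f i s.
Proof.
elim: r => [|i r IH] h; first by exists 1 => [|s _]; rewrite hornerC big_nil.
have [q q0 qE] := h i (mem_head _ _).
have [j jr|q' q0' qE'] := IH; first by apply: h; rewrite inE jr orbT.
by exists (q * q') => [|s s0]; rewrite big_cons hornerM ?q0 ?q0' ?qE ?qE'.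
Qed.

Lemma splits_uniq2 L p : uniq (unzip2 L) -> p \in splits L ->
  [/\ uniq (unzip2 p.1), uniq (unzip2 p.2) & forall a b, a \in p.1 -> b \in p.2 -> a.2 != b.2].
Proof.
move=> uL /splits_perm /(perm_map snd) /perm_uniq; rewrite -/(unzip2 L) uL map_cat cat_uniq => /esym/and3P[u1 h u2].
split=> // a b /(map_f snd) aa /(map_f snd) bb.
by apply: contraNneq h => e; apply/hasP; exists b.2 => //=; rewrite -e.
Qed.

(** Over a splitting, [size] is additive and [adjn] is additive up to the pairs across the two
    parts; the weights of those pairs supply the missing powers of [s]. *)
Lemma lead_op e e' F G T T' : lead e F T -> lead e' G T' -> lead (e + e') (op om1 F G) (op om0 T T').
Proof.
move=> lF lG L uL.
pose X (s : R) : R := s ^+ (e + e' + adjn (unzip1 L)).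
have [p pL|q q0 qE] := @sum_poly_family _ (splits L) (fun p => T p.1 * T' p.2 * weight om0 p.1 p.2)
  (fun p s => X s / s ^+ size L * (F (dil s^-1 p.1) * G (dil s^-1 p.2) * weight om1 (dil s^-1 p.1) (dil s^-1 p.2))); last first.
  exists q; first by rewrite q0 op_splits.
  move=> s s0; rewrite qE // -mulr_sumr mulrAC divfK ?expf_neq0 //; congr (_ * _).
  by rewrite op_splits /dil splits_map big_map.
have [u1 u2 u12] := splits_uniq2 uL pL.
have [q1 q10 q1E] := lF _ u1; have [q2 q20 q2E] := lG _ u2.
have [a ap|q3 q30 q3E] := @prod_poly_family _ p.1 (fun a => \prod_(b <- p.2) om0 a b)
   (fun a s => s ^+ (\sum_(b <- p.2) adj a.1 b.1) * \prod_(b <- dil s^-1 p.2) om1 (a.1, s^-1 * a.2) b).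
  have [b bp|q q0 qE] := @prod_poly_family _ p.2 (fun b => om0 a b)
     (fun b s => s ^+ adj a.1 b.1 * om1 (a.1, s^-1 * a.2) (b.1, s^-1 * b.2)).
    by apply: om1_dil; exact: u12.
  by exists q => // s s0; rewrite qE // big_split /= -expr_sum big_map.
exists (q1 * q2 * q3) => [|s s0]; first by rewrite !hornerM q10 q20 q30.
have sn k : s ^+ k != 0 by rewrite expf_neq0.
have E1 : F (dil s^-1 p.1) = q1.[s] * s ^+ size p.1 / s ^+ (e + adjn (unzip1 p.1)) by rewrite q1E // mulrC mulKf.
have E2 : G (dil s^-1 p.2) = q2.[s] * s ^+ size p.2 / s ^+ (e' + adjn (unzip1 p.2)) by rewrite q2E // mulrC mulKf.
have E3 : q3.[s] = s ^+ (\sum_(a <- p.1) \sum_(b <- p.2) adj a.1 b.1) * weight om1 (dil s^-1 p.1) (dil s^-1 p.2).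
  by rewrite q3E // big_split /= -expr_sum /weight big_map.
rewrite !hornerM E1 E2 E3 /X (adjn_splits pL) (perm_size (splits_perm pL)) size_cat !exprD; field.
by rewrite !sn.
Qed.

Lemma lead_lone : lead 0 (@lone R) (@lone R).
Proof.
move=> L _; exists (lone L)%:P => [|s s0]; first by rewrite hornerC.
by case: L => [|x L]; rewrite hornerC /= ?mul0r ?mulr0 // big_nil.
Qed.

Lemma lead_scale c e F T : lead e F T -> lead e (fun L => c * F L) (fun L => c * T L).
Proof.
move=> lF L uL; have [q q0 qE] := lF L uL; exists (c *: q) => [|s s0]; first by rewrite hornerZ q0.
by rewrite hornerZ -mulrA qE // mulrCA.
Qed.

(** On a string [adjn - size] equals -1, so degree [r] corresponds to weight [r + 1]. Counting one
    unit per point keeps all weights nonnegative, although the rational function may have negative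
    degree. *)
Lemma lead_eps i j r : (i <= j)%N -> lead r.+1 (@eps R (i, j, r)) (@eps R (i, j, r)).
Proof.
move=> ij L _; exists (@eps R (i, j, r) L)%:P => [|s s0]; first by rewrite hornerC.
rewrite hornerC /eps unzip1_dil; case: ifP => P; last by rewrite mul0r mulr0.
rewrite (perm_adjn P) adjn_roots // -[size L](size_map fst) (perm_size P) size_iota.
have -> : \prod_(a <- dil s^-1 L) (if a.1 == i then a.2 ^+ r else 1)
     = s ^- r * \prod_(a <- L) (if a.1 == i then a.2 ^+ r else 1).
  rewrite big_map (eq_bigr (fun a => (if a.1 == i then s ^- r else 1) * (if a.1 == i then a.2 ^+ r else 1))) => [|a _].
    rewrite big_split /= -(big_map fst xpredT (fun k => if k == i then s ^- r else 1)) (perm_big _ P) /=.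
    by rewrite prod_uniq_if ?iota_uniq // mem_roots // leqnn ij.
  by case: ifP; rewrite ?mulr1 // exprMn exprVn.
have -> : (r.+1 + (j - i) = r + (j.+1 - i))%N by lia.
by rewrite exprD [RHS]mulrCA [RHS]mulrC; field; exact: expf_neq0.
Qed.

(** The restriction of [F] to the ray through [L], a junk value when that is not polynomial; its
    coefficients are the homogeneous components of [F] at [L]. *)
Definition hpoly F L : {poly R} := epsilon (inhabits 0) (fun q => forall t, F (dil t L) = q.[t]).

Definition hc F k L := (hpoly F L)`_k.

Lemma hpoly_unique F L (q : {poly R}) : (forall t, F (dil t L) = q.[t]) -> hpoly F L = q.
Proof.
move=> qE; have h : exists q : {poly R}, forall t, F (dil t L) = q.[t] by exists q.
have := epsilon_spec (inhabits 0) _ h; rewrite -/(hpoly F L) => E.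
by apply: (@poly_cofinite_eq _ [::]) => t _; rewrite -E qE.
Qed.

Lemma inst_std v (l : seq (nat * nat)) :
  inst v l = inst (fun k => v (nth 0%N (unzip2 l) k)) (lstd (unzip1 l) 0).
Proof.
have -> : unzip1 l = unzip1 (inst v l) by rewrite /unzip1 /inst -map_comp.
rewrite inst_lstd // => s; rewrite size_map => sl.
by rewrite add0n /inst /unzip2 -map_comp (nth_map (0, 0)%N) // (nth_map (0, 0)%N).
Qed.

Lemma inst_self L : inst (nth 0 (unzip2 L)) (lstd (unzip1 L) 0) = L.
Proof. exact: inst_lstd. Qed.

Section Homogeneous.
Variables (S : R -> Prop) (F : seq elt -> R).
Hypothesis SS : subringP S.

Lemma hpoly_coefs d l : lpolyd S d F -> exists2 fk : nat -> (nat -> R) -> R, (forall k, polyf S d (fk k)) &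
  forall v, hpoly F (inst v l) = \poly_(k < d.+1) fk k v.
Proof.
move=> Fd; have [i|i|fk Pfk fkE] := polyf_affine_subst SS (al := fun _ _ => 0) (be := fun i v => v i) (Fd l).
- by apply: polyf_cst; exact: subring0.
- exact: polyf_var.
exists fk => // v; apply: hpoly_unique => t; rewrite horner_poly.
transitivity (\sum_(k < d.+1) t ^+ k * fk k v); last by apply: eq_bigr => k _; rewrite mulrC.
rewrite -fkE; congr F; rewrite /dil /inst -map_comp; apply: eq_map => c /=; by rewrite add0r.
Qed.

Lemma hpolyE L t : lpoly S F -> F (dil t L) = (hpoly F L).[t].
Proof.
move=> PF; have [d Pd] := PF (lstd (unzip1 L) 0).
have [q _ qE] := polyf_line (fun=> 0) (nth 0 (unzip2 L)) Pd.
have qE' t' : F (dil t' L) = q.[t'].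
  rewrite -qE -{1}(inst_self L) /dil /inst -map_comp; congr F; apply: eq_map => c /=; by rewrite add0r.
by rewrite (hpoly_unique qE').
Qed.

Lemma size_hpoly d L : lpolyd S d F -> (size (hpoly F L) <= d.+1)%N.
Proof.
move=> Fd; have [fk _ fkE] := hpoly_coefs (lstd (unzip1 L) 0) Fd.
by rewrite -(inst_self L) fkE size_poly.
Qed.

Lemma lpolyd_hc d k : lpolyd S d F -> lpolyd S d (hc F k).
Proof.
move=> Fd l; have [fk Pfk fkE] := hpoly_coefs l Fd.
apply: (@polyf_ext _ _ _ (fun v => if (k < d.+1)%N then fk k v else 0)) => [v|].
  by rewrite /hc fkE coef_poly.
by case: (k < d.+1)%N; [exact: Pfk|exact: polyf0].
Qed.

Lemma lpoly_hc k : lpoly S F -> lpoly S (hc F k).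
Proof.
move=> PF l; have [d Pd] := PF l.
have [i|i|fk Pfk fkE] := polyf_affine_subst SS (al := fun _ _ => 0) (be := fun i v => v i) Pd.
- by apply: polyf_cst; exact: subring0.
- exact: polyf_var.
exists d; apply: (@polyf_ext _ _ _ (fun v => if (k < d.+1)%N then fk k v else 0)) => [v|].
  rewrite /hc (hpoly_unique (q := \poly_(k < d.+1) fk k v)) ?coef_poly // => t; rewrite horner_poly.
  transitivity (\sum_(k < d.+1) t ^+ k * fk k v); last by apply: eq_bigr => k' _; rewrite mulrC.
  rewrite -fkE; congr F; rewrite /dil /inst -map_comp; apply: eq_map => c /=; by rewrite add0r.
by case: (k < d.+1)%N; [exact: Pfk|exact: polyf0].
Qed.

Lemma hc_dil u k L : lpoly S F -> hc F k (dil u L) = u ^+ k * hc F k L.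
Proof.
move=> PF; rewrite /hc.
rewrite (hpoly_unique (q := hpoly F L \Po (u *: 'X))) => [|t].
  rewrite comp_polyE coef_sum.
  rewrite (eq_bigr (fun i : 'I__ => if i == k :> nat then u ^+ k * (hpoly F L)`_k else 0)) => [|i _].
    case: (ltnP k (size (hpoly F L))) => ks.
      rewrite (bigD1 (Ordinal ks)) //= eqxx big1 ?addr0 // => i ik.
      by rewrite ifN //; apply: contraNneq ik => e; apply/eqP/val_inj.
    rewrite nth_default // mulr0 big1 // => i _; by case: ifP.
  rewrite coefZ exprZn coefZ coefXn [k == i]eq_sym; case: eqP => [->|_]; first by rewrite mulr1 mulrC.
  by rewrite !mulr0.
by rewrite horner_comp hornerZ hornerX -hpolyE // /dil -map_comp; congr F; apply: eq_map => c /=; rewrite mulrA [u * t]mulrC.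
Qed.

Lemma lsym_hc k : lpoly S F -> lsym F -> lsym (hc F k).
Proof.
move=> PF sF L L' P; rewrite /hc; suff -> : hpoly F L = hpoly F L' by [].
by apply: hpoly_unique => t; rewrite -hpolyE //; apply: sF; apply: perm_map.
Qed.

Lemma list_density : lpoly S F -> (forall L, uniq (unzip2 L) -> F L = 0) -> forall L, F L = 0.
Proof.
move=> PF h L; have [d Pd] := PF (lstd (unzip1 L) 0).
have u2 w o v : unzip2 (inst v (lstd w o)) = [seq v k | k <- iota o (size w)].
  by elim: w o => //= c w IH o; rewrite IH.
rewrite -(inst_self L); apply: (polyf_density (n := size L) Pd) => v iv; apply: h.
rewrite u2 size_map map_inj_in_uniq ?iota_uniq // => a b; rewrite !mem_iota !add0n => al bl.
exact: iv.
Qed.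
End Homogeneous.
Lemma lpoly_sub S F G : subringP S -> lpoly S F -> lpoly S G -> lpoly S (fun L => F L - G L).
Proof. by move=> SS PF PG l; apply: polyfn_sub. Qed.

Lemma lpoly_scale S c F : subringP S -> S c -> lpoly S F -> lpoly S (fun L => c * F L).
Proof. by move=> SS Sc PF l; apply: polyfn_scale. Qed.

(** [lead] describes [F] near infinity and [hc] its coefficients, so the comparison reverses a
    polynomial. It is carried out at distinct points and extended by density. *)
Lemma lead_hc S e F T k L : subringP S -> lpoly S F -> lpoly S T -> lead e F T ->
  (e + adjn (unzip1 L) <= k + size L)%N ->
  hc F k L = if (k + size L == e + adjn (unzip1 L))%N then T L else 0.
Proof.
move=> SS PF PT lF; set A := (e + adjn (unzip1 L))%N => kL.
apply/eqP; rewrite -subr_eq0; apply/eqP; pose C := (k + size L == A)%N; rewrite -/C.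
pose G L' := hc F k L' - (C%:R * T L').
suff H w : w = unzip1 L -> forall v, G (inst v (lstd w 0)) = 0.
  have := H _ erefl (nth 0 (unzip2 L)); rewrite inst_self /G; by case: (C); rewrite ?mul1r ?mul0r.
move=> wE; have [d Pd] : polyfn S (fun v => G (inst v (lstd w 0))).
  exact: (lpoly_sub SS (lpoly_hc SS k PF) (lpoly_scale SS (subring_nat SS C) PT) (lstd w 0)).
apply: (polyf_density (n := size w) Pd) => v iv; set L' := inst v (lstd w 0).
have L'w : unzip1 L' = w.
  by rewrite /L'; elim: (w) 0%N => //= c w' IH o; rewrite IH.
have L'u : uniq (unzip2 L').
  have -> : unzip2 L' = [seq v k | k <- iota 0 (size w)].
    by rewrite /L'; elim: (w) 0%N => //= c w' IH o; rewrite IH.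
  rewrite map_inj_in_uniq ?iota_uniq // => a b; rewrite !mem_iota !add0n => al bl.
  exact: iv.
have L's : size L' = size L by rewrite -(size_map fst) -/(unzip1 L') L'w wE size_map.
have [q q0 qE] := lF L' L'u; rewrite L'w wE L's -/A in qE.
(* Large enough that [D - k] does not truncate and that reversing in degree [D] loses no
   coefficient. *)
pose D := (k + size (hpoly F L'))%N.
have E : q * 'X^(size L + D) = 'X^A * \poly_(j < D.+1) (hpoly F L')`_(D - j).
  apply: (@poly_cofinite_eq _ [:: 0]) => s; rewrite inE => s0.
  rewrite !hornerM !hornerXn exprD mulrA qE // -mulrA; congr (_ * _).
  rewrite (hpolyE _ _ PF) (@horner_coef_wide _ D.+1); last by rewrite /D leqW // leq_addl.
  rewrite horner_poly mulr_suml [RHS](reindex_inj rev_ord_inj) /=; apply: eq_bigr => j _.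
  rewrite subSS subKn; last by rewrite -ltnS.
  rewrite -mulrA; congr (_ * _).
  have jD : (j <= D)%N by rewrite -ltnS.
  by rewrite expfB_cond ?(negPf s0) // exprVn mulrC.
have := congr1 (fun q : {poly R} => q`_(A + (D - k))) E.
rewrite /G coefMXn coefXnM [(_ < A)%N]ltnNge leq_addr /= addKn coef_poly ltnS leq_subr subKn; last exact: leq_addr.
rewrite -/(hc F k L') => <-.
have kD : (k <= D)%N by exact: leq_addr.
rewrite /C; case: eqP => kA.
  rewrite ifF; last by move: kD kA; lia.
  have -> : (A + (D - k) - (size L + D) = 0)%N by move: kD kA; lia.
  by rewrite -horner_coef0 q0 mul1r subrr.
by rewrite ifT ?mul0r ?subr0 //; move: kD kA kL; lia.
Qed.

Definition wheel1 F := forall i j (x : R) L, adj i j ->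
  F [:: (i, x + 1), (i, x), (j, x + 2^-1) & L] = 0.

(** The component of degree [e - off + adjn - size]. Since [e - off] may be negative, [off] is
    carried separately, and the guard gives 0 in negative degree. *)
Definition topc e off F L := if (size L + off <= e + adjn (unzip1 L))%N
  then hc F (e + adjn (unzip1 L) - (size L + off)) L else 0.

Definition hdeg_le e off F := forall k L, (e + adjn (unzip1 L) < k + (size L + off))%N -> hc F k L = 0.

(** For the limiting wheel condition, the given condition at scaled points is multiplied by a power
    of [s] and becomes a polynomial identity in [s]; at [s = 0] only the top component survives. *)
Lemma config_topc m S d e off F : subringP S -> lsym F -> lpolyd S d F -> wheel1 F ->
  (forall L, ~~ all (fun a : elt => (a.1 < m)%N) L -> F L = 0) -> hdeg_le e off F -> config m S (topc e off F).
Proof.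
move=> SS sF Fd wF cF hF.
have PF : lpoly S F by move=> l; exists d.
split.
- move=> L L' P; rewrite /topc (perm_size P) (perm_adjn (perm_map fst P)); case: ifP => // _.
  exact: (lsym_hc _ PF sF P).
- exists d => l; apply: (@polyf_ext _ _ _ (fun v => if (size l + off <= e + adjn (unzip1 l))%N
     then hc F (e + adjn (unzip1 l) - (size l + off)) (inst v l) else 0)).
    by move=> v; rewrite /topc size_map /unzip1 /inst -map_comp.
  by case: (_ <= _)%N; [exact: lpolyd_hc|exact: polyf0].
- move=> i j x L ij; rewrite /topc; set L0 := [:: _, _, _ & L]; case: ifP => // h.
  set k := (_ - _)%N.
  (* The wheel configuration shrunk by the factor [s]; at [s = 0] its three points coincide. *)
  pose Ls s : seq elt := [:: (i, x + s), (i, x), (j, x + s * 2^-1) & L].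
  have hk k' s : (k < k')%N -> hc F k' (Ls s) = 0.
    move=> kk; apply: hF.
    have -> : unzip1 (Ls s) = unzip1 L0 by [].
    have -> : size (Ls s) = size L0 by [].
    by move: kk h; rewrite /k; lia.
  have z s : s != 0 -> \sum_(k' < k.+1) s ^+ (k - k') * hc F k' (Ls s) = 0.
    move=> s0; have : F (dil s^-1 (Ls s)) = 0.
      rewrite /dil /= mulrDr mulVf // mulrDr mulrA mulVf // mul1r; exact: wF.
    rewrite (hpolyE _ _ PF) (@horner_coef_wide _ (k.+1 + size (hpoly F (Ls s)))) ?leq_addl //.
    rewrite big_split_ord /= [X in _ + X]big1 ?addr0 => [E|k' _]; last first.
      by rewrite -/(hc F _ _) hk ?mul0r // ltn_addr.
    apply: (mulfI (expf_neq0 k (invr_neq0 s0))); rewrite mulr0 -[RHS]E mulr_sumr; apply: eq_bigr => k' _.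
    rewrite mulrA -/(hc F _ _) mulrC; congr (_ * _).
    have kk : (k' <= k)%N by rewrite -ltnS.
    by rewrite [s ^+ (k - k')]expfB_cond ?(negPf s0) // !exprVn; field; rewrite !expf_neq0.
  have lin k' : exists q : {poly R}, forall s, hc F k' (Ls s) = q.[s].
    have [d' Pd'] := lpoly_hc SS k' PF (lstd (unzip1 L0) 0).
    have [q _ qE] := polyf_line (nth 0 (x :: x :: x :: unzip2 L)) (nth 0 [:: 1; 0; 2^-1]) Pd'.
    exists q => s; rewrite -qE; congr hc.
    rewrite -[LHS]inst_self; apply: eq_map => -[c [|[|[|a]]]] /=; rewrite ?mulr1 ?mulr0 ?addr0 //.
    by congr (_, _); rewrite nth_nil mulr0 addr0.
  have [q q0 qE] : exists2 q : {poly R}, q.[0] = hc F k (Ls 0) & forall s, q.[s] = \sum_(k' < k.+1) s ^+ (k - k') * hc F k' (Ls s).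
    have {lin} [Q QE] : exists Q : 'I_k.+1 -> {poly R}, forall (k' : 'I_k.+1) s, hc F k' (Ls s) = (Q k').[s].
      exact: (fin_all_exists (fun k' : 'I_k.+1 => lin k')).
    exists (\sum_(k' < k.+1) 'X^(k - k') * Q k') => [|s].
      rewrite horner_sum big_ord_recr /= subnn expr0 mul1r -QE big1 ?add0r // => k' _.
      by rewrite hornerM hornerXn expr0n subn_eq0 /= leqNgt ltn_ord mul0r.
    by rewrite horner_sum; apply: eq_bigr => k' _; rewrite hornerM hornerXn QE.
  have : q = 0 by apply: (@poly_cofinite_eq0 _ [:: 0]) => s; rewrite inE => s0; rewrite qE z.
  move=> q00; move: q0; rewrite q00 horner0 /Ls mul0r !addr0 => <-; by [].
- move=> L Lm; rewrite /topc; case: ifP => // _; rewrite /hc (hpoly_unique (q := 0)) ?coef0 // => t.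
  by rewrite horner0 cF // /dil all_map.
Qed.

(** * Integrality of the deformed product *)

Section Integrality.
Variables (S : R -> Prop) (n : nat).
Hypothesis SS : subringP S.

Definition ratf (f : (nat -> R) -> R) := exists (D : seq (nat * nat)) g,
  [/\ all (fun ab => [&& ab.1 < n, ab.2 < n & ab.1 != ab.2]%N) D, polyfn S g &
      forall v, injn n v -> f v * \prod_(ab <- D) (v ab.1 - v ab.2) = g v].

Lemma ratf_polyfn f : polyfn S f -> ratf f.
Proof. by move=> Pf; exists [::], f; split=> // v _; rewrite big_nil mulr1. Qed.

Lemma ratf_ext f g : f =1 g -> ratf f -> ratf g.
Proof. by move=> fg [D [h [hD Ph E]]]; exists D, h; split=> // v iv; rewrite -fg E. Qed.

Lemma polyfn_diffs D : polyfn S (fun v => \prod_(ab <- D) (v ab.1 - v ab.2)).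
Proof. by apply: polyfn_prod => // ab _ _; apply: polyfn_sub => //; exact: polyfn_var. Qed.

Lemma ratf_mul f g : ratf f -> ratf g -> ratf (fun v => f v * g v).
Proof.
move=> [D [f' [hD Pf fE]]] [D' [g' [hD' Pg gE]]]; exists (D ++ D'), (fun v => f' v * g' v).
split; [by rewrite all_cat hD|exact: polyfn_mul|move=> v iv].
by rewrite big_cat mulrACA fE ?gE.
Qed.

Lemma ratf_add f g : ratf f -> ratf g -> ratf (fun v => f v + g v).
Proof.
move=> [D [f' [hD Pf fE]]] [D' [g' [hD' Pg gE]]].
exists (D ++ D'), (fun v => f' v * \prod_(ab <- D') (v ab.1 - v ab.2) + g' v * \prod_(ab <- D) (v ab.1 - v ab.2)).
split; first by rewrite all_cat hD.
  exact: (polyfn_add (polyfn_mul Pf (polyfn_diffs D')) (polyfn_mul Pg (polyfn_diffs D))).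
by move=> v iv; rewrite big_cat -fE -?gE //=; ring.
Qed.

Lemma ratf_sum (I : eqType) (r : seq I) (f : I -> (nat -> R) -> R) :
  (forall i, i \in r -> ratf (f i)) -> ratf (fun v => \sum_(i <- r) f i v).
Proof.
elim: r => [|i r IH] h.
  by apply: (@ratf_ext (fun=> 0)) => [v|]; [rewrite big_nil|apply: ratf_polyfn; apply: polyfn_cst; exact: subring0].
apply: (@ratf_ext (fun v => f i v + \sum_(i <- r) f i v)) => [v|]; first by rewrite big_cons.
by apply: ratf_add; [apply: h; rewrite inE eqxx|apply: IH => j jr; apply: h; rewrite inE jr orbT].
Qed.

Lemma ratf_prod (I : eqType) (r : seq I) (f : I -> (nat -> R) -> R) :
  (forall i, i \in r -> ratf (f i)) -> ratf (fun v => \prod_(i <- r) f i v).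
Proof.
elim: r => [|i r IH] h.
  by apply: (@ratf_ext (fun=> 1)) => [v|]; [rewrite big_nil|apply: ratf_polyfn; apply: polyfn_cst; exact: subring1].
apply: (@ratf_ext (fun v => f i v * \prod_(i <- r) f i v)) => [v|]; first by rewrite big_cons.
by apply: ratf_mul; [apply: h; rewrite inE eqxx|apply: IH => j jr; apply: h; rewrite inE jr orbT].
Qed.

(** Polynomiality over the whole field supplies the divisibility by each difference in the
    denominator; as differences are monic, the quotients stay over [S]. *)
Lemma polyfn_ratf f : polyfn (@anyR R) f -> ratf f -> polyfn S f.
Proof.
move=> Pf [D [g [hD Pg fE]]].
have {}fE v : f v * \prod_(ab <- D) (v ab.1 - v ab.2) = g v.
  apply/eqP; rewrite -subr_eq0; apply/eqP.
  have [d Pd] : polyfn (@anyR R) (fun v => f v * \prod_(ab <- D) (v ab.1 - v ab.2) - g v).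
    apply: polyfn_sub => //.
      by apply: polyfn_mul => //; have [d Pd] := polyfn_diffs D; exists d; exact: polyf_weaken Pd.
    by have [d Pd] := Pg; exists d; exact: polyf_weaken Pd.
  by apply: (polyf_density (n := n) Pd) => w iw; rewrite fE // subrr.
elim: D g hD Pg fE => [g _ Pg fE|[a b] D IH g /= /andP[/and3P[_ _ ab] hD] [d Pg] fE].
  by apply: polyfn_ext Pg => v; rewrite -fE big_nil mulr1.
have [v vab|g' Pg' g'E] := @polyf_divide _ _ _ _ a b SS Pg.
  by rewrite -fE big_cons /= vab subrr mul0r mulr0.
apply: (IH g' hD); first by exists d.
move=> v; apply/eqP; rewrite -subr_eq0; apply/eqP; move: v.
have [d' Pd'] : polyfn (@anyR R) (fun v => f v * \prod_(ab <- D) (v ab.1 - v ab.2) - g' v).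
  apply: polyfn_sub => //.
    by apply: polyfn_mul => //; have [d' Pd'] := polyfn_diffs D; exists d'; exact: polyf_weaken Pd'.
  by exists d; exact: polyf_weaken Pg'.
apply: (polyf_cancel ab Pd') => v; rewrite mulrBr -g'E -fE big_cons /=; ring.
Qed.
End Integrality.

(** Only equal colours leave a denominator in [om1], namely the difference of the positions.
    Adjacent colours give that difference shifted by a half, whence the hypothesis on [2^-1]. *)
Lemma op_integral S F G H : subringP S -> S 2^-1 -> lpoly S F -> lpoly S G -> lpoly (@anyR R) H ->
  (forall L, uniq (unzip2 L) -> H L = op om1 F G L) -> lpoly S H.
Proof.
move=> SS S2 PF PG PH HE l.
pose n := size l; set w := unzip1 l.
suff Pw : polyfn S (fun v => H (inst v (lstd w 0))).
  by apply: polyfn_ext (polyfn_subst (nth 0%N (unzip2 l)) Pw) => v; rewrite -inst_std.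
set lw := lstd w 0.
have lwu : unzip2 lw = iota 0 n by rewrite unzip2_lstd size_map.
apply: (@polyfn_ratf S n) => //.
have : ratf S n (fun v => \sum_(p <- splits lw) F (inst v p.1) * G (inst v p.2) *
    \prod_(a <- p.1) \prod_(b <- p.2) om1 (a.1, v a.2) (b.1, v b.2)).
  apply: ratf_sum => // p pL.
  have /perm_mem pm := splits_perm pL.
  have lt (a : nat * nat) : a \in p.1 ++ p.2 -> (a.2 < n)%N.
    by rewrite -pm => /(map_f snd); rewrite -/(unzip2 lw) lwu mem_iota.
  have dis (a b : nat * nat) : a \in p.1 -> b \in p.2 -> a.2 != b.2.
    have := iota_uniq 0 n; rewrite -lwu /unzip2 (perm_uniq (perm_map snd (splits_perm pL))) map_cat cat_uniq => /and3P[_ h _] ap bp.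
    by apply: contraNneq h => e; apply/hasP; exists b.2; [exact: map_f|rewrite /= -e; exact: map_f].
  apply: ratf_mul; first by apply: ratf_mul; apply: ratf_polyfn; [exact: PF|exact: PG].
  apply: ratf_prod => // a ap; apply: ratf_prod => // b bp.
  have ab := dis _ _ ap bp.
  have an : (a.2 < n)%N by apply: lt; rewrite mem_cat ap.
  have bn : (b.2 < n)%N by apply: lt; rewrite mem_cat bp orbT.
  have vab v : injn n v -> v a.2 - v b.2 != 0.
    by move=> iv; rewrite subr_eq0; apply: contraNneq ab => /(iv _ _ an bn) ->.
  have Pab : polyfn S (fun v => v a.2 - v b.2) by apply: polyfn_sub => //; exact: polyfn_var.
  have [e|ne] := eqVneq a.1 b.1.
    exists [:: (a.2, b.2)], (fun v => v a.2 - v b.2 + 1); split=> [||v iv].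
    - by rewrite /= an bn ab.
    - by apply: polyfn_add Pab _; apply: polyfn_cst; exact: subring1.
    - rewrite big_seq1 /om1 /om0 /cross /cart /= e !eqxx [b.1.+1 == _]gtn_eqF // !mul1r.
      by field; exact: vab.
  rewrite /om1 /om0 /cross /cart /= (negPf ne) /adj.
  have [e|_] := eqVneq a.1.+1 b.1.
    exists [::], (fun v => v a.2 - v b.2 - 2^-1); split=> // [|v iv].
      by apply: polyfn_sub => //; exact: polyfn_cst.
    rewrite big_nil (_ : b.1.+1 == a.1 = false); last by lia.
    rewrite /=; by field; exact: vab.
  case: eqP => _.
    exists [::], (fun v => - (v a.2 - v b.2) + 2^-1); split=> // [|v iv].
      by apply: polyfn_add; [exact: polyfn_opp|exact: polyfn_cst].
    by rewrite big_nil /=; field; exact: vab.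
  apply: (@ratf_ext _ _ (fun=> 1)) => [v|]; first by rewrite mul0r addr0 !mulr1.
  by apply: ratf_polyfn; apply: polyfn_cst; exact: subring1.
case=> D [g [h1 h2 h3]]; exists D, g; split=> // v iv; rewrite -h3 //; congr (_ * _).
rewrite HE; last first.
  have -> : unzip2 (inst v lw) = [seq v k | k <- iota 0 n].
    by rewrite -lwu /unzip2 /inst -!map_comp.
  rewrite map_inj_in_uniq ?iota_uniq // => a b; rewrite !mem_iota !add0n => al bl; exact: iv.
rewrite op_splits splits_map big_map; apply: eq_bigr => p _; congr (_ * _).
by rewrite /weight big_map; apply: eq_bigr => a _; rewrite big_map.
Qed.
End Deformation.

(** * Splittings of a list, subsets and shuffle permutations *)

Lemma sum_splits_subsets (V : nmodType) (T : finType) (U : seq T) (Phi : seq T -> seq T -> V) : uniq U ->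
  \sum_(p <- splits U) Phi p.1 p.2 =
  \sum_(Y : {set T} | [forall x in Y, x \in U]) Phi [seq u <- U | u \in Y] [seq u <- U | u \notin Y].
Proof.
elim: U Phi => [|x U IH] Phi /=.
  move=> _; rewrite big_seq1 (big_pred1 set0) // => Y.
  apply/forallP/eqP => [h|->] /=; last by move=> y; rewrite inE.
  by apply/setP => y; rewrite inE; have := h y; case: (y \in Y).
case/andP=> xU uU; rewrite big_cat !big_map /= [RHS](bigID (fun Y : {set T} => x \in Y)) /=.
have nE (Y : {set T}) : x \in Y -> forall u, u \in U -> (u \in Y) = (u \in Y :\ x).
  by move=> xY u uU'; rewrite !inE; case: eqP => // e; rewrite -e uU' in xU.
congr (_ + _).
  rewrite (IH (fun A B => Phi (x :: A) B) uU) [RHS](reindex_onto (fun Y => x |: Y) (fun Y => Y :\ x)) /=; last first.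
    by move=> Y /andP[_ xY]; rewrite setD1K.
  apply: eq_big => [Y|Y /forallP h].
    rewrite setU11 andbT; apply/forallP/andP => [h|[/forallP h1 /eqP h2] y].
      have xY : x \notin Y by apply/negP => xY; have := h x; rewrite xY (negPf xU).
      split; last by apply/eqP; rewrite setU1K.
      by apply/forallP => y; rewrite !inE; case: eqP => //= _; exact: h.
    apply/implyP => yY; have := h1 y; rewrite !inE yY orbT /=.
    by case: eqP => // e; move: yY; rewrite -h2 e !inE eqxx.
  rewrite setU11 /=; congr (Phi (_ :: _) _); apply: eq_in_filter => u uU'; rewrite !inE;
    by case: eqP => // e; rewrite -e uU' in xU.
rewrite (IH (fun A B => Phi A (x :: B)) uU); apply: eq_big => [Y|Y /forallP h].
  apply/forallP/andP => [h|[/forallP h1 xY] y].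
    split; last by apply/negP => xY; have := h x; rewrite xY (negPf xU).
    by apply/forallP => y; apply/implyP => yY; rewrite inE; have := h y; rewrite yY => /= ->; rewrite orbT.
  apply/implyP => yY; have := h1 y; rewrite yY inE /=; case: eqP => // e; by rewrite -e yY in xY.
have xY : x \notin Y by apply/negP => xY; have := h x; rewrite xY (negPf xU).
by rewrite xY /= (negPf xY).
Qed.

Lemma perm_map_lift (T : eqType) (T' : eqType) (f : T -> T') (s : seq T) (t : seq T') :
  perm_eq t (map f s) -> exists2 s', perm_eq s' s & map f s' = t.
Proof.
elim: t s => [|y t IH] s P.
  by exists [::]; move: P; case: s => //= a s /perm_size.
have : y \in map f s by rewrite -(perm_mem P) inE eqxx.
case/mapP=> x xs yE; have := P; rewrite (permPr (perm_map f (perm_to_rem xs))) /= -yE perm_cons => /IH[s' ps' <-].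
exists (x :: s'); last by rewrite /= yE.
by rewrite perm_sym (permPl (perm_to_rem xs)) perm_cons perm_sym.
Qed.

Section Shuffles.
Variables (M K : nat).
Hypothesis KM : (K <= M)%N.

Definition shuffle_perm (k : nat) (s : {perm 'I_M}) : bool :=
  [forall x : 'I_M, (K <= x)%N ==> (s x == x)] &&
  [forall x : 'I_M, forall y : 'I_M, [&& (x < y)%N, (y < K)%N & ((y < k)%N || (k <= x)%N)] ==> (s x < s y)%N].

Lemma pairwise_enum_ord (P : pred 'I_M) : pairwise (fun x y : 'I_M => (x < y)%N) (filter P (enum 'I_M)).
Proof.
apply: pairwise_filter; have : pairwise ltn (map val (enum 'I_M)).
  rewrite val_enum_ord -sorted_pairwise ?iota_ltn_sorted //; exact: ltn_trans.
by rewrite pairwise_map.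
Qed.

Lemma pairwise_ltn_eq (s t : seq 'I_M) : pairwise (fun x y : 'I_M => (x < y)%N) s ->
  pairwise (fun x y : 'I_M => (x < y)%N) t -> s =i t -> s = t.
Proof.
rewrite -!sorted_pairwise; try by move=> x y z; exact: ltn_trans.
apply: irr_sorted_eq; first by move=> x y z; exact: ltn_trans.
by move=> x; rewrite /= ltnn.
Qed.

(** List [X] in increasing order and then its complement. As [X] lies below [K], the complement ends
    with the numbers from [K] on, each in its own place. *)
Lemma shuffle_perm_exists (X : {set 'I_M}) : (forall x, x \in X -> (x < K)%N) ->
  exists2 s, shuffle_perm #|X| s & forall x : 'I_M, (x < #|X|)%N = (s x \in X).
Proof.
move=> XK; set k := #|X|; pose e := enum X ++ enum (~: X).
have eu : uniq e.
  rewrite cat_uniq !enum_uniq /= andbT; apply/hasPn => x; rewrite !mem_enum inE; by case: (x \in X).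
have es : size e = M.
  by rewrite size_cat -!cardE -/k cardsCs setCK card_ord subnKC // -[X in (_ <= X)%N](card_ord M) max_card.
have inj : injective (fun x : 'I_M => nth x e x).
  move=> x y; rewrite (set_nth_default y) ?es // => /eqP; rewrite nth_uniq ?es // => /eqP; exact: val_inj.
exists (perm inj); last first.
  move=> x; rewrite permE nth_cat -cardE -/k; case: ltnP => xk.
    by rewrite -[LHS]/true -mem_enum mem_nth // -cardE.
  have : nth x (enum (~: X)) (x - k) \in ~: X.
    rewrite -mem_enum mem_nth // -(ltn_add2l k) subnKC //.
    by have -> : (k + size (enum (~: X)) = M)%N by move: es; rewrite size_cat -cardE.
  by rewrite inE => /negPf ->.
have eK (x : 'I_M) : (K <= x)%N -> nth x e x = x.
  move=> Kx; have eE : e = (enum X ++ filter (mem (~: X)) (take K (enum 'I_M))) ++ drop K (enum 'I_M).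
    rewrite /e -catA; congr (_ ++ _).
    have -> : enum (~: X) = filter (mem (~: X)) (enum 'I_M) by rewrite {1}/enum_mem enumT.
    rewrite -[in LHS](cat_take_drop K (enum 'I_M)) filter_cat; congr (_ ++ _).
    apply/all_filterP/allP => y yd; rewrite !inE; apply/negP => /XK; apply/negP; rewrite -leqNgt.
    have : val y \in map val (drop K (enum 'I_M)) by exact: map_f.
    by rewrite map_drop val_enum_ord drop_iota mem_iota add0n => /andP[].
  have sz : size (enum X ++ filter (mem (~: X)) (take K (enum 'I_M))) = K.
    have := es; rewrite eE size_cat size_drop size_enum_ord; lia.
  rewrite eE nth_cat sz ltnNge Kx /= nth_drop subnKC // nth_ord_enum //.
apply/andP; split.
  by apply/forallP => x; apply/implyP => Kx; rewrite permE eK.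
apply/forallP => x; apply/forallP => y; apply/implyP => /and3P[xy yK h]; rewrite !permE.
have pe (P : {set 'I_M}) : pairwise (fun x y : 'I_M => (x < y)%N) (enum P).
  by rewrite /enum_mem -enumT; exact: pairwise_enum_ord.
have szC : (k + size (enum (~: X)) = M)%N by move: es; rewrite size_cat -cardE.
case/orP: h => h.
  have xk := ltn_trans xy h.
  rewrite (set_nth_default x y) ?es // !nth_cat -cardE -/k h xk.
  by have /(pairwiseP x) pX := pe X; apply: pX => //; rewrite inE -cardE.
have ky : (k <= y)%N := leq_trans h (ltnW xy).
rewrite (set_nth_default x y) ?es // !nth_cat -cardE -/k [(x < k)%N]ltnNge [(y < k)%N]ltnNge h ky /=.
have /(pairwiseP x) pX := pe (~: X); apply: pX; rewrite ?inE; last by move: xy h; clear; lia.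
  by rewrite ltn_subLR // szC.
by rewrite ltn_subLR // szC.
Qed.

(** An increasing list is determined by its set of entries; this applies to the images of the blocks
    below and above [k]. *)
Lemma shuffle_perm_inj k s s' : (k <= K)%N -> shuffle_perm k s -> shuffle_perm k s' ->
  [set s x | x : 'I_M & (x < k)%N] = [set s' x | x : 'I_M & (x < k)%N] -> s = s'.
Proof.
move=> kK hs hs' E.
have incr t (P : pred 'I_M) : shuffle_perm k t -> (forall x, P x -> (x < K)%N) ->
    (forall x y : 'I_M, P x -> P y -> (y < k)%N || (k <= x)%N) ->
    pairwise (fun x y : 'I_M => (x < y)%N) [seq t x | x <- filter P (enum 'I_M)].
  case/andP=> _ /forallP ht PK Pk; rewrite pairwise_map; have := pairwise_enum_ord P.
  apply: (sub_in_pairwise (P := P)); last by rewrite filter_all.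
  move=> x y Px Py xy; have /forallP/(_ y)/implyP := ht x; apply.
  by rewrite xy PK // Pk.
have memlow t (y : 'I_M) : (y \in [seq t x | x <- filter (fun x : 'I_M => x < k)%N (enum 'I_M)]) =
    (y \in [set t x | x : 'I_M & (x < k)%N]).
  apply/mapP/imsetP => -[x xk ->]; exists x => //.
    by move: xk; rewrite mem_filter inE => /andP[].
  by move: xk; rewrite mem_filter inE mem_enum => ->.
have fixK t (x : 'I_M) : shuffle_perm k t -> (K <= x)%N -> t x = x.
  by case/andP=> /forallP/(_ x)/implyP h _ /h /eqP.
have memhigh (t : {perm 'I_M}) (y : 'I_M) : shuffle_perm k t ->
   (y \in [seq t x | x <- filter (fun x : 'I_M => (k <= x < K)%N) (enum 'I_M)]) =
    (y \notin [set t x | x : 'I_M & (x < k)%N]) && (y < K)%N.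
  move=> ht; rewrite -[y](permKV t); set x := (t^-1 y)%g.
  rewrite (mem_map (@perm_inj _ t)) (mem_imset _ _ (@perm_inj _ t)) mem_filter mem_enum andbT inE -leqNgt; congr (_ && _).
  case: (ltnP x K) => xK; last by rewrite (fixK t x) // ltnNge xK.
  apply/esym; rewrite ltnNge; apply/negP => h; have := fixK t (t x) ht h.
  by move/perm_inj => e; move: xK; rewrite -e ltnNge h.
have low : [seq s x | x <- filter (fun x : 'I_M => x < k)%N (enum 'I_M)] = [seq s' x | x <- filter (fun x : 'I_M => x < k)%N (enum 'I_M)].
  apply: pairwise_ltn_eq => [||y]; last by rewrite !memlow E.
    by apply: incr => // [x xk|x y _ ->//]; exact: leq_trans xk kK.
  by apply: incr => // [x xk|x y _ ->//]; exact: leq_trans xk kK.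
have high : [seq s x | x <- filter (fun x : 'I_M => (k <= x < K)%N) (enum 'I_M)] = [seq s' x | x <- filter (fun x : 'I_M => (k <= x < K)%N) (enum 'I_M)].
  apply: pairwise_ltn_eq => [||y]; last by rewrite !memhigh // E.
    by apply: incr => // [x /andP[]//|x y /andP[-> _]]; rewrite orbT.
  by apply: incr => // [x /andP[]//|x y /andP[-> _]]; rewrite orbT.
apply/permP => x; case: (ltnP x k) => xk.
  by move/eq_in_map: low; apply; rewrite mem_filter xk mem_enum.
case: (ltnP x K) => xK; last by rewrite !fixK.
by move/eq_in_map: high; apply; rewrite mem_filter xk xK mem_enum.
Qed.

Lemma shuffle_perm_lt k s (x : 'I_M) : shuffle_perm k s -> (s x < K)%N = (x < K)%N.
Proof.
case/andP=> /forallP fixK _; have fix' (y : 'I_M) : (K <= y)%N -> s y = y.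
  by move=> h; apply/eqP; apply: (implyP (fixK y)).
apply/idP/idP; apply: contraLR; rewrite -!leqNgt => h; first by rewrite fix'.
by have /perm_inj <- := fix' _ h.
Qed.
End Shuffles.

(** * From shuffle elements to functions on lists *)

Section Numerators.
Variable m : nat.
Notation elt := (nat * C)%type.
Implicit Types (L : seq elt) (v w : point m) (K : degree m).

Definition okL L := all (fun a : elt => (a.1 < m)%N) L.
Definition colv (i : nat) L : seq C := [seq a.2 | a <- L & a.1 == i].
Definition degL L : degree m := [ffun i : 'I_m => size (colv i L)].
Definition ptL L : point m := fun i r => nth 0 (colv i L) r.

Definition num (F : Wfam m) L : C := if okL L then evalK m (degL L) (F (degL L)) (ptL L) else 0.

(** The list may mix colours and order the points of one colour freely; symmetry of the numerators
    makes the choice immaterial. *)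
Definition rep K v L := okL L /\ forall i : 'I_m, perm_eq (mkseq (v i) (K i)) (colv i L).

Lemma evalK_eq K (f : {mpoly C[Nk m K]}) v w : (forall i r, (r < K i)%N -> v i r = w i r) ->
  evalK m K f v = evalK m K f w.
Proof.
move=> h; apply: meval_eq => t; apply: eq_bigr => i _; apply: eq_bigr => r _.
by case: ifP => // _; apply: h.
Qed.

Lemma evalK_perm K (f : {mpoly C[Nk m K]}) v w : Defs.is_sym m K f ->
  (forall i : 'I_m, perm_eq (mkseq (v i) (K i)) (mkseq (w i) (K i))) -> evalK m K f v = evalK m K f w.
Proof.
move=> fs h.
have /fin_all_exists [Is IsP] (i : 'I_m) : exists I : seq nat, perm_eq I (iota 0 (K i)) /\
    mkseq (v i) (K i) = [seq w i k | k <- I].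
  have /(perm_iotaP 0)[I PI vI] := h i; rewrite size_mkseq in PI; exists I; split=> //.
  rewrite vI; apply/eq_in_map => k; rewrite (perm_mem PI) mem_iota add0n => /andP[_ kK].
  by rewrite nth_mkseq.
have sz i : size (Is i) = K i by have [/perm_size -> _] := IsP i; rewrite size_iota.
rewrite -(fs w (fun i r => nth 0%N (Is i) r)).
- apply: evalK_eq => i r ri; have [_ E] := IsP i.
  have := congr1 (nth 0 ^~ r) E; rewrite nth_mkseq // => ->.
  by rewrite (nth_map 0%N) // sz.
- move=> i r ri; have [PI _] := IsP i.
  have : nth 0%N (Is i) r \in Is i by rewrite mem_nth // sz.
  by rewrite (perm_mem PI) mem_iota.
- move=> i r r' ri r'i /eqP; have [PI _] := IsP i.
  by rewrite nth_uniq ?sz // ?(perm_uniq PI) ?iota_uniq // => /eqP.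
Qed.

Lemma rep_self L : okL L -> rep (degL L) (ptL L) L.
Proof.
move=> oL; split=> // i; rewrite ffunE.
by rewrite (_ : mkseq _ _ = colv i L) //; exact: mkseq_nth.
Qed.

Lemma rep_deg K v L : rep K v L -> K = degL L.
Proof. by case=> _ h; apply/ffunP => i; rewrite ffunE -(perm_size (h i)) size_mkseq. Qed.

Lemma rep_perm K v L L' : perm_eq L L' -> rep K v L -> rep K v L'.
Proof.
move=> P [oL h]; split=> [|i]; first by rewrite /okL -(perm_all _ P).
by rewrite (permPl (h i)); apply/perm_map/perm_filter.
Qed.

Lemma num_rep (F : Wfam m) K v L : Defs.is_sym m K (F K) -> rep K v L -> num F L = evalK m K (F K) v.
Proof.
move=> Fs rL; have E := rep_deg rL; subst K; case: (rL) => oL h; rewrite /num oL.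
apply: evalK_perm => // i; rewrite perm_sym (permPl (h i)).
by have [_ h'] := rep_self oL; rewrite perm_sym h'.
Qed.

Lemma prod_rep (g : elt -> C) K v L : rep K v L ->
  \prod_(a <- L) g a = \prod_(i < m) \prod_(r < K i) g (nat_of_ord i, v i r).
Proof.
case=> oL h.
have E (a : elt) : a \in L -> g a = \prod_(i < m | a.1 == i) g a.
  move/(allP oL) => /= am; rewrite (big_pred1 (Ordinal am)) //.
rewrite big_seq (eq_bigr _ E) -big_seq (exchange_big_dep xpredT) //=; apply: eq_bigr => i _.
rewrite -(big_mkord xpredT (fun r => g (nat_of_ord i, v i r))) /index_iota subn0.
rewrite -(big_map (v i) xpredT (fun x => g (nat_of_ord i, x))) -/(mkseq _ _) (perm_big _ (h i)) /colv big_map big_filter.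
by apply: eq_bigr => -[c x] /= /eqP ->.
Qed.

Definition DL L : C := \prod_(a <- L) \prod_(b <- L) cross a b.

Lemma Dk_rep K v L : rep K v L -> Dk m K v = DL L.
Proof.
move=> rL; rewrite /DL (prod_rep _ rL).
rewrite /Dk; apply: eq_bigr => i _; rewrite exchange_big; apply: eq_bigr => r _ /=.
rewrite (prod_rep _ rL) big_mkcond; apply: eq_bigr => j _.
rewrite /cross /= eq_sym; case: eqP => _ //.
by rewrite big1.
Qed.

Lemma ratK_rep (F : Wfam m) K v L : Defs.is_sym m K (F K) -> rep K v L -> ratK m K (F K) v = num F L / DL L.
Proof. by move=> Fs rL; rewrite /ratK (num_rep Fs rL) (Dk_rep rL). Qed.

Lemma perm_DL L L' : perm_eq L L' -> DL L = DL L'.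
Proof. by move=> P; rewrite /DL (perm_big _ P); apply: eq_bigr => a _; apply: perm_big. Qed.

Lemma DL_cat A B : DL (A ++ B) = DL A * DL B * weight (@om0 C) A B.
Proof.
rewrite /DL big_cat /= (eq_bigr (fun a => (\prod_(b <- A) cross a b) * \prod_(b <- B) cross a b)) => [|a _].
  rewrite big_split /= [X in _ * X](eq_bigr (fun a => (\prod_(b <- A) cross a b) * \prod_(b <- B) cross a b)) => [|a _].
    rewrite big_split /= /weight; rewrite [X in _ = _ * X](eq_bigr (fun a => (\prod_(b <- B) cross a b) * \prod_(b <- B) cross b a)) => [|a _].
      by rewrite big_split /= [X in _ = _ * (_ * X)]exchange_big /=; ring.
    by rewrite -big_split.
  by rewrite big_cat.
by rewrite big_cat.
Qed.

Lemma DL_neq0 L : uniq (unzip2 L) -> DL L != 0.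
Proof.
move=> uL; rewrite prodf_seq_neq0; apply/allP => a aL /=; rewrite prodf_seq_neq0; apply/allP => b bL /=.
rewrite /cross; case: (a.1.+1 =P b.1) => [ab|_]; last exact: oner_neq0.
rewrite subr_eq0; apply/eqP => e.
have : a = b.
  have := uL; move: aL bL; elim: (L) => //= c l IH; rewrite !inE => /orP[/eqP ac|al] /orP[/eqP bc|bl] //= /andP[cl ul].
  - by rewrite ac bc.
  - by case/negP: cl; rewrite -ac e; exact: map_f.
  - by case/negP: cl; rewrite -bc -e; exact: map_f.
  - exact: IH.
by move=> eab; move: ab; rewrite eab; lia.
Qed.

Lemma injpt_self L : okL L -> uniq (unzip2 L) -> injpt m (degL L) (ptL L).
Proof.
move=> oL uL i i' r r'; rewrite !ffunE => ri ri' E.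
have mem (k : 'I_m) s : (s < size (colv k L))%N -> (nat_of_ord k, ptL L k s) \in L.
  move=> sk; have : ptL L k s \in colv k L by exact: mem_nth.
  case/mapP=> -[c x]; rewrite mem_filter /= => /andP[/eqP -> h] ->; exact: h.
have ii : i = i'.
  have := mem _ _ ri; have := mem _ _ ri'; rewrite -E; move: (ptL L i r) => x h1 h2.
  apply: val_inj => /=; move: uL h1 h2; elim: (L) => //= -[c y] l IH /= /andP[cl ul].
  rewrite !inE => /orP[/eqP[e1 e2]|al] /orP[/eqP[e3 e4]|bl] //=; first by rewrite e1 e3.
  - by case/negP: cl; rewrite -e2; exact: (map_f snd bl).
  - by case/negP: cl; rewrite -e4; exact: (map_f snd al).
  - exact: IH.
split=> //; subst i'; move/eqP: E; rewrite /ptL nth_uniq // => [/eqP //|].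
by move: uL; rewrite /colv; apply: subseq_uniq; apply/map_subseq/filter_subseq.
Qed.

Lemma count_colv c x L : count_mem (c, x) L = count_mem x (colv c L).
Proof.
rewrite /colv count_map count_filter; apply: eq_count => -[c' y] /=.
by rewrite xpair_eqE andbC.
Qed.

Lemma perm_colv L L' : okL L -> okL L' -> (forall i : 'I_m, perm_eq (colv i L) (colv i L')) -> perm_eq L L'.
Proof.
move=> oL oL' h; apply/allP => -[c x] _; apply/eqP; rewrite /= !count_colv.
have [cm|cm] := ltnP c m; first by have /seq.permP := h (Ordinal cm); apply.
have E (l : seq elt) : okL l -> colv c l = [::].
  move=> ol; rewrite /colv (eq_in_filter (a2 := pred0)) ?filter_pred0 // => a /(allP ol) /= am.
  by apply/eqP => e; move: am; rewrite e ltnNge cm.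
by rewrite !E.
Qed.

Section ShuffleProduct.
Variables (F G : Wfam m) (L : seq elt).
Hypotheses (Fs : forall K, Defs.is_sym m K (F K)) (Gs : forall K, Defs.is_sym m K (G K)).
Hypotheses (oL : okL L) (uL : uniq (unzip2 L)).

Let K := degL L.
Let v := ptL L.
Let M := Mk m K.
Let Idx := ('I_m * 'I_M)%type.
Let value (u : Idx) : elt := (nat_of_ord u.1, v u.1 u.2).

Lemma degree_lt_Mk i : (K i < M)%N.
Proof. by rewrite /M /Mk /Nk ltnS (bigD1 i) //= leq_addr. Qed.

Lemma okL_value (U : seq Idx) : okL (map value U).
Proof. by rewrite /okL all_map; apply/allP => u _ /=. Qed.

Lemma colv_value (U : seq Idx) (i : 'I_m) (r : seq 'I_M) : uniq U -> uniq r ->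
  (forall x, (x \in r) = ((i, x) \in U)) -> perm_eq [seq v i x | x : 'I_M <- r] (colv i (map value U)).
Proof.
move=> uU ur h; rewrite /colv filter_map -map_comp.
have -> : [seq (snd \o value) u | u <- U & preim value (fun a : elt => a.1 == i :> nat) u] =
    [seq v i x | x : 'I_M <- [seq u.2 | u <- U & u.1 == i]].
  rewrite -map_comp; have -> : filter (preim value (fun a : elt => a.1 == i :> nat)) U = filter (fun u => u.1 == i) U by [].
  by apply/eq_in_map => u; rewrite mem_filter => /andP[/eqP /= -> _].
apply: perm_map; apply: uniq_perm => // [|x].
  rewrite map_inj_in_uniq ?filter_uniq // => -[a b] [a' b']; rewrite !mem_filter /= => /andP[/eqP -> _] /andP[/eqP -> _] -> //.
rewrite h; apply/idP/mapP => [xU|[[a b]]]; first by exists (i, x); rewrite // mem_filter eqxx.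
by rewrite mem_filter /= => /andP[/eqP -> abU] ->.
Qed.

(** Splittings will be compared with subsets of a finite type, so the points of [L] are presented
    through a duplicate-free list of indices. *)
Lemma index_list : exists U : seq Idx, [/\ uniq U, map value U = L & forall u : Idx, (u \in U) = (u.2 < K u.1)%N].
Proof.
pose U0 := [seq u : Idx <- enum {: Idx} | (u.2 < K u.1)%N].
have mU0 (u : Idx) : (u \in U0) = (u.2 < K u.1)%N by rewrite mem_filter mem_enum andbT.
have uU0 : uniq U0 by rewrite filter_uniq ?enum_uniq.
have P : perm_eq L (map value U0).
  apply: perm_colv => //; first exact: okL_value.
  move=> i; have [_ /(_ i) rp] := rep_self oL; rewrite perm_sym -/K -/v in rp.
  apply: (perm_trans rp).
  pose r := [seq x : 'I_M <- enum 'I_M | (x < K i)%N].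
  have -> : mkseq (v i) (K i) = [seq v i x | x : 'I_M <- r].
    have -> : [seq v i x | x : 'I_M <- r] = map (v i) (map val r) by rewrite -map_comp.
    rewrite /mkseq; congr map.
    have -> : map val r = [seq x <- map val (enum 'I_M) | (x < K i)%N] by rewrite filter_map.
    rewrite val_enum_ord; have KM := ltnW (degree_lt_Mk i).
    rewrite -[in RHS](subnKC KM) iotaD filter_cat add0n [X in _ ++ X](_ : _ = [::]) ?cats0.
      by apply/esym/all_filterP/allP => x; rewrite mem_iota.
    rewrite -(filter_pred0 (iota (K i) (M - K i))); apply: eq_in_filter => x; rewrite mem_iota => /andP[h _].
    by rewrite ltnNge h.
  apply: colv_value => // [|x]; first by rewrite filter_uniq ?enum_uniq.
  by rewrite mem_filter mem_enum andbT mU0.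
have [U PU UE] := perm_map_lift P; exists U; split=> // [|u]; first by rewrite (perm_uniq PU).
by rewrite (perm_mem PU) mU0.
Qed.

Definition ratio A B : C := num F A / DL A * (num G B / DL B) *
  \prod_(a <- A) \prod_(b <- B) (1 + @cart C a.1 b.1 / (2 * (a.2 - b.2))).

(** The denominator of a concatenation is the product of both denominators and [weight om0], so
    dividing by [DL L] turns the weights [om1] into the factors of [zeta]. *)
Lemma op_ratio : op (@om1 C) (num F) (num G) L / DL L = \sum_(p <- splits L) ratio p.1 p.2.
Proof.
rewrite op_splits mulr_suml big_seq [RHS]big_seq; apply: eq_bigr => p pL.
have [u1 u2 u12] := splits_uniq2 uL pL.
have W : weight (@om0 C) p.1 p.2 != 0.
  have := DL_neq0 uL; rewrite (perm_DL (splits_perm pL)) DL_cat; by apply: contraNneq => ->; rewrite mulr0.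
rewrite (perm_DL (splits_perm pL)) DL_cat /ratio.
have -> : weight (@om1 C) p.1 p.2 = weight (@om0 C) p.1 p.2 *
    \prod_(a <- p.1) \prod_(b <- p.2) (1 + @cart C a.1 b.1 / (2 * (a.2 - b.2))).
  by rewrite /weight -big_split; apply: eq_bigr => a _ /=; rewrite -big_split.
by field; rewrite W !DL_neq0.
Qed.

Lemma zetaE (i j : 'I_m) z : zeta m i j z = 1 + @cart C i j / (2 * z).
Proof.
rewrite /zeta /cC /cartan /cart /adj -val_eqE; case: ifP => _ //; case: ifP => _ //.
Qed.

Section Term.
Variables (U : seq Idx) (kk : {ffun 'I_m -> 'I_M}) (s : {ffun 'I_m -> {perm 'I_M}}).
Let k : degree m := [ffun i => (kk i : nat)].
Let Y : {set Idx} := [set u : Idx | ((s u.1)^-1%g u.2 < kk u.1)%N].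
Hypotheses (uU : uniq U) (UE : map value U = L) (mU : forall u : Idx, (u \in U) = (u.2 < K u.1)%N).
Hypotheses (kkK : forall i, (kk i <= K i)%N) (ss : is_shuffle m K k s).

Lemma shuffle_permP i : shuffle_perm (K i) (kk i) (s i).
Proof. by move/forallP: ss => /(_ i); rewrite /shuffle_perm !ffunE. Qed.

Lemma shuffle_term_ratio : shuffle_term m K k (F k) (G (degsub m K k)) s v =
  ratio (map value [seq u <- U | u \in Y]) (map value [seq u <- U | u \notin Y]).
Proof.
set A := map value _; set B := map value _.
pose u1 : point m := fun i r => v i (Defs.act m K s i r).
pose u2 : point m := fun i r => v i (Defs.act m K s i (k i + r)).
have inM i r : (r < K i)%N -> (r < M)%N by move=> h; exact: ltn_trans h (degree_lt_Mk i).
have inordK' i r : (r < K i)%N -> (inord r : 'I_M) = r :> nat by move=> /inM h; rewrite inordK.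
have inord_inj' i : {in [pred r | r < K i]%N &, injective (fun r => s i (inord r))}.
  by move=> a b; rewrite !inE => ha hb /perm_inj /(congr1 val) /=; rewrite !(inordK' i).
have kE i : k i = kk i by rewrite ffunE.
have r1 : rep k u1 A.
  split=> [|i]; first exact: okL_value.
  have -> : mkseq (u1 i) (k i) = [seq v i x | x : 'I_M <- [seq s i (inord r) | r <- iota 0 (kk i)]].
    by rewrite /mkseq -map_comp kE.
  apply: colv_value => [||x]; first by rewrite filter_uniq.
    rewrite map_inj_in_uniq ?iota_uniq // => a b; rewrite !mem_iota !add0n => ha hb.
    by apply: (inord_inj' i); rewrite inE; [exact: leq_trans ha (kkK i)|exact: leq_trans hb (kkK i)].
  rewrite mem_filter mU inE /=; apply/mapP/andP => [[r]|[h xK]].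
    rewrite mem_iota add0n => /= rk ->; have rK := leq_trans rk (kkK i).
    by rewrite permK (shuffle_perm_lt _ (shuffle_permP i)) (inordK' i).
  exists (((s i)^-1)%g x : nat); first by rewrite mem_iota.
  by rewrite inord_val permKV.
have r2 : rep (degsub m K k) u2 B.
  split=> [|i]; first exact: okL_value.
  have -> : mkseq (u2 i) (degsub m K k i) = [seq v i x | x : 'I_M <- [seq s i (inord r) | r <- iota (kk i) (K i - kk i)]].
    rewrite /mkseq ffunE kE -[in RHS](addn0 (kk i)) iotaDl -!map_comp addn0. apply: eq_map => r.
    by rewrite /u2 /Defs.act kE.
  have lt r : r \in iota (kk i) (K i - kk i) -> (kk i <= r < K i)%N by rewrite mem_iota subnKC.
  apply: colv_value => [||x]; first by rewrite filter_uniq.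
    rewrite map_inj_in_uniq ?iota_uniq // => a b /lt /andP[_ ha] /lt /andP[_ hb].
    exact: (inord_inj' i).
  rewrite mem_filter mU inE /=; apply/mapP/andP => [[r] /lt /andP[kr rK] ->|[h xK]].
    by rewrite permK (shuffle_perm_lt _ (shuffle_permP i)) (inordK' i) // -leqNgt.
  exists (((s i)^-1)%g x : nat); last by rewrite inord_val permKV.
  rewrite mem_iota subnKC // leqNgt h /= -(shuffle_perm_lt _ (shuffle_permP i)) permKV //.
rewrite /shuffle_term -/u1 -/u2 (ratK_rep (@Fs k) r1) (ratK_rep (@Gs _) r2) /ratio; congr (_ * _).
rewrite (prod_rep _ r1); apply: eq_bigr => i _; rewrite [LHS]exchange_big; apply: eq_bigr => r _ /=.
rewrite (prod_rep _ r2); apply: eq_bigr => j _ /=; rewrite [degsub m K k j]ffunE; apply: eq_bigr => r' _.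
by rewrite zetaE.
Qed.
End Term.

Lemma card_ord_lt n k : (k <= n)%N -> #|[set x : 'I_n | (x < k)%N]| = k.
Proof. by move=> kn; rewrite -sum1dep_card -(big_ord_widen n (fun=> 1%N)) // sum1_card card_ord. Qed.

(** Both sides are sums over subsets of the index set: a splitting selects its left part, and a
    degree with a shuffle selects the indices that go to the first factor. *)
Lemma num_op (H : Wfam m) : Defs.is_sym m K (H K) -> ratK m K (H K) v = shuffle_prod_at m F G K v ->
  num H L = op (@om1 C) (num F) (num G) L.
Proof.
move=> Hs HE; have DL0 : DL L != 0 by exact: DL_neq0.
have DV : (DL L)^-1 != 0 by rewrite invr_eq0.
apply: (mulIf DV).
rewrite op_ratio -(ratK_rep Hs (rep_self oL)) HE.
have [U [uU UE mU]] := index_list.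
rewrite -[in RHS]UE splits_map big_map.
rewrite (sum_splits_subsets (fun A B => ratio (map value A) (map value B)) uU).
rewrite /shuffle_prod_at pair_big_dep /=.
set cond := (X in \sum_(p | X p) _).
(* The indices whose preimage under the shuffle lies in the first block. *)
pose Yof (p : {ffun 'I_m -> 'I_M} * {ffun 'I_m -> {perm 'I_M}}) : {set Idx} :=
  [set u : Idx | ((p.2 u.1)^-1%g u.2 < p.1 u.1)%N].
pose Phi (Y : {set Idx}) := ratio (map value [seq u <- U | u \in Y]) (map value [seq u <- U | u \notin Y]).
transitivity (\sum_(p | cond p) Phi (Yof p)).
  by apply: eq_bigr => -[kk s] /andP[/forallP kkK ss] /=; rewrite (shuffle_term_ratio uU mU kkK ss).
have condP p : cond p -> (forall i, (p.1 i <= K i)%N) /\ forall i, shuffle_perm (K i) (p.1 i) (p.2 i).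
  case/andP=> /forallP kkK ss; split=> // i; exact: (shuffle_permP ss).
have inj : {in [set p | cond p] &, injective Yof}.
  move=> [kk s] [kk' s']; rewrite !inE => /condP /= [h1 h2] /condP /= [h1' h2'] E.
  have X i : [set s i x | x : 'I_M & (x < kk i)%N] = [set s' i x | x : 'I_M & (x < kk' i)%N].
    have sec (t : {ffun 'I_m -> {perm 'I_M}}) (c : {ffun 'I_m -> 'I_M}) :
        [set t i x | x : 'I_M & (x < c i)%N] = [set y | (i, y) \in Yof (c, t)].
      apply/setP => y; rewrite !inE /=; apply/imsetP/idP => [[x]|h].
        by rewrite inE => xc ->; rewrite permK.
      by exists ((t i)^-1%g y); rewrite ?inE ?permKV.
    by rewrite !sec E.
  have ke i : kk i = kk' i.
    apply: val_inj => /=; rewrite -(card_ord_lt (ltnW (ltn_ord (kk i)))) -(card_ord_lt (ltnW (ltn_ord (kk' i)))).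
    by rewrite -(card_imset _ (@perm_inj _ (s i))) X card_imset //; exact: perm_inj.
  have -> : kk = kk' by apply/ffunP.
  congr (_, _); apply/ffunP => i.
  apply: (shuffle_perm_inj (k := kk i) (K := K i)) => //.
  - by rewrite ke.
  - by rewrite X ke.
rewrite -[RHS]/(\sum_(Y | _) Phi Y).
rewrite (eq_bigl (fun p => p \in [set p | cond p])) => [|p]; last by rewrite inE.
rewrite -(big_imset Phi inj) /=; apply: eq_bigl => Y; apply/imsetP/forallP => [[p]|YU].
  rewrite inE => /condP [h1 h2] -> [i y]; apply/implyP; rewrite inE /= => h; rewrite mU /=.
  rewrite -[y](permKV (p.2 i)) (shuffle_perm_lt _ (h2 i)); exact: leq_trans h (h1 i).
pose X i := [set y | (i, y) \in Y].
have XK i y : y \in X i -> (y < K i)%N.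
  by rewrite inE => h; have := YU (i, y); rewrite h mU.
have XKc i : (#|X i| <= K i)%N.
  rewrite -[leqRHS](card_ord_lt (ltnW (degree_lt_Mk i))); apply/subset_leq_card/subsetP => y /XK.
  by rewrite inE.
(* Surjectivity: for each colour, the shuffle whose first block has image [X i]. *)
have /fin_all_exists2 [s sP sX] (i : 'I_m) := @shuffle_perm_exists M (K i) (ltnW (degree_lt_Mk i)) (X i) (XK i).
have kE i : (inord #|X i| : 'I_M) = #|X i| :> nat.
  by rewrite inordK //; apply: leq_ltn_trans (XKc i) (degree_lt_Mk i).
exists ([ffun i => inord #|X i|], [ffun i => s i]).
  rewrite inE; apply/andP; split; first by apply/forallP => i; rewrite /= ffunE kE.
  by apply/forallP => i; rewrite !ffunE /= ?ffunE ?kE; have := sP i; rewrite /shuffle_perm !ffunE.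
by apply/setP => -[i y]; rewrite inE /= !ffunE kE sX permKV inE.
Qed.
End ShuffleProduct.
End Numerators.

(** * Values and coefficients of multivariate polynomials *)

Section MultivariatePolynomials.
Variable R : numFieldType.

Lemma digits_inj B n (a b : 'I_n -> nat) : (forall i, a i < B)%N -> (forall i, b i < B)%N ->
  (\sum_(i < n) a i * B ^ i = \sum_(i < n) b i * B ^ i)%N -> a =1 b.
Proof.
elim: n a b => [|n IH] a b aB bB; first by move=> _ [].
have E (c : 'I_n.+1 -> nat) : (\sum_(i < n.+1) c i * B ^ i = c ord0 + B * \sum_(i < n) c (lift ord0 i) * B ^ i)%N.
  rewrite big_ord_recl expn0 muln1 big_distrr; congr (_ + _)%N; apply: eq_bigr => i _.
  by rewrite /= /bump add1n expnS mulnCA.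
rewrite !E => e.
have B0 : (0 < B)%N by apply: leq_ltn_trans (aB ord0).
have e0 : a ord0 = b ord0.
  by have := congr1 (modn ^~ B) e; rewrite /= ![(B * _)%N]mulnC ![(_ + _ * B)%N]addnC !modnMDl !modn_small.
have e1 : (\sum_(i < n) a (lift ord0 i) * B ^ i = \sum_(i < n) b (lift ord0 i) * B ^ i)%N.
  by move: e; rewrite e0 => /addnI /eqP; rewrite eqn_pmul2l // => /eqP.
move=> i; have [j ->|->] := unliftP ord0 i; last exact: e0.
exact: (IH _ _ (fun j => aB _) (fun j => bB _) e1).
Qed.

(** Kronecker substitution: setting the [i]-th variable to [t ^+ (B ^ i)], with [B] above all
    exponents, sends different monomials to different powers of [t]. *)
Lemma mpoly_eval_eq0 n (p : {mpoly R[n]}) : (forall x, p.@[x] = 0) -> p = 0.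
Proof.
move=> p0; pose B := msize p.
pose k (m : 'X_{1.. n}) := (\sum_(i < n) m i * B ^ i)%N.
have mB m : m \in msupp p -> forall i, (m i < B)%N.
  by move=> mp i; apply: leq_ltn_trans (msize_mdeg_lt mp); rewrite mdegE (bigD1 i) //= leq_addr.
pose q : {poly R} := \sum_(m <- msupp p) p@_m *: 'X^(k m).
have q0 : q = 0.
  apply: (@poly_cofinite_eq0 _ [::]) => t _; rewrite -(p0 (fun i => t ^+ (B ^ i))) mevalE horner_sum.
  apply: eq_bigr => m _; rewrite hornerZ hornerXn /k expr_sum; congr (_ * _).
  by apply: eq_bigr => i _; rewrite mulnC exprM.
apply/eqP; rewrite -msupp_eq0; apply/eqP; case E: (msupp p) => [//|m0 s].
have m0p : m0 \in msupp p by rewrite E inE eqxx.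
have := congr1 (fun q : {poly R} => q`_(k m0)) q0; rewrite coef0 coef_sum (bigD1_seq m0 m0p (msupp_uniq p)) /=.
rewrite coefZ coefXn eqxx mulr1 big_seq_cond big1 ?addr0 => [|m /andP[mp mm0]].
  by move/eqP; rewrite mcoeff_eq0 m0p.
rewrite coefZ coefXn; case: eqP => [e|_]; last by rewrite mulr0.
case/negP: mm0; apply/eqP/mnmP => i.
by apply: (digits_inj (mB _ mp) (mB _ m0p)); rewrite -/(k m) -/(k m0) -e.
Qed.

Lemma polyf_mpoly S d f n : subringP S -> polyf S d f -> exists2 p : {mpoly R[n]}, (forall m, S p@_m) &
  forall x : 'I_n -> R, f (fun k => if insub k is Some i then x i else 0) = p.@[x].
Proof.
move=> SS; elim=> {d f} [c Sc|i|d f g _ [p Sp pE] _ [q Sq qE]|d d' f g _ [p Sp pE] _ [q Sq qE]|//|d f g fg _ [p Sp pE]].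
- exists c%:MP => [m|x]; last by rewrite mevalC.
  by rewrite mcoeffC; apply: subringM => //; exact: subring_nat.
- have [lt|ge] := ltnP i n.
    exists 'X_(Ordinal lt) => [m|x]; first by rewrite mcoeffX; exact: subring_nat.
    by rewrite mevalXU insubT; congr x; exact: val_inj.
  exists 0 => [m|x]; first by rewrite mcoeff0; exact: subring0.
  by rewrite meval0 insubN // -leqNgt.
- exists (p + q) => [m|x]; last by rewrite pE qE mevalD.
  by rewrite mcoeffD; exact: subringD.
- exists (p * q) => [m|x]; last by rewrite pE qE mevalM.
  by rewrite mcoeffM; apply: subring_sum => // k _; exact: subringM.
- by exists p => // x; rewrite -fg.
Qed.

(** An integral function is the value function of some polynomial over [S], and a polynomial is
    determined by its values. *)
Lemma polyfn_mcoeff S n (p : {mpoly R[n]}) : subringP S -> polyfn S (fun v => p.@[fun i : 'I_n => v i]) ->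
  forall m, S p@_m.
Proof.
move=> SS [d Pd] m; have [q Sq qE] := polyf_mpoly n SS Pd.
suff -> : p = q by [].
apply/eqP; rewrite -subr_eq0; apply/eqP/mpoly_eval_eq0 => x; rewrite mevalB -qE; apply/eqP.
by rewrite subr_eq0; apply/eqP/meval_eq => i; rewrite valK.
Qed.

Lemma mcoeff_polyfn S n (p : {mpoly R[n]}) (f : 'I_n -> (nat -> R) -> R) : subringP S ->
  (forall m, S p@_m) -> (forall i, polyfn S (f i)) -> polyfn S (fun v => p.@[fun i => f i v]).
Proof.
move=> SS Sp Pf; apply: (@polyfn_ext _ _ (fun v => \sum_(m <- msupp p) p@_m * \prod_(i < n) f i v ^+ m i)).
  by move=> v; rewrite mevalE.
apply: polyfn_sum => // m _ _; apply: polyfn_scale => //; apply: polyfn_prod => // i _ _.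
exact: polyfn_expr.
Qed.
End MultivariatePolynomials.

Lemma subring_dyadic : subringP dyadic.
Proof.
have p2 n : (2 : C) ^+ n != 0 by rewrite expf_neq0 ?pnatr_eq0.
split.
- by exists 1, 0%N; rewrite expr0 divr1.
- move=> _ _ [a [s ->]] [b [t ->]]; exists (a * 2 ^+ t - b * 2 ^+ s), (s + t)%N.
  by rewrite rmorphB !rmorphM !rmorphXn /= exprD; field; rewrite !p2.
- move=> _ _ [a [s ->]] [b [t ->]]; exists (a * b), (s + t)%N.
  by rewrite rmorphM /= exprD; field; rewrite !p2.
Qed.

Lemma dyadic_half : dyadic 2^-1.
Proof. by exists 1, 1%N; rewrite expr1 mul1r. Qed.

(** * Between families of numerators and functions on lists *)

Section WeightedFamilies.
Variable m : nat.
Notation elt := (nat * C)%type.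
Implicit Types (L : seq elt) (F : Wfam m).

Lemma num_deg F K L : okL m L -> K = degL m L -> num F L = evalK m K (F K) (@ptL m L).
Proof. by move=> oL ->; rewrite /num oL. Qed.

Lemma okL_inst v l : okL m (inst v l) = all (fun c => c.1 < m)%N l.
Proof. by rewrite /okL all_map. Qed.

Lemma colv_inst i v l : colv i (inst v l) = [seq v c.2 | c <- l & c.1 == i].
Proof. by rewrite /colv /inst filter_map -!map_comp. Qed.

Lemma num_sym F : (forall K, Defs.is_sym m K (F K)) -> lsym (num F).
Proof.
move=> Fs L L' P; have [oL|oL] := boolP (okL m L); last first.
  by rewrite /num (negPf oL) ifN // /okL -(perm_all _ P).
have rL := rep_self oL; rewrite (num_rep (@Fs _) rL) (num_rep (@Fs _) (rep_perm P rL)) //.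
Qed.

Lemma num_wheel F : (forall K, wheel m K (F K)) -> wheel1 (num F).
Proof.
move=> Fw i j x L ij; set L1 := [:: _, _, _ & L]; rewrite /num; case: ifP => // /and4P[/= im _ jm _].
have ji : (j == i) = false by move: ij; rewrite /adj; lia.
have ij' : (i == j) = false by rewrite eq_sym.
have ci : colv i L1 = x + 1 :: x :: colv i L by rewrite /colv /= !eqxx ji.
have cj : colv j L1 = (x + 2^-1) :: colv j L by rewrite /colv /= ij' eqxx.
apply: (Fw _ _ (Ordinal im) (Ordinal jm) 0%N 1%N 0%N) => //.
- by rewrite ffunE ci.
- by rewrite ffunE ci.
- by rewrite ffunE cj.
- by rewrite /ptL ci cj /=; field.
- by rewrite /ptL ci cj /=; field.
Qed.

Lemma num_col F L : ~~ all (fun a : elt => (a.1 < m)%N) L -> num F L = 0.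
Proof. by move=> h; rewrite /num /okL ifN. Qed.

Lemma size_degL L : okL m L -> size L = (\sum_(i < m) degL m L i)%N.
Proof.
elim: L => [_|[c x] L IH /andP[/= cm /IH ->]].
  by rewrite big1 // => i _; rewrite ffunE.
rewrite [RHS](eq_bigr (fun i : 'I_m => (i == Ordinal cm) + degL m L i)%N) => [|i _].
  by rewrite big_split /= -big_mkcond sum1_card card1.
by rewrite !ffunE /colv /= eq_sym -val_eqE /=; case: ifP.
Qed.

Lemma num_bounded F B : (forall K : degree m, (exists i, (B <= K i)%N) -> F K = 0) ->
  forall L, (m * B < size L)%N -> num F L = 0.
Proof.
move=> FB L sL; rewrite /num; case: ifP => // oL; rewrite FB ?/evalK ?meval0 //.
case: (pickP (fun i => B <= degL m L i)%N) => [i h|h]; first by exists i.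
move: sL; rewrite (size_degL oL) ltnNge.
have -> : (\sum_(i < m) degL m L i <= m * B)%N by
  rewrite -[X in (_ <= X * _)%N]card_ord -sum_nat_const leq_sum // => i _; rewrite ltnW // ltnNge h.
by [].
Qed.

Lemma polyfn_flatpt S K l t : subringP S -> polyfn S (fun v => flatpt m K (@ptL m (inst v l)) t).
Proof.
move=> SS; apply: polyfn_sum => // i _ _; apply: polyfn_sum => // r _ _.
case: (offset m K i + r == t)%N; last by apply: polyfn_cst; exact: subring0.
pose g (v : nat -> C) : C := if (r < size [seq c <- l | c.1 == nat_of_ord i])%N
   then v (nth (0, 0)%N [seq c <- l | c.1 == nat_of_ord i] r).2 else 0.
apply: (polyfn_ext (f := g)); rewrite /g {g}.
  move=> v; rewrite /ptL colv_inst; case: ltnP => h; first by rewrite (nth_map (0, 0)%N).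
  by rewrite nth_default // size_map.
by case: (_ < _)%N; [exact: polyfn_var|apply: polyfn_cst; exact: subring0].
Qed.

Lemma lpoly_num S F : subringP S -> (forall K mon, S (F K)@_mon) -> lpoly S (num F).
Proof.
move=> SS FS l; have [ol|ol] := boolP (all (fun c => c.1 < m)%N l); last first.
  apply: (@polyfn_ext C S (fun=> 0)); last by apply: polyfn_cst; exact: subring0.
  by move=> v; rewrite /num okL_inst (negPf ol).
pose K : degree m := [ffun i : 'I_m => size [seq c <- l | c.1 == nat_of_ord i]].
apply: (@polyfn_ext C S (fun v => evalK m K (F K) (@ptL m (inst v l)))) => [v|].
  rewrite (num_deg F (K := K)) ?okL_inst //.
  by apply/ffunP => i; rewrite !ffunE colv_inst size_map.
by apply: mcoeff_polyfn => // t; exact: polyfn_flatpt.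
Qed.

(** The blocks of variables tile the interval below [Nk K]; summed over the first [n] blocks, the
    count is the indicator of [t] lying below the end of the last one. *)
Lemma sum_blocks (K : degree m) (t : nat) : (t < Nk m K)%N ->
  (\sum_(i < m) \sum_(r < K i) (offset m K i + r == t) = 1)%N.
Proof.
move=> tN; pose k j := if insub j is Some i then K i else 0%N.
have kE (i : 'I_m) : k i = K i by rewrite /k valK.
pose off n := (\sum_(j < n) k j)%N.
have offE (i : 'I_m) : offset m K i = off i.
  rewrite /offset /off (big_ord_widen m k (ltnW (ltn_ord i))); by apply: eq_bigr => j _; rewrite kE.
have H n : (\sum_(i < n) \sum_(r < k i) (off i + r == t) = (t < off n))%N.
  elim: n => [|n IH]; first by rewrite /off !big_ord0.
  have -> : off n.+1 = (off n + k n)%N by rewrite /off big_ord_recr.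
  rewrite big_ord_recr /= IH; move: (off n) (k n) => o c; clear.
  elim: c => [|c IH]; first by rewrite big_ord0 !addn0.
  rewrite big_ord_recr /= addnA IH; lia.
have offm : off m = Nk m K by apply: eq_bigr => i _; rewrite kE.
have := H m; rewrite offm tN => Hm; rewrite -[RHS]Hm.
by apply: eq_bigr => i _; rewrite offE kE.
Qed.

(** The template on which variable [t] of the polynomial is variable [t] of the function, so that
    coefficients can be recovered from [num]. *)
Definition stdidx (K : degree m) : seq (nat * nat) :=
  flatten [seq [seq (nat_of_ord i, (offset m K i + r)%N) | r <- iota 0 (K i)] | i <- enum 'I_m].

Lemma colv_stdidx (K : degree m) v (i : 'I_m) :
  colv i (inst v (stdidx K)) = [seq v (offset m K i + r)%N | r <- iota 0 (K i)].
Proof.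
rewrite colv_inst /stdidx filter_flatten -map_comp.
suff H (s : seq 'I_m) : uniq s -> flatten [seq (filter (fun c : nat * nat => c.1 == i) \o
    (fun i : 'I_m => [seq (nat_of_ord i, (offset m K i + r)%N) | r <- iota 0 (K i)])) j | j <- s]
    = if i \in s then [seq (nat_of_ord i, (offset m K i + r)%N) | r <- iota 0 (K i)] else [::].
  by rewrite H ?enum_uniq // mem_enum -map_comp.
elim: s => //= j s IH /andP[js us]; rewrite IH // inE filter_map.
rewrite (eq_filter (a2 := fun=> j == i)) => [|r] //=.
have [<-|ji] := eqVneq j i; first by rewrite filter_predT (negPf js) cats0.
by rewrite filter_pred0.
Qed.

Lemma num_stdidx F (K : degree m) v : (forall K, Defs.is_sym m K (F K)) ->
  num F (inst v (stdidx K)) = (F K).@[fun t : 'I_(Nk m K) => v t].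
Proof.
move=> Fs; rewrite (num_rep (K := K) (v := fun i r => v (offset m K i + r)%N) (@Fs _)); last first.
  split=> [|i]; last by rewrite colv_stdidx.
  rewrite okL_inst; apply/allP => c /flattenP[_ /mapP[i _ ->]] /mapP[r _ ->] /=; exact: ltn_ord.
apply: meval_eq => t; rewrite /flatpt.
transitivity (\sum_(i < m) \sum_(r < K i) (offset m K i + r == t)%:R * v t).
  apply: eq_bigr => i _; apply: eq_bigr => r _.
  by case: eqP => [->|_]; rewrite ?mul1r ?mul0r.
under eq_bigr do rewrite -mulr_suml -natr_sum.
by rewrite -mulr_suml -natr_sum sum_blocks // mul1r.
Qed.

Lemma num_lpolyS S F : subringP S -> (forall K, Defs.is_sym m K (F K)) -> lpoly S (num F) ->
  forall K mon, S (F K)@_mon.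
Proof.
move=> SS Fs PF K; apply: polyfn_mcoeff => //.
by apply: polyfn_ext (PF (stdidx K)) => v; rewrite num_stdidx.
Qed.

Lemma num_eq0 F : (forall K, Defs.is_sym m K (F K)) -> (forall L, num F L = 0) -> forall K, F K = 0.
Proof.
move=> Fs F0 K; apply: mpoly_eval_eq0 => x.
have := F0 (inst (fun k => if insub k is Some i then x i else 0) (stdidx K)); rewrite num_stdidx // => <-.
by apply: meval_eq => t; rewrite valK.
Qed.
End WeightedFamilies.

(** * Divided powers of root vectors *)

Section Commutators.
Variable A : algType C.
Implicit Types x y z u : A.

Lemma jacobi x y z : commr x (commr y z) = commr (commr x y) z + commr y (commr x z).
Proof.
have zid (V : zmodType) (a b c d e f : V) : a - b - (c - d) = a - e - (f - d) + (e - c - (b - f)).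
  by rewrite !opprB [RHS]addrACA !subrKA addrACA [RHS]addrACA [- b - c]addrC.
rewrite /commr !mulrBl !mulrBr !mulrA; exact: zid.
Qed.

Lemma commrN x y : commr x y = - commr y x.
Proof. by rewrite /commr opprB. Qed.

Lemma commr0 x : commr x 0 = 0. Proof. by rewrite /commr mulr0 mul0r subrr. Qed.
Lemma comm0r x : commr 0 x = 0. Proof. by rewrite /commr mulr0 mul0r subrr. Qed.
Lemma commrNr x y : commr x (- y) = - commr x y.
Proof. by rewrite /commr mulrN mulNr opprB opprK addrC. Qed.
Lemma commrNl x y : commr (- x) y = - commr x y.
Proof. by rewrite /commr mulrN mulNr opprB opprK addrC. Qed.

Lemma commrMl u x y : commr (u * x) y = u * commr x y + commr u y * x.
Proof. by rewrite /commr mulrBr mulrBl !mulrA addrA subrK. Qed.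

Lemma commrZl (c : C) x y : commr (c *: x) y = c *: commr x y.
Proof. by rewrite /commr scalerBr scalerAl scalerAr. Qed.

Lemma commr_suml (I : Type) (r : seq I) (P : pred I) (F : I -> A) y :
  commr (\sum_(i <- r | P i) F i) y = \sum_(i <- r | P i) commr (F i) y.
Proof. by rewrite /commr mulr_suml mulr_sumr -sumrB. Qed.

Definition dpow (k : nat) (x : A) : A := (k`!%:R : C)^-1 *: x ^+ k.

Lemma fact_neq0 k : (k`!%:R : C) != 0.
Proof. by rewrite pnatr_eq0 -lt0n fact_gt0. Qed.

Section DividedAdjoint.
Variable y : A.

(** The [k]-th divided power of the derivation sending [u] to [commr u y], written with divided
    powers of [y] so that no other denominator appears. *)
Definition dad k u := \sum_(a < k.+1) (-1) ^+ a *: (dpow a y * u * dpow (k - a) y).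

(** Each term of [dad k.+1] arises from two neighbours in [dad k], with coefficients [k + 1 - a] and
    [a]. *)
Lemma commr_dad k u : commr (dad k u) y = k.+1%:R *: dad k.+1 u.
Proof.
have dpowS a : dpow a y * y = a.+1%:R *: dpow a.+1 y.
  rewrite /dpow factS natrM invfM scalerA mulVKf ?mulrA; last by rewrite pnatr_eq0.
  by rewrite -scalerAl exprSr.
have dpowS' a : y * dpow a y = a.+1%:R *: dpow a.+1 y.
  by rewrite -dpowS /dpow -scalerAl -scalerAr -exprS -exprSr.
rewrite /dad commr_suml scaler_sumr.
pose E a := (-1) ^+ a *: (dpow a y * u * dpow (k.+1 - a) y).
transitivity (\sum_(a < k.+1) ((k.+1 - a)%:R : C) *: E a + \sum_(a < k.+1) (a.+1%:R : C) *: E a.+1).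
  rewrite -big_split /=; apply: eq_bigr => a _.
  have ak : (a <= k)%N by rewrite -ltnS.
  rewrite commrZl /E /commr -!mulrA dpowS !mulrA dpowS' subSn //.
  have -> : (-1 : C) ^+ a.+1 = - (-1) ^+ a by rewrite exprS mulN1r.
  rewrite subSS -!scalerAl -!scalerAr scalerBr !scalerA -scaleNr.
  by congr (_ *: _ + _ *: _); ring.
have -> : \sum_(a < k.+1) ((k.+1 - a)%:R : C) *: E a = \sum_(a < k.+2) ((k.+1 - a)%:R : C) *: E a.
  by rewrite [RHS]big_ord_recr /= subnn scale0r addr0.
have -> : \sum_(a < k.+1) (a.+1%:R : C) *: E a.+1 = \sum_(a < k.+2) (a%:R : C) *: E a.
  by rewrite [RHS]big_ord_recl /= scale0r add0r.
rewrite -big_split; apply: eq_bigr => a _ /=.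
by rewrite -scalerDl -natrD subnK // -ltnS.
Qed.

Variables x z : A.
Hypotheses (xy : commr x y = z) (zy : commr z y = 0) (xz : commr x z = 0).

Lemma commr_expr n : commr (x ^+ n) y = n%:R *: (z * x ^+ n.-1).
Proof.
have xzC : x * z = z * x by apply/eqP; rewrite -subr_eq0; apply/eqP.
elim: n => [|[|n] IH]; first by rewrite expr0 scale0r /commr mulr1 mul1r subrr.
  by rewrite expr1 xy scale1r expr0 mulr1.
rewrite exprS commrMl IH xy -scalerAr mulrA xzC -mulrA -exprS /=.
by rewrite -[X in _ + X]scale1r -scalerDl natr1.
Qed.

(** As [z] commutes with [x] and [y], bracketing with [y] acts on powers of [x] as [z] times
    differentiation. *)
Lemma dad_expr k n : (k <= n)%N -> k`!%:R *: dad k (x ^+ n) = (n ^_ k)%:R *: (z ^+ k * x ^+ (n - k)).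
Proof.
have zk k' : commr (z ^+ k') y = 0.
  elim: k' => [|k' IH]; first by rewrite expr0 /commr mulr1 mul1r subrr.
  by rewrite exprS commrMl IH zy mulr0 mul0r addr0.
elim: k => [_|k IH kn].
  by rewrite /dad big_ord1 /dpow !expr0 !fact0 !invr1 !scale1r mulr1 !mul1r subn0.
rewrite factS mulnC natrM -scalerA -commr_dad -commrZl IH ?(ltnW kn) // commrZl commrMl zk mul0r addr0.
rewrite commr_expr -scalerAr scalerA mulrA -exprSr ffactnSr natrM -subnS; congr (_ *: (_ * _)).
Qed.

Lemma dpow_commr k : dpow k z = dad k (dpow k x).
Proof.
have := dad_expr (leqnn k); rewrite ffactnn subnn expr0 mulr1 => /(scalerI (fact_neq0 k)) E.
rewrite {1}/dpow -E.
rewrite /dad scaler_sumr; apply: eq_bigr => a _.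
rewrite [dpow k x]/dpow -[dpow a y * (_ *: _)]scalerAr -[_ *: _ * dpow _ _]scalerAl.
by rewrite !scalerA mulrC.
Qed.
End DividedAdjoint.
End Commutators.

Section DividedPowers.
Variables (m : nat) (A : algType C) (e : 'I_m -> nat -> A).
Hypothesis eY : Yrel m A e.

Lemma serre (i j : 'I_m) r s : cartan m i j = - 1%:Z -> commr (e i r) (commr (e i r) (e j s)) = 0.
Proof.
case: eY => _ _ h ij; have := h i j r r s ij; rewrite -mulr2n => /eqP.
by rewrite -scaler_nat scaler_eq0 pnatr_eq0 /= => /eqP.
Qed.

Lemma cartan_adj (i j : 'I_m) : (i.+1 == j :> nat) || (j.+1 == i :> nat) -> cartan m i j = - 1%:Z.
Proof. by move=> h; rewrite /cartan h ifF //; apply/negP => /eqP e0; move: h; rewrite e0; lia. Qed.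

Lemma cartan_far (i j : 'I_m) : (i.+1 < j)%N -> cartan m i j = 0.
Proof.
move=> h; rewrite /cartan; case: eqP => [e0|_]; first by move: h; rewrite e0; lia.
by rewrite ifF //; lia.
Qed.

Lemma eroot_self i r : eroot m A e i i r = e i r.
Proof.
rewrite /eroot (eq_filter (a2 := pred0)) ?filter_pred0 // => k /=.
by apply/negP; lia.
Qed.

Lemma eroot_step (i j j' : 'I_m) r : (i <= j')%N -> j = j'.+1 :> nat ->
  eroot m A e i j r = commr (eroot m A e i j' r) (e j 0%N).
Proof.
move=> ij jj; rewrite /eroot.
suff -> : [seq k : 'I_m <- enum 'I_m | (i < k <= j)%N] = rcons [seq k : 'I_m <- enum 'I_m | (i < k <= j')%N] j.
  by rewrite foldl_rcons.
apply: pairwise_ltn_eq => [||k]; first exact: pairwise_enum_ord.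
  rewrite pairwise_rcons pairwise_enum_ord andbT; apply/allP => k; rewrite mem_filter /=; lia.
rewrite mem_rcons in_cons !mem_filter -!enumT ?mem_enum ?andbT -val_eqE /=; lia.
Qed.

(* The three relations that make the string [i..j] and [e j+1 0] behave as two root vectors of sl_3. *)
Lemma eroot_serre (i j : 'I_m) r : (i <= j)%N ->
  [/\ forall k : 'I_m, (j.+1 < k)%N -> commr (eroot m A e i j r) (e k 0%N) = 0,
      forall k : 'I_m, k = j.+1 :> nat -> commr (commr (eroot m A e i j r) (e k 0%N)) (e k 0%N) = 0 &
      forall k : 'I_m, k = j.+1 :> nat -> commr (eroot m A e i j r) (commr (eroot m A e i j r) (e k 0%N)) = 0].
Proof.
have [n] := ubnP (j - i)%N; elim: n j => // n IH j jn ij.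
have [ji|ji] := eqVneq i j.
  subst j; rewrite eroot_self; case: (eY) => _ far _; split=> k hk.
  - by apply: far; exact: cartan_far.
  - rewrite commrN [commr (e i r) _]commrN commrNr opprK; apply: serre.
    by apply: cartan_adj; rewrite hk eqxx orbT.
  - by apply: serre; apply: cartan_adj; rewrite hk eqxx.
have jm : (j.-1 < m)%N by apply: leq_ltn_trans (ltn_ord j); exact: leq_pred.
have ij' : (i < j)%N by rewrite ltn_neqAle ij andbT val_eqE.
pose p := Ordinal jm; have jp : j = p.+1 :> nat by rewrite /= prednK // (leq_ltn_trans _ ij').
have ip : (i <= p)%N by rewrite -ltnS -jp.
have [|far b c] := IH p _ ip; first by move: jn jp ij'; rewrite /=; lia.
rewrite (eroot_step r ip jp); set P := eroot m A e i p r in far b c *; set y := e j 0%N.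
case: (eY) => _ efar _.
split=> k hk; set w := e k 0%N.
- have Pw : commr P w = 0 by apply: far; rewrite -jp ltnW.
  have yw : commr y w = 0 by apply: efar; exact: cartan_far.
  by rewrite commrN jacobi [commr w P]commrN Pw [commr w y]commrN yw !oppr0 comm0r commr0 addr0 oppr0.
- have Pw : commr P w = 0 by apply: far; rewrite -jp hk.
  have Qw : commr (commr P y) w = commr P (commr y w) by rewrite jacobi Pw commr0 addr0.
  have yww : commr (commr y w) w = 0.
    rewrite commrN [commr y w]commrN commrNr opprK; apply: serre.
    by apply: cartan_adj; rewrite hk eqxx orbT.
  by rewrite Qw commrN jacobi [commr w P]commrN Pw oppr0 comm0r add0r [commr w _]commrN yww oppr0 commr0 oppr0.
- have Pw : commr P w = 0 by apply: far; rewrite -jp hk.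
  set Q := commr P y.
  have Qw : commr Q w = commr P (commr y w) by rewrite /Q jacobi Pw commr0 addr0.
  have PQ : commr P Q = 0 by apply: c.
  have Qy : commr Q y = 0 by apply: b.
  have yyw : commr y (commr y w) = 0.
    by apply: serre; apply: cartan_adj; rewrite hk eqxx.
  have QW : commr Q (commr y w) = 0.
    (* Applying the Jacobi identity repeatedly returns the same bracket with opposite sign, so it
       vanishes. *)
    have E : commr Q (commr y w) = - commr Q (commr y w).
      rewrite {1}jacobi Qy comm0r add0r Qw jacobi yyw commr0 addr0 [commr y P]commrN -/Q commrNl //.
    have : commr Q (commr y w) + commr Q (commr y w) = 0 by rewrite {1}E addNr.
    rewrite -mulr2n => /eqP.
    by rewrite -scaler_nat scaler_eq0 pnatr_eq0 /= => /eqP.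
  by rewrite Qw jacobi [commr Q P]commrN PQ oppr0 comm0r add0r QW commr0.
Qed.

Lemma Ybold_sum (n : nat) (F : 'I_n -> A) : (forall i, Ybold m A e (F i)) -> Ybold m A e (\sum_i F i).
Proof.
move=> h; elim/big_ind: _ => //; last exact: Yb_add.
by rewrite -(subrr 1); apply: Yb_add; [exact: Yb_one|apply: Yb_opp; exact: Yb_one].
Qed.

Lemma Ybold_eroot (i j : 'I_m) r k : (i <= j)%N -> Ybold m A e (dpow k (eroot m A e i j r)).
Proof.
have [n] := ubnP (j - i)%N; elim: n j k => // n IH j k jn ij.
have [ji|ji] := eqVneq i j; first by subst j; rewrite eroot_self; exact: Yb_gen.
have jm : (j.-1 < m)%N by apply: leq_ltn_trans (ltn_ord j); exact: leq_pred.
have ij' : (i < j)%N by rewrite ltn_neqAle ij andbT val_eqE.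
pose p := Ordinal jm; have jp : j = p.+1 :> nat by rewrite /= prednK // (leq_ltn_trans _ ij').
have ip : (i <= p)%N by rewrite -ltnS -jp.
have [far b c] := eroot_serre r ip.
rewrite (eroot_step r ip jp) (dpow_commr (y := e j 0%N) (x := eroot m A e i p r) erefl (b _ jp) (c _ jp)).
apply: Ybold_sum => a.
have H u : Ybold m A e u -> Ybold m A e ((-1) ^+ a *: u).
  move=> Yu; rewrite -signr_odd; case: (odd a); rewrite ?expr0 ?scale1r //.
  by rewrite expr1 scaleN1r; exact: Yb_opp.
apply: H; apply: Yb_mul; last exact: Yb_gen.
apply: Yb_mul; first exact: Yb_gen.
by apply: IH => //; move: jn jp ij'; rewrite /=; lia.
Qed.

Lemma Ybold_prod (I : Type) (r : seq I) (P : pred I) (F : I -> A) :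
  (forall i, P i -> Ybold m A e (F i)) -> Ybold m A e (\prod_(i <- r | P i) F i).
Proof. by move=> h; elim/big_ind: _ => //; [exact: Yb_one|exact: Yb_mul]. Qed.

Lemma Ybold_Eh R h : Ybold m A e (Eh m A e R h).
Proof.
apply: Ybold_prod => i _; apply: Ybold_prod => j ij; apply: Ybold_prod => r _.
exact: Ybold_eroot.
Qed.
End DividedPowers.

(** * Homogeneity, uniform degree bounds and sums over splittings *)

Section Homogeneity.
Variable R : numFieldType.
Notation elt := (nat * R)%type.
Notation gen := (nat * nat * nat)%type.
Local Notation om0 := (@om0 R).
Local Notation om1 := (@om1 R).
Local Notation mono := (@mono R).
Local Notation eps := (@eps R).
Implicit Types (F G T : seq elt -> R) (L : seq elt) (S : R -> Prop) (v : nat -> R).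

Lemma hc_sub S F G k L : lpoly S F -> lpoly S G -> hc (fun L => F L - G L) k L = hc F k L - hc G k L.
Proof.
move=> PF PG; rewrite /hc (hpoly_unique (q := hpoly F L - hpoly G L)) ?coefB // => t.
by rewrite hornerD hornerN -(hpolyE _ _ PF) -(hpolyE _ _ PG).
Qed.

Lemma hc_scale S c F k L : lpoly S F -> hc (fun L => c * F L) k L = c * hc F k L.
Proof.
move=> PF; rewrite /hc (hpoly_unique (q := c *: hpoly F L)) ?coefZ // => t.
by rewrite hornerZ -(hpolyE _ _ PF).
Qed.

Lemma hc_sum S (I : Type) (r : seq I) (P : pred I) (F : I -> seq elt -> R) k L : (forall i, lpoly S (F i)) ->
  hc (fun L => \sum_(i <- r | P i) F i L) k L = \sum_(i <- r | P i) hc (F i) k L.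
Proof.
move=> PF; rewrite /hc (hpoly_unique (q := \sum_(i <- r | P i) hpoly (F i) L)) ?coef_sum // => t.
by rewrite horner_sum; apply: eq_bigr => i _; rewrite -(hpolyE _ _ (PF i)).
Qed.

(** Homogeneity of degree [e + adjn - size], with the normalization of [lead] and written without
    subtraction. *)
Definition hom e T := forall u L, u != 0 -> T (dil u L) * u ^+ size L = u ^+ (e + adjn (unzip1 L)) * T L.

Lemma hom_op e e' T T' : hom e T -> hom e' T' -> hom (e + e') (op om0 T T').
Proof.
move=> hT hT' u L u0; rewrite !op_splits /dil splits_map big_map mulr_suml mulr_sumr.
rewrite big_seq [RHS]big_seq; apply: eq_bigr => p pL /=.
rewrite (perm_size (splits_perm pL)) size_cat (adjn_splits pL).
have W : weight om0 (dil u p.1) (dil u p.2) = u ^+ (\sum_(a <- p.1) \sum_(b <- p.2) adj a.1 b.1) * weight om0 p.1 p.2.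
  rewrite /weight /dil big_map expr_sum -big_split; apply: eq_bigr => a _ /=.
  by rewrite big_map expr_sum -big_split; apply: eq_bigr => b _ /=; rewrite om0_dil.
rewrite -/(dil u p.1) -/(dil u p.2) W.
have -> : T (dil u p.1) * T' (dil u p.2) * (u ^+ (\sum_(a <- p.1) \sum_(b <- p.2) adj a.1 b.1) * weight om0 p.1 p.2) * u ^+ (size p.1 + size p.2)
  = (T (dil u p.1) * u ^+ size p.1) * (T' (dil u p.2) * u ^+ size p.2) * (u ^+ (\sum_(a <- p.1) \sum_(b <- p.2) adj a.1 b.1) * weight om0 p.1 p.2).
  by rewrite exprD; ring.
by rewrite hT // hT' // !exprD; ring.
Qed.

Lemma hom_lone : hom 0 (@lone R).
Proof. by move=> u [|x L] _ /=; rewrite ?mul0r ?mulr0 // big_nil. Qed.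

Lemma hom_eps i j r : (i <= j)%N -> hom r.+1 (eps (i, j, r)).
Proof.
move=> ij u L u0; rewrite /eps unzip1_dil; case: ifP => P; last by rewrite mul0r mulr0.
rewrite (perm_adjn P) adjn_roots // -[size L](size_map fst) (perm_size P) size_iota.
have -> : \prod_(a <- dil u L) (if a.1 == i then a.2 ^+ r else 1)
     = u ^+ r * \prod_(a <- L) (if a.1 == i then a.2 ^+ r else 1).
  rewrite big_map (eq_bigr (fun a => (if a.1 == i then u ^+ r else 1) * (if a.1 == i then a.2 ^+ r else 1))) => [|a _].
    rewrite big_split /= -(big_map fst xpredT (fun k => if k == i then u ^+ r else 1)) (perm_big _ P) /=.
    by rewrite prod_uniq_if ?iota_uniq // mem_roots // leqnn ij.
  by case: ifP; rewrite ?mulr1 // exprMn.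
have -> : (r.+1 + (j - i) = r + (j.+1 - i))%N by lia.
by rewrite exprD; ring.
Qed.

Definition wt (s : seq gen) := (\sum_(b <- s) b.2.+1)%N.

Lemma hom_mono (s : seq gen) : all (fun b : gen => b.1.1 <= b.1.2)%N s -> hom (wt s) (mono s).
Proof.
move=> gs; suff H : hom (wt s) (@epsprod R s).
  by move=> u L u0; rewrite /mono mulrCA -mulrA; congr (_ * _); exact: H.
elim: s gs => [_|[[i j] r] s IH /andP[/= ij gs]]; first by rewrite /wt big_nil; exact: hom_lone.
by rewrite /wt big_cons; apply: hom_op; [exact: hom_eps|exact: IH].
Qed.

Lemma lpoly_eps S b : subringP S -> lpoly S (eps b).
Proof.
case: b => -[i j] r SS l; rewrite /eps.
apply: (@polyfn_ext _ _ (fun v => if perm_eq (unzip1 l) (roots i j) then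
   (-1) ^+ (j - i) * \prod_(c <- l) (if c.1 == i then v c.2 ^+ r else 1) else 0)) => [v|].
  by rewrite /unzip1 /inst -map_comp big_map.
case: (perm_eq _ _); last by apply: polyfn_cst; exact: subring0.
apply: polyfn_scale; first exact: subring_sign.
apply: polyfn_prod => // c _ _; case: (c.1 == i); last by apply: polyfn_cst; exact: subring1.
by apply: polyfn_expr => //; exact: polyfn_var.
Qed.

Lemma lpoly_lone S : subringP S -> lpoly S (@lone R).
Proof. by move=> SS [|c l]; apply: polyfn_cst; [exact: subring1|exact: subring0]. Qed.

Lemma polyfn_om0 S a b : subringP S -> polyfn S (fun v => om0 (a.1, v a.2) (b.1, v b.2)).
Proof.
move=> SS; have H (c d : nat * nat) : polyfn S (fun v => cross (c.1, v c.2) (d.1, v d.2)).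
  rewrite /cross /=; case: (c.1.+1 == d.1).
    by apply: polyfn_sub => //; exact: polyfn_var.
  by apply: polyfn_cst; exact: subring1.
exact: polyfn_mul.
Qed.

Lemma lpoly_mono (s : seq gen) : lpoly (@anyR R) (mono s).
Proof.
have Sa := subring_any R; apply: lpoly_scale => //.
elim: s => [|b s IH]; first exact: lpoly_lone.
by apply: lpoly_op => //; [move=> a c; exact: polyfn_om0|exact: lpoly_eps].
Qed.

(** The degree of a polynomial function would be negative. *)
Lemma hom_small e T L : lpoly (@anyR R) T -> hom e T -> (e + adjn (unzip1 L) < size L)%N -> T L = 0.
Proof.
move=> PT hT lt.
have E : hpoly T L * 'X^(size L - (e + adjn (unzip1 L))) = (T L)%:P.
  apply: (@poly_cofinite_eq _ [:: 0]) => u; rewrite inE => u0.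
  apply: (mulfI (expf_neq0 (e + adjn (unzip1 L)) u0)).
  rewrite hornerM hornerXn hornerC -hT // (hpolyE _ _ PT) mulrCA -exprD subnKC //; exact: ltnW.
have := congr1 (fun q : {poly R} => q`_0) E; rewrite coefMXn coefC eqxx => <-.
by rewrite subn_gt0 lt.
Qed.

Fixpoint words m n : seq (seq nat) := [::] :: if n is n'.+1 then [seq c :: w | c <- iota 0 m, w <- words m n'] else [::].

Lemma mem_words m n w : (size w <= n)%N -> all (fun c => c < m)%N w -> w \in words m n.
Proof.
elim: n w => [|n IH] [|c w] //= sw /andP[cm wm]; rewrite inE; apply/orP; right.
by apply/allpairsP; exists (c, w); rewrite mem_iota; split=> //; exact: IH.
Qed.

(** Every template is a substitution into one with consecutive variables, and only finitely many
    colour words have length at most [n] and colours below [m]. *)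
Lemma uniform_degree m n S F : subringP S -> lpoly S F -> (forall L, (n < size L)%N -> F L = 0) ->
  (forall L, ~~ all (fun a : elt => (a.1 < m)%N) L -> F L = 0) -> exists d, lpolyd S d F.
Proof.
move=> SS PF Fn Fm.
have [d dP] : exists d, forall w, w \in words m n -> polyf S d (fun v => F (inst v (lstd w 0))).
  elim: (words m n) => [|w W [d dP]]; first by exists 0%N.
  have [d' Pd'] := PF (lstd w 0); exists (maxn d d') => w'; rewrite inE => /orP[/eqP ->|/dP h].
    exact: polyf_leq (leq_maxr _ _) Pd'.
  exact: polyf_leq (leq_maxl _ _) h.
exists d => l; apply: (@polyf_ext _ _ _ (fun v => F (inst (fun k => v (nth 0%N (unzip2 l) k)) (lstd (unzip1 l) 0)))).
  by move=> v; rewrite -inst_std.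
have [h|h] := boolP (unzip1 l \in words m n).
  apply: (polyf_subst (s := fun k v => v (nth 0%N (unzip2 l) k)) (dP _ h)) => k; exact: polyf_var.
apply: (@polyf_ext _ _ _ (fun=> 0)); last exact: polyf0.
move=> v; rewrite -inst_std; apply/esym; case: (leqP (size l) n) => ln; last by rewrite Fn // size_map.
apply: Fm; apply: contra h => h; apply: mem_words; first by rewrite size_map.
by move: h; rewrite /inst !all_map.
Qed.

Lemma adjn_le w : (adjn w <= size w * size w)%N.
Proof.
elim: w => //= c w IH; have : (\sum_(b <- w) adj c b <= size w)%N.
  by elim: (w) => [|b l IHl] /=; rewrite ?big_nil // big_cons; case: (adj c b) => /=; lia.
by move: IH; lia.
Qed.

Lemma sum_splits_insert (V : nmodType) (T : eqType) (f : seq T -> seq T -> V) x s1 s2 :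
  (forall A A' B B', perm_eq A A' -> perm_eq B B' -> f A B = f A' B') ->
  \sum_(p <- splits (s1 ++ x :: s2)) f p.1 p.2 = \sum_(p <- splits (x :: s1 ++ s2)) f p.1 p.2.
Proof.
elim: s1 f => // y s1 IH f fP /=.
rewrite !big_cat !big_map /= (IH (fun A B => f (y :: A) B)) => [|A A' B B' PA PB]; last first.
  by apply: fP => //; rewrite perm_cons.
rewrite (IH (fun A B => f A (y :: B))) => [|A A' B B' PA PB]; last first.
  by apply: fP => //; rewrite perm_cons.
rewrite /= ?map_cat !big_cat !big_map /=.
have sw (l : seq T) : perm_eq [:: y, x & l] [:: x, y & l].
  by rewrite -[y :: _]cat1s -[[:: x, y & l]]cat1s -[x :: l]cat1s -[y :: l]cat1s perm_catCA.
rewrite !addrA; congr (_ + _); last by apply: eq_bigr => p _; apply: fP.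
by rewrite addrAC; congr (_ + _ + _); apply: eq_bigr => p _; apply: fP.
Qed.

Lemma sum_splits_perm (V : nmodType) (T : eqType) (f : seq T -> seq T -> V) s s' :
  (forall A A' B B', perm_eq A A' -> perm_eq B B' -> f A B = f A' B') -> perm_eq s s' ->
  \sum_(p <- splits s) f p.1 p.2 = \sum_(p <- splits s') f p.1 p.2.
Proof.
elim: s s' f => [|x s IH] s' f fP P; first by move: P; rewrite perm_sym => /perm_nilP ->.
have xs : x \in s' by rewrite -(perm_mem P) inE eqxx.
case/splitPr: xs P => s1 s2; rewrite -[x :: s2]cat1s perm_sym perm_catCA perm_sym perm_cons cat1s => P.
rewrite sum_splits_insert //= !big_cat !big_map /=; congr (_ + _).
  by apply: (IH _ (fun A B => f (x :: A) B)) P => A A' B B' PA PB; apply: fP => //; rewrite perm_cons.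
by apply: (IH _ (fun A B => f A (x :: B))) P => A A' B B' PA PB; apply: fP => //; rewrite perm_cons.
Qed.
End Homogeneity.

(** * Numerators of elements of the algebra *)

Lemma far_nodes c j : (c < j)%N ->
  [/\ (c.+1 == j.+1) = false, (j.+2 == c) = false, (c == j.+1) = false & (j.+1 == c) = false].
Proof. by move=> h; split; lia. Qed.

Lemma next_node j : [/\ (j.+2 == j) = false, (j == j.+1) = false & (j.+1 == j) = false].
Proof. by split; lia. Qed.

Section NumeratorFunctions.
Variables (m : nat) (A : algType C) (e : 'I_m -> nat -> A) (Psi : A -> Wfam m).
Hypotheses (eY : Yrel m A e) (hPsi : Psi_hom m A e Psi) (hbij : Psi_bij m A Psi).
Notation elt := (nat * C)%type.
Notation gen := (nat * nat * nat)%type.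
Implicit Types (L : seq elt) (a b : A).

Definition N a : seq elt -> C := num (Psi a).

Lemma Psi_sym a K : Defs.is_sym m K (Psi a K).
Proof. by case: hbij => /(_ a) [_ h] _ _; case: (h K). Qed.

Lemma Psi_wheel a K : wheel m K (Psi a K).
Proof. by case: hbij => /(_ a) [_ h] _ _; case: (h K). Qed.

Lemma ND a b L : N (a + b) L = N a L + N b L.
Proof.
case: hPsi => hD _ _ _ _; rewrite /N /num; case: ifP => _; last by rewrite addr0.
by rewrite hD /evalK mevalD.
Qed.

Lemma NZ c a L : N (c *: a) L = c * N a L.
Proof.
case: hPsi => _ hZ _ _ _; rewrite /N /num; case: ifP => _; last by rewrite mulr0.
by rewrite hZ /evalK mevalZ.
Qed.

Lemma N0 L : N 0 L = 0.
Proof. by rewrite -(scale0r (0 : A)) NZ mul0r. Qed.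

Lemma N_sum (I : Type) (r : seq I) (P : pred I) (F : I -> A) L :
  N (\sum_(i <- r | P i) F i) L = \sum_(i <- r | P i) N (F i) L.
Proof.
elim: r => [|i r IH]; first by rewrite !big_nil N0.
by rewrite !big_cons; case: ifP => _ //; rewrite ND IH.
Qed.

Lemma NN a L : N (- a) L = - N a L.
Proof. by rewrite -scaleN1r NZ mulN1r. Qed.

Lemma N_eq0 a : (forall L, N a L = 0) -> a = 0.
Proof.
move=> h; case: hbij => _ inj _; apply: inj => K.
have -> : Psi a K = 0 by exact: (num_eq0 (@Psi_sym a) h).
by have -> : Psi 0 K = 0 by exact: (num_eq0 (@Psi_sym 0) N0).
Qed.

Lemma lsym_N a : lsym (N a). Proof. exact: num_sym (@Psi_sym a). Qed.

Lemma wheel_N a : wheel1 (N a). Proof. exact: num_wheel (@Psi_wheel a). Qed.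

Lemma N_col a L : ~~ all (fun x : elt => (x.1 < m)%N) L -> N a L = 0.
Proof. exact: num_col. Qed.

Lemma N_bounded a : exists n, forall L, (n < size L)%N -> N a L = 0.
Proof. by case: hbij => /(_ a) [[B h] _] _ _; exists (m * B)%N; exact: num_bounded. Qed.

Lemma lpoly_N a : lpoly (@anyR C) (N a).
Proof. by apply: lpoly_num => //; exact: subring_any. Qed.

Lemma N1 L : N 1 L = lone L.
Proof.
case: hPsi => _ _ h1 _ _; rewrite /N /num; case: ifP => oL; last by case: L oL.
rewrite h1; case: eqP => [E|E].
  rewrite /evalK meval1; suff -> : L = [::] by [].
  apply/eqP; rewrite -size_eq0 (size_degL oL) E big1 // => i _; by rewrite ffunE.
rewrite /evalK meval0; case: L oL E => // _ []; apply/ffunP => i; by rewrite !ffunE.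
Qed.

Lemma Ne i r L : N (e i r) L = @eps C (nat_of_ord i, nat_of_ord i, r) L.
Proof.
case: hPsi => _ _ _ _ he; rewrite /N /num /eps /roots subSnn subnn expr0 mul1r.
have perm1 : perm_eq (unzip1 L) [:: (i : nat)] = (unzip1 L == [:: (i : nat)]).
  apply/idP/eqP => [|->//] h; exact: perm_small_eq h.
rewrite perm1; case: (okL m L) / idP => oL; last first.
  case: eqP => // E; case: oL; have : all (fun c => c < m)%N (unzip1 L) by rewrite E /= ltn_ord.
  by rewrite all_map.
have [h1 h2] := he i r (degL m L).
case: eqP => E.
  case: L E {oL perm1} h1 h2 => [|[c x] [|]] //= [->] h1 _.
  rewrite h1; first by rewrite /ptL /colv /= eqxx big_seq1 /= eqxx.
  apply/ffunP => j; rewrite !ffunE /colv /= -val_eqE [_ == i :> nat]eq_sym /=; by case: ifP.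
rewrite h2 ?/evalK ?meval0 // => D; case: E.
have sL : size L = 1%N.
  rewrite (size_degL oL) D (bigD1 i) //= ffunE eqxx big1 // => j ji; by rewrite ffunE (negPf ji).
case: L sL D {oL perm1 h1 h2} => [|[c x] []] //= _ D; congr [:: _].
have := congr1 (fun d : degree m => d i) D; rewrite !ffunE eqxx /colv /=; by case: eqP.
Qed.

(** The product formula is given at distinct points only; statements about all lists are recovered
    by density. *)
Lemma NM a b L : uniq (unzip2 L) -> N (a * b) L = op (@om1 C) (N a) (N b) L.
Proof.
move=> uL; have [oL|oL] := boolP (okL m L); last first.
  rewrite N_col // op_splits big_seq big1 // => p /splits_perm pL.
  move: oL; rewrite /okL (perm_all _ pL) all_cat negb_and => /orP[] h.
    by rewrite (N_col _ h) !mul0r.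
  by rewrite (N_col _ h) mulr0 mul0r.
apply: num_op => //; first exact: Psi_sym.
- exact: Psi_sym.
- exact: Psi_sym.
- by case: hPsi => _ _ _ h _; apply: h; exact: injpt_self.
Qed.

Lemma perm_eps (b : gen) L L' : perm_eq L L' -> @eps C b L = eps b L'.
Proof. by case: b => -[i j] r P; rewrite /eps (perm_big _ P) (permPl (perm_map fst P)). Qed.

Lemma sum_splits_swap (f : seq elt -> seq elt -> C) L :
  \sum_(p <- splits L) f p.1 p.2 = \sum_(p <- splits L) f p.2 p.1.
Proof.
elim: L f => [|x L IH] f; first by rewrite !big_seq1.
rewrite /= !big_cat !big_map /= addrC.
by rewrite (IH (fun B B' => f B (x :: B'))) (IH (fun B B' => f (x :: B) B')).
Qed.

(** The point [t] of colour [j+1] interacts only with the point [x] of colour [j]. The two orders of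
    multiplication give [om1] the values [x - t - 1/2] and [x - t + 1/2], whose difference -1 is the
    sign built into [eps]. *)
Lemma N_eroot_step (i j : nat) r (x y : A) L : (i <= j)%N -> uniq (unzip2 L) ->
  (forall L, uniq (unzip2 L) -> N x L = @eps C (i, j, r) L) -> (forall L, N y L = @eps C (j.+1, j.+1, 0%N) L) ->
  N (commr x y) L = @eps C (i, j.+1, r) L.
Proof.
move=> ij uL Nx Ny; rewrite /commr ND NN !NM // !op_splits.
rewrite (sum_splits_swap (fun B B' => N y B * N x B' * weight (@om1 C) B B')) -sumrB.
pose f (B B' : seq elt) : C := - (@eps C (i, j, r) B * @eps C (j.+1, j.+1, 0%N) B').
transitivity (\sum_(p <- splits L) f p.1 p.2).
  rewrite big_seq [RHS]big_seq; apply: eq_bigr => p pL.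
  have [u1 u2 u12] := splits_uniq2 uL pL; rewrite Ny Nx //.
  rewrite /f [eps (j.+1, _, _) _ * _]mulrC -mulrBr.
  have [->|X0] := eqVneq (eps (i, j, r) p.1) 0; first by rewrite !mul0r oppr0.
  have [->|Y0] := eqVneq (eps (j.+1, j.+1, 0%N) p.2) 0; first by rewrite !mulr0 mul0r oppr0.
  rewrite -[RHS]mulrN1; congr (_ * _).
  have P1 : perm_eq (unzip1 p.1) (roots i j) by move: X0; rewrite /eps; case: ifP => //; rewrite eqxx.
  have P2 : perm_eq (unzip1 p.2) (roots j.+1 j.+1) by move: Y0; rewrite /eps; case: ifP => //; rewrite eqxx.
  have [t E2] : exists t, p.2 = [:: (j.+1, t)].
    move: P2; rewrite /roots subSnn; case: (p.2) => [|[c t] [|? ?]] /= P; try by have := perm_size P.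
    by exists t; have := perm_mem P c; rewrite !inE eqxx => /esym/eqP ->.
  have [jx jxL] : exists jx, (j, jx) \in p.1.
    have : j \in unzip1 p.1 by rewrite (perm_mem P1) mem_roots // ij leqnn.
    by case/mapP=> -[c z] cz ->; exists z.
  have jt : jx - t != 0 by rewrite subr_eq0; apply: (u12 _ (j.+1, t)) jxL _; rewrite E2 inE.
  have other (c : elt) : c \in rem (j, jx) p.1 -> @om1 C c (j.+1, t) = 1 /\ @om1 C (j.+1, t) c = 1.
    move=> cL; have cj : (c.1 < j)%N.
      have : c.1 \in roots i j by rewrite -(perm_mem P1); apply/map_f/mem_rem/cL.
      rewrite mem_roots // [(c.1 <= j)%N]leq_eqVlt => /andP[_ /orP[/eqP ce|//]].
      have : uniq (unzip1 p.1) by rewrite (perm_uniq P1) iota_uniq.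
      rewrite (perm_uniq (perm_map fst (perm_to_rem jxL))) /= => /andP[/negP []].
      by have := map_f fst cL; rewrite /= ce.
    rewrite /om1 /om0 /cross /cart /adj /=.
    have [-> -> -> ->] := far_nodes cj.
    by rewrite /= !mul0r addr0 !mulr1.
  have w1 : weight (@om1 C) p.1 p.2 = @om1 C (j, jx) (j.+1, t).
    rewrite /weight E2 (perm_big _ (perm_to_rem jxL)) big_cons big_seq1 big_seq big1 => [|c /other [oc _]]; last by rewrite big_seq1.
    exact: mulr1.
  have w2 : weight (@om1 C) p.2 p.1 = @om1 C (j.+1, t) (j, jx).
    rewrite /weight E2 big_seq1 (perm_big _ (perm_to_rem jxL)) big_cons big_seq big1 => [|c /other [_ oc]//].
    exact: mulr1.
  rewrite w1 w2 /om1 /om0 /cross /cart /adj /= !eqxx.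
  have [-> -> ->] := next_node j.
  have tj : t - jx != 0 by rewrite -opprB oppr_eq0.
  by rewrite /=; field; rewrite tj jt.
have fP B1 B1' B2 B2' : perm_eq B1 B1' -> perm_eq B2 B2' -> f B1 B2 = f B1' B2'.
  by move=> PA PB; rewrite /f (perm_eps _ PA) (perm_eps _ PB).
have [P|P] := boolP (perm_eq (unzip1 L) (roots i j.+1)); last first.
  rewrite big_seq big1 => [|p pL].
    by rewrite /eps ifN.
  apply/eqP; rewrite /f oppr_eq0; apply: contraR P.
  rewrite mulf_eq0 negb_or {1 2}/eps => /andP[]; case: ifP => [P1 _|]; last by rewrite eqxx.
  case: ifP => [P2 _|]; last by rewrite eqxx.
  rewrite (permPl (perm_map fst (splits_perm pL))) map_cat (permPl (perm_cat P1 P2)).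
  rewrite /roots subSnn; have -> : (j.+2 - i = (j.+1 - i) + 1)%N by lia.
  by rewrite iotaD subnKC // leqW.
have : j.+1 \in unzip1 L by rewrite (perm_mem P) mem_roots ?leqnn ?leqW.
case/mapP=> -[c t] cL /= jc; subst c.
pose L' := rem (j.+1, t) L.
have PL : perm_eq L ((j.+1, t) :: L') by exact: perm_to_rem.
have PL' : perm_eq (unzip1 L') (roots i j).
  move: P; rewrite (permPl (perm_map fst PL)) /= /roots.
  have -> : (j.+2 - i = (j.+1 - i) + 1)%N by lia.
  rewrite iotaD subnKC ?leqW //= cats1 perm_sym (permPl (permEl (perm_rcons _ _))) perm_cons.
  by rewrite perm_sym.
rewrite (sum_splits_perm fP PL).
rewrite -[RHS]/(@eps C (i, j.+1, r) L) (perm_eps _ PL) /= big_cat !big_map /=.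
rewrite big1 ?add0r => [|p _]; last first.
  rewrite /f {1}/eps; case: ifP => [Q|_]; last by rewrite mul0r oppr0.
  have : j.+1 \in roots i j by rewrite -(perm_mem Q) /= inE eqxx.
  by rewrite mem_roots // ltnn andbF.
(* The point of colour [j+1] is alone in the right part, so the others form a product with the unit
   [lone]; the weights have already been used up. *)
transitivity (- op (fun _ _ => 1) (@eps C (i, j, r)) (@lone C) L').
  rewrite op_splits -sumrN; apply: eq_bigr => p _; rewrite /f; congr (- (_)).
  rewrite /weight big1 ?mulr1; last by move=> a _; rewrite big1.
  congr (_ * _); rewrite /eps /roots subSnn /=; case: (p.2) => [|d B] /=.
    by rewrite perm_refl subnn expr0 big_seq1 mul1r; case: ifP; rewrite ?expr0.
  by rewrite ifN //; apply/negP => /perm_size.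
rewrite op1r /eps PL' /=.
have -> : perm_eq (j.+1 :: unzip1 L') (roots i j.+1) by rewrite -(permPl (perm_map fst PL)).
rewrite big_cons /= ifF ?mul1r; last by lia.
by rewrite subSn // exprS mulN1r mulNr.
Qed.

Lemma N_eroot (i j : 'I_m) r L : (i <= j)%N -> uniq (unzip2 L) ->
  N (eroot m A e i j r) L = @eps C (nat_of_ord i, nat_of_ord j, r) L.
Proof.
have [n] := ubnP (j - i)%N; elim: n j L => // n IH j L jn ij uL.
have [ji|ji] := eqVneq i j; first by subst j; rewrite eroot_self Ne.
have jm : (j.-1 < m)%N by apply: leq_ltn_trans (ltn_ord j); exact: leq_pred.
have ij' : (i < j)%N by rewrite ltn_neqAle ij andbT val_eqE.
pose p := Ordinal jm; have jp : j = p.+1 :> nat by rewrite /= prednK // (leq_ltn_trans _ ij').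
have ip : (i <= p)%N by rewrite -ltnS -jp.
rewrite (@eroot_step m A e i j p r ip jp) jp; apply: N_eroot_step => // [L' uL'|L'].
  by apply: IH => //; move: jn jp ij'; rewrite /=; lia.
by rewrite Ne jp.
Qed.
End NumeratorFunctions.

Lemma cfac_nseq k b (s : seq (nat * nat * nat)) : b \notin s -> cfac (nseq k b ++ s) = (k`! * cfac s)%N.
Proof.
move=> bs; elim: k => [|k IH] /=; first by rewrite mul1n.
by rewrite IH count_cat count_nseq (count_memPn bs) /= eqxx mul1n addn0 factS mulnA.
Qed.

(** * Leading terms of the ordered products *)

Section LeadingTerms.
Variables (m : nat) (A : algType C) (e : 'I_m -> nat -> A) (Psi : A -> Wfam m).
Hypotheses (eY : Yrel m A e) (hPsi : Psi_hom m A e Psi) (hbij : Psi_bij m A Psi).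
Notation elt := (nat * C)%type.
Notation gen := (nat * nat * nat)%type.
Notation root := ('I_m * 'I_m * nat)%type.
Implicit Types (L : seq elt) (a : A) (b : root) (s : seq gen).
Local Notation N := (N Psi).

Definition genn b : gen := (nat_of_ord b.1.1, nat_of_ord b.1.2, b.2).

Lemma genn_inj : injective genn.
Proof. by move=> [[i j] r] [[i' j'] r'] [/val_inj -> /val_inj -> ->]. Qed.

Definition rootvec b := eroot m A e b.1.1 b.1.2 b.2.

Definition gens_of (G : seq root) (h : root -> nat) : seq gen := flatten [seq nseq (h b) (genn b) | b <- G].

Lemma mem_gens_of G h x : x \in gens_of G h -> exists2 b, b \in G & x = genn b.
Proof.
by case/flatten_mapP=> b bG; rewrite mem_nseq => /andP[_ /eqP ->]; exists b.
Qed.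

Lemma count_gens_of G h b : uniq G -> count_mem (genn b) (gens_of G h) = if b \in G then h b else 0%N.
Proof.
elim: G => //= d G IH /andP[dG uG]; rewrite /gens_of /= count_cat count_nseq /= -/(gens_of G h) IH // inE.
rewrite (inj_eq genn_inj) [d == b]eq_sym; have [->|_] := eqVneq b d; last by rewrite mul0n.
by rewrite (negPf dG) mul1n addn0.
Qed.

Lemma lead_rootvec_pow k b s y c : (b.1.1 <= b.1.2)%N -> lead (wt s) (N y) (fun L => c * epsprod s L) ->
  lead (wt (nseq k (genn b) ++ s)) (N (rootvec b ^+ k * y)) (fun L => c * epsprod (nseq k (genn b) ++ s) L).
Proof.
move=> ij ly; elim: k => [|k IH] /=; first by rewrite expr0 mul1r.
have H : lead (wt (genn b :: nseq k (genn b) ++ s)) (N (rootvec b ^+ k.+1 * y))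
    (op (@om0 C) (eps (genn b)) (fun L => c * epsprod (nseq k (genn b) ++ s) L)).
  rewrite /wt big_cons -/(wt _).
  apply: lead_eq (lead_op (lead_eps b.2 ij) IH) => L uL.
  rewrite exprS -mulrA (NM hPsi hbij) // !op_splits big_seq [RHS]big_seq; apply: eq_bigr => p pL.
  by have [u1 _ _] := splits_uniq2 uL pL; rewrite (N_eroot hPsi hbij).
by move=> L uL; have [q q0 qE] := H L uL; exists q => //; rewrite q0 opZr.
Qed.

Lemma lead_gens_of G h : uniq G -> all (fun b => b.1.1 <= b.1.2)%N G ->
  lead (wt (gens_of G h)) (N (\prod_(b <- G) dpow (h b) (rootvec b))) (@mono C (gens_of G h)).
Proof.
move=> uG gG; rewrite /mono; elim: G uG gG => [_ _|b G IH /= /andP[bG uG] /andP[gb gG]].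
  rewrite /wt !big_nil /= => L uL; have [q q0 qE] := lead_lone uL; exists q; first by rewrite q0 invr1 mul1r.
  by move=> s s0; rewrite qE // (N1 hPsi).
have nb : genn b \notin gens_of G h by apply/negP => /mem_gens_of[d dG /genn_inj E]; rewrite E dG in bG.
rewrite big_cons /gens_of /= -/(gens_of G h) cfac_nseq // natrM invfM.
rewrite /dpow -scalerAl => L uL.
have [q q0 qE] := lead_scale ((h b)`!%:R^-1 : C) (lead_rootvec_pow (h b) gb (IH uG gG)) uL.
exists q; first by rewrite q0 mulrA.
by move=> s s0; rewrite qE // (NZ hPsi).
Qed.

Definition rootidx R : seq root :=
  [seq (p, r) | p <- [seq (i, j) | i : 'I_m <- enum 'I_m, j : 'I_m <- [seq j : 'I_m <- enum 'I_m | (i <= j)%N]], r <- rev (iota 0 R)].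

Lemma uniq_rootidx R : uniq (rootidx R).
Proof.
apply: allpairs_uniq; last by move=> [? ?] [? ?].
  apply: allpairs_uniq_dep; first exact: enum_uniq.
    by move=> i _; rewrite filter_uniq ?enum_uniq.
  by move=> [i j] [i' j'] _ _ /= [-> ->].
by rewrite rev_uniq iota_uniq.
Qed.

Lemma mem_rootidx R b : (b \in rootidx R) = ((b.1.1 <= b.1.2) && (b.2 < R))%N.
Proof.
apply/idP/idP => [/allpairsP[[p r] /= [/allpairsPdep[i [j [_ ]]]]]|].
  by rewrite mem_filter => /andP[ij _] -> /=; rewrite mem_rev mem_iota => /andP[_ rR] -> /=; rewrite ij.
case/andP=> ij rR; apply/allpairsP; exists b; split; last by case: b ij rR.
  apply/allpairsPdep; exists b.1.1, b.1.2; split; last by case: (b.1).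
    exact: mem_enum.
  by rewrite mem_filter ij mem_enum.
by rewrite mem_rev mem_iota.
Qed.

Lemma Eh_rootidx R h : Eh m A e R h = \prod_(b <- rootidx R) dpow (h b.1.1 b.1.2 b.2) (rootvec b).
Proof.
rewrite /Eh /rootidx big_allpairs_dep big_allpairs_dep; apply: eq_bigr => i _.
by rewrite big_filter.
Qed.

Definition elist R (h : 'I_m -> 'I_m -> nat -> nat) := gens_of (rootidx R) (fun b => h b.1.1 b.1.2 b.2).

Lemma lead_Eh R h : lead (wt (elist R h)) (N (Eh m A e R h)) (@mono C (elist R h)).
Proof.
rewrite Eh_rootidx; apply: lead_gens_of; first exact: uniq_rootidx.
by apply/allP => b; rewrite mem_rootidx => /andP[].
Qed.

Lemma elist_all R h : all (fun x : gen => x.1 \in rootlist m) (elist R h).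
Proof.
apply/allP => x /mem_gens_of[b]; rewrite mem_rootidx => /andP[ij _] ->.
by rewrite mem_rootlist /= ij ltn_ord.
Qed.

Lemma elist_inj R h h' : admissible m R h -> admissible m R h' -> perm_eq (elist R h) (elist R h') -> h = h'.
Proof.
move=> [h1 h2] [h1' h2'] P; have E i j r : h i j r = h' i j r.
  have [ij|ij] := leqP i j; last by rewrite h1 // h1'.
  have [rR|rR] := leqP R r; first by rewrite h2 // h2'.
  have := seq.permP P (pred1 (genn (i, j, r))); rewrite !count_gens_of ?uniq_rootidx // !mem_rootidx /= ij rR.
  done.
do 3!(apply: functional_extensionality => ?); exact: E.
Qed.

(** Converts a multiset of generators back into an exponent function, inverse to [elist]. The weight
    exceeds every exponent [r] that occurs, so [wt s <= R] gives admissibility. *)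
Definition hcnt s (i j : 'I_m) r := if (i <= j)%N then count_mem (genn (i, j, r)) s else 0%N.

Lemma wt_mem x s : x \in s -> (x.2 < wt s)%N.
Proof.
elim: s => // y s IH; rewrite /wt big_cons -/(wt s) inE => /orP[/eqP ->|/IH h]; first exact: leq_addr.
exact: leq_trans h (leq_addl _ _).
Qed.

Lemma hcnt_admissible R s : (wt s <= R)%N -> admissible m R (hcnt s).
Proof.
move=> sR; split=> i j r h; rewrite /hcnt; first by rewrite leqNgt h.
case: ifP => // _; apply/count_memPn/negP => /wt_mem /=; lia.
Qed.

Lemma elist_hcnt R s : (wt s <= R)%N -> all (fun x : gen => x.1 \in rootlist m) s -> perm_eq (elist R (hcnt s)) s.
Proof.
move=> sR /allP gs; apply/allP => x _ /=; apply/eqP.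
have [xs|xs] := boolP (x \in [seq genn b | b <- rootidx R]).
  case/mapP: xs => b bG ->; rewrite count_gens_of ?uniq_rootidx // bG /hcnt.
  by move: bG; rewrite mem_rootidx => /andP[-> _]; case: b => -[].
rewrite !(count_memPn _) //; apply: contra xs.
  move=> xs; have := gs _ xs; case: x xs => -[i j] r xs; rewrite mem_rootlist /= => /andP[ij jm].
  apply/mapP; exists (Ordinal (leq_ltn_trans ij jm), Ordinal jm, r) => //.
  by rewrite mem_rootidx /= ij (leq_trans (wt_mem xs)).
by move=> /mem_gens_of[b bG ->]; exact: map_f.
Qed.

Lemma wt_perm s s' : perm_eq s s' -> wt s = wt s'. Proof. exact: perm_big. Qed.

Lemma lead_Ehcnt R s : (wt s <= R)%N -> all (fun x : gen => x.1 \in rootlist m) s ->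
  lead (wt s) (N (Eh m A e R (hcnt s))) (@mono C s).
Proof.
move=> sR gs L uL; have P := elist_hcnt sR gs.
have [q q0 qE] := lead_Eh R (hcnt s) uL; exists q; first by rewrite q0 (perm_mono P).
by rewrite -(wt_perm P).
Qed.

Lemma op_support (om : elt -> elt -> C) (F G : seq elt -> C) w w' :
  (forall L, ~~ perm_eq (unzip1 L) w -> F L = 0) -> (forall L, ~~ perm_eq (unzip1 L) w' -> G L = 0) ->
  forall L, ~~ perm_eq (unzip1 L) (w ++ w') -> op om F G L = 0.
Proof.
move=> hF hG L hL; rewrite op_splits big_seq big1 // => p pL.
have [P1|P1] := boolP (perm_eq (unzip1 p.1) w); last by rewrite hF // !mul0r.
have [P2|P2] := boolP (perm_eq (unzip1 p.2) w'); last by rewrite hG // mulr0 mul0r.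
case/negP: hL; rewrite (permPl (perm_map fst (splits_perm pL))) map_cat.
exact: perm_cat.
Qed.

Lemma eps_support (i : nat) r L : ~~ perm_eq (unzip1 L) [:: i] -> @eps C (i, i, r) L = 0.
Proof. by move=> h; rewrite /eps /roots subSnn /= (negPf h). Qed.

Lemma adjn_nseq k i : adjn (nseq k i) = 0%N.
Proof.
elim: k => //= k ->; rewrite addn0 big1_seq // => c /andP[_]; rewrite mem_nseq => /andP[_ /eqP ->].
by rewrite adjnn.
Qed.

(** Points of one colour have weight 1 and each factor takes exactly one of them, so the sum counts
    orderings. *)
Lemma epsprod_nseq k i L : unzip1 L = nseq k i -> epsprod (nseq k (i, i, 0%N)) L = k`!%:R :> C.
Proof.
elim: k L => [|k IH] L; first by case: L.
move=> cL /=.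
have /eqP := congr1 size cL; rewrite size_map size_nseq => /eqP sL.
rewrite op_splits.
have E : forall n L, unzip1 L = nseq n i ->
  \sum_(p <- splits L) (if size p.1 == 1%N then 1 else 0) = n%:R :> C.
  elim=> [|n IHn] [|[c x] L'] //=; first by rewrite big_seq1.
  move=> [-> cL']; rewrite big_cat !big_map /= IHn // -nat1r; congr (_ + _).
  elim: (L') => [|y L2 IH2]; first by rewrite big_seq1.
  by rewrite /= big_cat !big_map /= IH2 big1 ?add0r // => p _.
rewrite factS natrM -(E _ _ cL) mulr_suml big_seq [RHS]big_seq; apply: eq_bigr => p pL.
have P : perm_eq (nseq k.+1 i) (unzip1 p.1 ++ unzip1 p.2).
  by rewrite -map_cat -cL; apply/perm_map/splits_perm.
have mem1 c : c \in unzip1 p.1 ++ unzip1 p.2 -> c = i.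
  by rewrite -(perm_mem P) mem_nseq => /andP[_ /eqP].
have n1 : unzip1 p.1 = nseq (size p.1) i.
  rewrite -(size_map fst); apply/all_pred1P/allP => c cp /=; apply/eqP/mem1; by rewrite mem_cat cp.
have n2 : unzip1 p.2 = nseq (size p.2) i.
  rewrite -(size_map fst); apply/all_pred1P/allP => c cp /=; apply/eqP/mem1; by rewrite mem_cat cp orbT.
case: eqP => s1; last first.
  rewrite eps_support ?mul0r //; apply/negP => /perm_size; by rewrite size_map.
have s2 : size p.2 = k by have := perm_size P; rewrite size_cat !size_map size_nseq s1 => -[->].
rewrite IH -?s2 // mul1r {1}/eps /roots subSnn n1 s1 /= perm_refl subnn expr0 mul1r.
rewrite big1 ?mul1r => [|a _]; last by case: ifP; rewrite ?expr0.
rewrite /weight big1_seq ?mulr1 // => a /andP[_ ap]; rewrite big1_seq // => c /andP[_ cp].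
have ai : a.1 = i by apply: mem1; rewrite mem_cat (map_f fst ap).
have ci : c.1 = i by apply: mem1; rewrite mem_cat (map_f fst cp) orbT.
by rewrite /om0 /cross ai ci (gtn_eqF (ltnSn i)) mulr1.
Qed.

Lemma expr_support (i : 'I_m) r k L : uniq (unzip2 L) -> ~~ perm_eq (unzip1 L) (nseq k (nat_of_ord i)) -> N (e i r ^+ k) L = 0.
Proof.
elim: k L => [|k IH] L uL hL; first by rewrite expr0 (N1 hPsi); case: L hL {uL}.
pose F k L := if uniq (unzip2 L) then N (e i r ^+ k) L else 0.
rewrite exprS (NM hPsi hbij) //.
transitivity (op (@om1 C) (@eps C (nat_of_ord i, nat_of_ord i, r)) (F k) L).
  rewrite !op_splits big_seq [RHS]big_seq; apply: eq_bigr => p pL.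
  by have [u1 u2 _] := splits_uniq2 uL pL; rewrite /F u2 (Ne hPsi).
apply: (@op_support _ _ _ [:: nat_of_ord i] (nseq k (nat_of_ord i))) => //.
- by move=> L'; exact: eps_support.
- by move=> L' hL'; rewrite /F; case: ifP => // u; exact: IH.
Qed.

(** For [k] points of one colour the weight [k] equals the size and [adjn] is 0, so the numerator
    has degree at most 0. It is thus constant and equal to its top component [k!]; the
    symmetrization of rational factors is never computed. *)
Lemma expr0_closed (i : 'I_m) k L : uniq (unzip2 L) ->
  N (e i 0%N ^+ k) L = if unzip1 L == nseq k (nat_of_ord i) then k`!%:R else 0.
Proof.
move=> uL; case: eqP => [E|E]; last first.
  apply: expr_support => //; apply/negP => P; case: E.
  have /all_pred1P : all (pred1 (nat_of_ord i)) (unzip1 L).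
    by rewrite (perm_all _ P); apply/all_pred1P; rewrite size_nseq.
  by rewrite (perm_size P) size_nseq.
have Sa := subring_any C.
have lF : lead k (N (e i 0%N ^+ k)) (epsprod (nseq k (nat_of_ord i, nat_of_ord i, 0%N))).
  have W : wt (nseq k (nat_of_ord i, nat_of_ord i, 0%N)) = k.
    by elim: (k) => [|k' IH]; rewrite /wt ?big_nil //= big_cons -/(wt _) IH.
  have := @lead_rootvec_pow k (i, i, 0%N) [::] 1 1 (leqnn _); rewrite cats0 /= W mulr1 /rootvec eroot_self => H.
  move=> L' uL'; have [|q q0 qE] := H _ L' uL'.
    move=> L2 uL2; have [q q0 qE] := lead_lone uL2; exists q; first by rewrite q0 mul1r.
    by move=> t t0; rewrite /wt big_nil qE // (N1 hPsi).
  by exists q => //; rewrite q0 mul1r.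
have PT : lpoly (@anyR C) (epsprod (nseq k (nat_of_ord i, nat_of_ord i, 0%N))).
  elim: (k) => [|k' IH] /=; first exact: lpoly_lone.
  by apply: lpoly_op => //; [move=> a c; exact: polyfn_om0|exact: lpoly_eps].
have sL : size L = k by have := congr1 size E; rewrite size_map size_nseq.
have aL : adjn (unzip1 L) = 0%N by rewrite E adjn_nseq.
have PN := lpoly_N Psi (e i 0%N ^+ k).
have dil1 : dil 1 L = L by rewrite /dil -[RHS]map_id; apply: eq_map => -[c x]; rewrite /= mul1r.
have H : hpoly (N (e i 0%N ^+ k)) L = (k`!%:R)%:P.
  apply/polyP => d; have := lead_hc (k := d) (L := L) Sa PN PT lF; rewrite /hc aL sL addn0 coefC => -> //.
    by rewrite -{2}(add0n k) eqn_add2r (epsprod_nseq E).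
  exact: leq_addl.
by rewrite -{1}dil1 (hpolyE _ _ PN) H hornerC.
Qed.

(** [e i r] is [e i 0] twisted by the character taking the [r]-th power of each position, and the
    product respects such twists. *)
Lemma expr_char (i : 'I_m) r k L : uniq (unzip2 L) ->
  N (e i r ^+ k) L = N (e i 0%N ^+ k) L * \prod_(a <- L) a.2 ^+ r.
Proof.
elim: k L => [|k IH] L uL.
  by rewrite !expr0 !(N1 hPsi); case: L {uL} => [|x L] /=; rewrite ?mul0r // big_nil mulr1.
rewrite !exprS !(NM hPsi hbij) // -op_mulchar !op_splits big_seq [RHS]big_seq; apply: eq_bigr => p pL.
have [u1 u2 _] := splits_uniq2 uL pL; rewrite IH // !(Ne hPsi); congr (_ * _ * _).
have [P|P] := boolP (perm_eq (unzip1 p.1) [:: nat_of_ord i]); last by rewrite !eps_support // mul0r.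
rewrite /eps /roots subSnn /= P subnn expr0 !mul1r; case: (p.1) P => [|[c x] [|? ?]] P; try by have := perm_size P.
by rewrite !big_seq1 /=; have := perm_mem P c; rewrite !inE eqxx /= => /esym ->; rewrite expr0 mul1r.
Qed.

Lemma lpoly_divided (i : 'I_m) r k : lpoly dyadic (N (dpow k (e i r))).
Proof.
have Sd := subring_dyadic.
pose F L := (if unzip1 L == nseq k (nat_of_ord i) then 1 else 0) * \prod_(a <- L) a.2 ^+ r : C.
have PF S : subringP S -> lpoly S F.
  move=> SS l; apply: polyfn_mul.
    apply: (@polyfn_ext _ _ (fun=> if unzip1 l == nseq k (nat_of_ord i) then 1 else 0)) => [v|].
      by rewrite /unzip1 /inst -map_comp.
    by apply: polyfn_cst; case: eqP => _; [exact: subring1|exact: subring0].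
  apply: (@polyfn_ext _ _ (fun v => \prod_(c <- l) v c.2 ^+ r)) => [v|]; first by rewrite big_map.
  by apply: polyfn_prod => // c _ _; apply: polyfn_expr => //; exact: polyfn_var.
have E L : N (dpow k (e i r)) L = F L.
  apply/eqP; rewrite -subr_eq0; apply/eqP; move: L.
  apply: (@list_density _ (@anyR C)); first by apply: lpoly_sub => //; [exact: lpoly_N|exact: PF].
  move=> L uL; rewrite /dpow (NZ hPsi) expr_char // expr0_closed // /F; case: eqP => _.
    by rewrite mulrA mulVf ?fact_neq0 // subrr.
  by rewrite !mul0r mulr0 subrr.
by move=> l; apply: (@polyfn_ext _ _ _ _ _ (PF _ Sd l)) => v; rewrite E.
Qed.

Lemma Ybold_lpoly a : Ybold m A e a -> lpoly dyadic (N a).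
Proof.
have Sd := subring_dyadic.
elim=> [i r k||x y _ IHx _ IHy|x _ IHx|x y _ IHx _ IHy|x _ IHx].
- exact: lpoly_divided.
- by move=> l; apply: (@polyfn_ext _ _ _ _ _ (lpoly_lone Sd l)) => v; rewrite (N1 hPsi).
- by move=> l; apply: (@polyfn_ext _ _ _ _ _ (polyfn_add (IHx l) (IHy l))) => v; rewrite (ND hPsi).
- by move=> l; apply: (@polyfn_ext _ _ _ _ _ (polyfn_opp Sd (IHx l))) => v; rewrite (NN hPsi).
- apply: (op_integral Sd dyadic_half IHx IHy); first exact: lpoly_N.
  by move=> L uL; rewrite (NM hPsi hbij).
- by move=> l; apply: (@polyfn_ext _ _ _ _ _ (polyfn_scale dyadic_half (IHx l))) => v; rewrite (NZ hPsi).
Qed.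
End LeadingTerms.

Lemma rootlist_ordered m (s : seq (nat * nat * nat)) : all (fun b => b.1 \in rootlist m) s ->
  all (fun b => b.1.1 <= b.1.2)%N s.
Proof. by apply: sub_all => b; rewrite mem_rootlist => /andP[]. Qed.

(** * The PBW basis *)

Section PBWBasis.
Variables (m : nat) (A : algType C) (e : 'I_m -> nat -> A) (Psi : A -> Wfam m).
Hypotheses (eY : Yrel m A e) (hPsi : Psi_hom m A e Psi) (hbij : Psi_bij m A Psi).
Notation elt := (nat * C)%type.
Notation gen := (nat * nat * nat)%type.
Implicit Types (L : seq elt) (a : A) (s : seq gen) (l : seq (C * seq gen)).
Local Notation N := (N Psi).
Local Notation E R s := (Eh m A e R (hcnt (m := m) s)).

Definition sized n a := forall L, size L != n -> N a L = 0.

Lemma sized_uniq n a : (forall L, uniq (unzip2 L) -> size L != n -> N a L = 0) -> sized n a.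
Proof.
move=> h L hL; have Sa := subring_any C.
pose F L := if size L == n then 0 else N a L.
have -> : N a L = F L by rewrite /F (negPf hL).
apply: (@list_density _ (@anyR C)) => [l|L' uL'].
  apply: (@polyfn_ext _ _ (fun v => if size l == n then 0 else N a (inst v l))) => [v|].
    by rewrite /F /inst size_map.
  by case: (size l == n); [apply: polyfn_cst|exact: lpoly_N].
by rewrite /F; case: eqP => // /eqP; exact: h.
Qed.

Lemma sizedM n n' a b : sized n a -> sized n' b -> sized (n + n') (a * b).
Proof.
move=> ha hb; apply: sized_uniq => L uL sL; rewrite (NM hPsi hbij) // op_splits big_seq big1 // => p pL.
have sp := perm_size (splits_perm pL); rewrite size_cat in sp.
have [s1|/ha ->] := eqVneq (size p.1) n; last by rewrite !mul0r.
have [s2|/hb ->] := eqVneq (size p.2) n'; last by rewrite mulr0 mul0r.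
by rewrite sp s1 s2 eqxx in sL.
Qed.

Lemma sized1 : sized 0 1.
Proof. by move=> L; rewrite (N1 hPsi); case: L. Qed.

Lemma sized_dpow n a k : sized n a -> sized (k * n) (dpow k a).
Proof.
move=> ha L hL; rewrite /dpow (NZ hPsi); suff -> : N (a ^+ k) L = 0 by rewrite mulr0.
elim: k L hL => [|k IH] L hL; first by rewrite expr0 sized1.
by rewrite exprS; apply: (sizedM ha IH).
Qed.

Lemma sized_Eh R h : sized (gsize (elist R h)) (Eh m A e R h).
Proof.
rewrite Eh_rootidx /elist.
have : all (fun b : 'I_m * 'I_m * nat => b.1.1 <= b.1.2)%N (rootidx m R).
  by apply/allP => b; rewrite mem_rootidx => /andP[].
elim: (rootidx m R) => [_|b G IH /= /andP[gb gG]].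
  by rewrite big_nil /gsize big_nil; exact: sized1.
rewrite big_cons /gens_of /= -/(gens_of G _) /gsize big_cat -/(gsize (gens_of G _)) /=.
apply: sizedM; last exact: IH.
rewrite big_nseq iter_addn addn0 mulnC; apply: sized_dpow.
apply: sized_uniq => L uL hL; rewrite /rootvec (N_eroot hPsi hbij) // /eps ifN //.
by apply: contraNN hL => /perm_size; rewrite size_map size_iota => ->.
Qed.

Lemma Ybold_scale c a : dyadic c -> Ybold m A e a -> Ybold m A e (c *: a).
Proof.
move=> [k [t ->]] Ya.
have Yn n : Ybold m A e (a *+ n).
  elim: n => [|n IH]; first by rewrite mulr0n -(subrr a); apply: Yb_add => //; exact: Yb_opp.
  by rewrite mulrSr; exact: Yb_add.
have Yk : Ybold m A e (k%:~R *: a).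
  rewrite scaler_int; case: k => n; first by rewrite -pmulrn.
  by rewrite NegzE mulrNz; apply: Yb_opp; rewrite -pmulrn.
elim: t => [|t IH]; first by rewrite expr0 divr1.
by rewrite exprS invfM mulrCA -scalerA; exact: Yb_half.
Qed.

Lemma uniform_N S a : subringP S -> lpoly S (N a) -> exists d, lpolyd S d (N a).
Proof.
move=> SS PF; have [n hn] := N_bounded hbij a.
exact: (@uniform_degree _ m n _ _ SS PF hn (@N_col _ _ Psi a)).
Qed.

Lemma mono_short s L : all (fun b : gen => b.1 \in rootlist m) s -> (wt s + adjn (unzip1 L) < size L)%N ->
  mono s L = 0 :> C.
Proof. by move=> gs; apply: hom_small; [exact: lpoly_mono|exact/hom_mono/rootlist_ordered/gs]. Qed.

Lemma hc_E R s k L : (wt s <= R)%N -> all (fun b : gen => b.1 \in rootlist m) s ->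
  (wt s + adjn (unzip1 L) <= k + size L)%N ->
  hc (N (E R s)) k L = if (k + size L == wt s + adjn (unzip1 L))%N then mono s L else 0.
Proof.
move=> sR gs; have Sa := subring_any C.
exact: (lead_hc Sa (lpoly_N _ _) (lpoly_mono _ s) (lead_Ehcnt hPsi hbij sR gs)).
Qed.

(** The monomial is the top component of the numerator of an ordered product in the integral form;
    symmetry, the wheel condition and integrality are all inherited from there. *)
Lemma config_mono s : all (fun b : gen => b.1 \in rootlist m) s -> config m dyadic (@mono C s).
Proof.
move=> gs; pose y := E (wt s) s.
have PF : lpoly dyadic (N y) by exact: (Ybold_lpoly hPsi hbij (Ybold_Eh eY _ _)).
have [d Pd] := uniform_N subring_dyadic PF.
have -> : @mono C s = topc (wt s) 0 (N y).
  apply: functional_extensionality => L.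
  rewrite /topc addn0; case: leqP => h; last exact: mono_short.
  by rewrite hc_E ?subnK ?eqxx.
apply: (config_topc subring_dyadic (lsym_N hbij y) Pd (wheel_N hbij y) (@N_col _ _ Psi y)) => k L.
rewrite addn0 => lt; rewrite hc_E //; last exact: ltnW.
by rewrite gtn_eqF.
Qed.

Section Spanning.
Variables (n0 Rmax : nat).
(** Since [adjn] is at most the square of the size, this shift makes a bound of 0 mean that every
    component vanishes, so the descent on [t] can end at 0. *)
Let off := (n0 * n0)%N.

Definition below t a := forall k L, (t + adjn (unzip1 L) <= k + (size L + off))%N -> hc (N a) k L = 0.

Lemma hc_long a k L : (forall L, (n0 < size L)%N -> N a L = 0) -> (n0 < size L)%N -> hc (N a) k L = 0.
Proof.
move=> hn sL; rewrite /hc (hpoly_unique (q := 0)) ?coef0 // => t.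
by rewrite horner0 hn // size_map.
Qed.

Lemma below0 a : lpoly dyadic (N a) -> (forall L, (n0 < size L)%N -> N a L = 0) -> below 0 a -> a = 0.
Proof.
move=> PF hn h; apply: (N_eq0 hPsi hbij) => L.
have [sL|sL] := leqP (size L) n0; last exact: hn.
have h0 : hpoly (N a) L = 0.
  apply/polyP => k; rewrite coef0; apply: h; rewrite add0n.
  apply: leq_trans (adjn_le _) _; rewrite size_map /off.
  by apply: leq_trans (leq_mul sL sL) _; rewrite addnA leq_addl.
have -> : L = dil 1 L by rewrite /dil -[LHS]map_id; apply: eq_map => -[c x]; rewrite /= mul1r.
by rewrite (hpolyE _ _ PF) h0 horner0.
Qed.

Definition top_term t (cs : C * seq gen) :=
  [/\ dyadic cs.1, all (fun b : gen => b.1 \in rootlist m) cs.2, (gsize cs.2 <= n0)%N & (wt cs.2 + off = t)%N].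

(** [span_main] does not control weights. Comparing coefficients of the scaling parameter discards
    the monomials of the wrong weight. *)
Lemma topc_combo t a : lpoly dyadic (N a) -> (forall L, (n0 < size L)%N -> N a L = 0) -> below t.+1 a ->
  exists2 l, forall cs, cs \in l -> top_term t cs & forall L, topc t off (N a) L = combo l L.
Proof.
move=> PF hn ha; have Sd := subring_dyadic.
have [d Pd] := uniform_N Sd PF.
have hT : config m dyadic (topc t off (N a)).
  apply: (config_topc Sd (lsym_N hbij a) Pd (wheel_N hbij a) (@N_col _ _ Psi a)) => k L lt.
  exact: ha.
have Tn L : (n0.+1 <= size L)%N -> topc t off (N a) L = 0.
  by move=> sL; rewrite /topc hc_long //; case: ifP.
have [l lP lE] := span_main Sd config_mono (done := [::]) erefl hT Tn (fun d => ltac:(by [])).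
pose l' := [seq cs <- l | wt cs.2 + off == t]%N.
exists l' => [cs|L].
  by rewrite mem_filter => /andP[/eqP w /lP[h1 h2 h3]]; split.
have T_dil u : u != 0 -> topc t off (N a) (dil u L) * u ^+ (size L + off) = u ^+ (t + adjn (unzip1 L)) * topc t off (N a) L.
  move=> u0; rewrite /topc unzip1_dil size_map; case: leqP => h; last by rewrite mul0r mulr0.
  by rewrite (hc_dil _ _ _ PF) mulrAC -exprD subnK.
pose a0 := adjn (unzip1 L).
have P : (topc t off (N a) L) *: 'X^(t + a0) = \sum_(cs <- l) (cs.1 * mono cs.2 L) *: 'X^(wt cs.2 + off + a0) :> {poly C}.
  apply: (@poly_cofinite_eq _ [:: 0]) => u; rewrite inE => u0.
  rewrite hornerZ hornerXn mulrC -T_dil // lE /combo mulr_suml horner_sum big_seq [RHS]big_seq.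
  apply: eq_bigr => cs /lP[_ gs _]; rewrite hornerZ hornerXn.
  have H := hom_mono (rootlist_ordered gs) L u0; rewrite -/a0 in H.
  move: H; move: (mono cs.2 _) (mono cs.2 _) => x x' H; rewrite exprD -mulrA [x * _]mulrA H !exprD; ring.
have := congr1 (fun q : {poly C} => q`_(t + a0)) P; rewrite coefZ coefXn eqxx mulr1 => ->.
rewrite coef_sum /combo big_filter [RHS]big_mkcond; apply: eq_bigr => cs _ /=.
by rewrite coefZ coefXn eqn_add2r eq_sym; case: eqP; rewrite ?mulr1 ?mulr0.
Qed.

(** Each leading monomial is replaced by the ordered product with that leading term, and the
    difference has a smaller bound. [Rmax] is fixed beforehand because all exponent functions must
    share one bound on [r]. *)
Lemma span_step t a : (t <= Rmax + off)%N -> lpoly dyadic (N a) -> (forall L, (n0 < size L)%N -> N a L = 0) -> below t a ->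
  exists2 l, forall cs, cs \in l -> [/\ dyadic cs.1, all (fun b : gen => b.1 \in rootlist m) cs.2 & (wt cs.2 <= Rmax)%N] &
  a = \sum_(cs <- l) cs.1 *: E Rmax cs.2.
Proof.
elim: t a => [|t IH] a tR PF hn ha.
  by exists [::] => //; rewrite big_nil; exact: below0.
have [l lP lE] := topc_combo PF hn ha.
have lR cs : cs \in l -> (wt cs.2 <= Rmax)%N by case/lP => _ _ _; lia.
pose y := \sum_(cs <- l) cs.1 *: E Rmax cs.2.
have Yy : Ybold m A e y.
  rewrite /y big_seq; elim/big_ind: _ => [|u v|cs /lP[h1 _ _ _]].
  - by rewrite -(subrr 1); apply: Yb_add; [exact: Yb_one|apply: Yb_opp; exact: Yb_one].
  - exact: Yb_add.
  - by apply: Ybold_scale => //; exact: (Ybold_Eh eY).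
have Ny L : N y L = \sum_(cs <- l) cs.1 * N (E Rmax cs.2) L.
  by rewrite /y (N_sum hPsi); apply: eq_bigr => cs _; rewrite (NZ hPsi).
have Ey : N (a - y) = fun L => N a L - N y L.
  by apply: functional_extensionality => L; rewrite (ND hPsi) (NN hPsi).
have Ey' : N y = fun L => \sum_(cs <- l) cs.1 * N (E Rmax cs.2) L.
  exact: functional_extensionality.
have PY := Ybold_lpoly hPsi hbij Yy.
have [||||l2 l2P l2E] := IH (a - y).
- by rewrite ltnW.
- by rewrite Ey; apply: lpoly_sub => //; exact: subring_dyadic.
- move=> L sL; rewrite Ey hn // Ny big_seq big1 ?subr0 // => cs csl.
  have [_ gs sn _] := lP _ csl; rewrite sized_Eh ?mulr0 //.
  rewrite /gsize (perm_big _ (elist_hcnt (lR _ csl) gs)) -/(gsize _); lia.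
- move=> k L h; rewrite Ey (hc_sub _ _ PF PY) Ey'.
  rewrite (@hc_sum _ (@anyR C)) => [|cs]; last by apply: lpoly_scale => //; exact: lpoly_N.
  have -> : \sum_(cs <- l) hc (fun L => cs.1 * N (E Rmax cs.2) L) k L
      = \sum_(cs <- l) cs.1 * (if (k + (size L + off) == t + adjn (unzip1 L))%N then mono cs.2 L else 0).
    rewrite big_seq [RHS]big_seq; apply: eq_bigr => cs csl; have [_ gs _ w] := lP _ csl.
    rewrite (@hc_scale _ (@anyR C)); last exact: lpoly_N.
    rewrite (hc_E (lR _ csl) gs); last by move: h; rewrite -w; lia.
    by rewrite -w addnA [(_ + off + adjn _)%N]addnAC eqn_add2r.
  case: eqP => [E|ne]; last first.
    rewrite big1 => [|cs _]; last by rewrite mulr0.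
    rewrite subr0; apply: ha; lia.
  rewrite -/(combo l L) -lE /topc -E leq_addl addnK subrr //.
exists (l ++ l2) => [cs|]; last by rewrite big_cat /= -l2E -/y addrC subrK.
rewrite mem_cat => /orP[csl|/l2P //]; have [h1 h2 _ _] := lP _ csl; split=> //; exact: lR.
Qed.
End Spanning.

Lemma spanning a : lpoly dyadic (N a) ->
  exists (K R : nat) (hs : 'I_K -> 'I_m -> 'I_m -> nat -> nat) (c : 'I_K -> C),
    [/\ forall k, admissible m R (hs k), forall k, dyadic (c k) & a = \sum_(k < K) c k *: Eh m A e R (hs k)].
Proof.
move=> PF; have [n0 hn] := N_bounded hbij a; have [d Pd] := uniform_N subring_dyadic PF.
(* With at most [n0] points and degree at most [d], a component violating the bound would have
   degree above [d]. *)
pose R := (d.+1 + n0)%N; have hB : below n0 (R + n0 * n0)%N a.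
  move=> k L h; have [sL|sL] := leqP (size L) n0; last exact: hc_long hn sL.
  rewrite /hc nth_default //; apply: leq_trans (size_hpoly subring_dyadic L Pd) _.
  by move: h; rewrite /R; lia.
have [l lP lE] := span_step (leqnn (R + n0 * n0)%N) PF hn hB.
exists (size l), R, (fun k => hcnt (m := m) (nth (0, [::]) l k).2), (fun k => (nth (0, [::]) l k).1).
split=> [k|k|].
- by apply: hcnt_admissible; case: (lP _ (mem_nth (0, [::]) (ltn_ord k))).
- by case: (lP _ (mem_nth (0, [::]) (ltn_ord k))).
- by rewrite lE (big_nth (0, [::])) big_mkord.
Qed.

(** Among the terms with nonzero coefficient, those of maximal weight have monomials that sum to a
    component of 0; [mono_indep] then kills their coefficients. *)
Lemma independence (K R : nat) (hs : 'I_K -> 'I_m -> 'I_m -> nat -> nat) (c : 'I_K -> C) :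
  (forall k, admissible m R (hs k)) -> injective hs ->
  \sum_(k < K) c k *: Eh m A e R (hs k) = 0 -> forall k, c k = 0.
Proof.
move=> hadm hinj h0 k1; apply/eqP/negPn/negP => ck1.
pose s k := elist R (hs k); have Sa := subring_any C.
pose P0 := [pred k | c k != 0]; have [k0 ck0 kmax] := @arg_maxnP _ k1 P0 (fun k => wt (s k)) ck1.
pose P := [pred k | (c k != 0) && (wt (s k) == wt (s k0))].
have E := @mono_indep C m (rootlist m) [::] erefl _ c s P.
case/negP: (ck0 : c k0 != 0); apply/eqP/E => [k _|k k' _ _ /elist_inj h|L|]; last by rewrite /P /= (ck0 : c k0 != 0) eqxx.
- exact: elist_all.
- by apply: hinj; apply: h; exact: hadm.
have [le|lt] := leqP (size L) (wt (s k0) + adjn (unzip1 L)); last first.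
  rewrite big1 // => k /andP[_ /eqP w]; rewrite mono_short ?mulr0 ?w //; exact: elist_all.
pose q := (wt (s k0) + adjn (unzip1 L) - size L)%N.
have : hc (N (\sum_(k < K) c k *: Eh m A e R (hs k))) q L = 0.
  by rewrite h0 /hc (hpoly_unique (q := 0)) ?coef0 // => t; rewrite horner0 (N0 hPsi).
have -> : N (\sum_(k < K) c k *: Eh m A e R (hs k)) = fun L => \sum_(k < K) c k * N (Eh m A e R (hs k)) L.
  apply: functional_extensionality => L'.
  by rewrite (N_sum hPsi); apply: eq_bigr => k _; rewrite (NZ hPsi).
rewrite (@hc_sum _ (@anyR C)) => [|k]; last by apply: lpoly_scale => //; exact: lpoly_N.
move=> H; rewrite -[RHS]H big_mkcond; apply: eq_bigr => k _.
rewrite (@hc_scale _ (@anyR C)); last exact: lpoly_N.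
have [->|ck] := eqVneq (c k) 0; first by rewrite !mul0r; case: (P k).
have wk : (wt (s k) <= wt (s k0))%N by exact: kmax.
rewrite /P /= ck (lead_hc Sa (lpoly_N _ _) (lpoly_mono _ (s k)) (lead_Eh hPsi hbij R (hs k))) /q; last by rewrite subnK // leq_add2r.
by rewrite subnK // eqn_add2r eq_sym; case: eqP; rewrite ?mulr0.
Qed.
End PBWBasis.

Theorem theorem2p14 (n : nat) (hn : (2 <= n)%N)
  (A : algType C) (e : 'I_(n.-1) -> nat -> A)
  (hY : is_Yangian (n.-1) A e)
  (Psi : A -> Wfam (n.-1))
  (hPsi : Psi_hom (n.-1) A e Psi) (hbij : Psi_bij (n.-1) A Psi) :
  (forall a : A, Ybold (n.-1) A e a <-> Wbold (n.-1) (Psi a)) /\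
  [/\ forall (R : nat) (h : 'I_(n.-1) -> 'I_(n.-1) -> nat -> nat),
        admissible (n.-1) R h -> Ybold (n.-1) A e (Eh (n.-1) A e R h),
      forall (N R : nat) (hs : 'I_N -> 'I_(n.-1) -> 'I_(n.-1) -> nat -> nat)
             (c : 'I_N -> C),
        (forall k, admissible (n.-1) R (hs k)) -> injective hs ->
        (forall k, dyadic (c k)) ->
        \sum_(k < N) c k *: Eh (n.-1) A e R (hs k) = 0 ->
        forall k, c k = 0 &
      forall y : A, Ybold (n.-1) A e y ->
        exists (N R : nat) (hs : 'I_N -> 'I_(n.-1) -> 'I_(n.-1) -> nat -> nat)
               (c : 'I_N -> C),
          [/\ forall k, admissible (n.-1) R (hs k),
              forall k, dyadic (c k) &
              y = \sum_(k < N) c k *: Eh (n.-1) A e R (hs k)]].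
Proof.
have [eY _] := hY.
split=> [a|]; last split=> [R h _|K R hs c hadm hinj _|y Yy].
- split=> [Ya|Wa].
    by move=> K mon; apply: (num_lpolyS subring_dyadic (Psi_sym hbij a) (Ybold_lpoly hPsi hbij Ya)).
  (* Spanning assumes only integral numerators, so it yields the reverse inclusion here as well as
     the spanning half of the basis statement. *)
  have [K [R [hs [c [_ dc ->]]]]] := spanning eY hPsi hbij (lpoly_num subring_dyadic Wa).
  by apply: Ybold_sum => k; apply: Ybold_scale => //; exact: (Ybold_Eh eY).
- exact: (Ybold_Eh eY).
- exact: (independence hPsi hbij hadm hinj).
- by apply: (spanning eY hPsi hbij); exact: (Ybold_lpoly hPsi hbij Yy).
Qed.
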